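(* Let $q$ be a prime power. (a) Let $C\subset\mathbb{P}^2$ be a nonsingular plane curve of degree $d$ defined over $\mathbb{F}_q$ without an $\mathbb{F}_q$-linear component. Unless $q=4$ and $C$ is projectively equivalent over $\mathbb{F}_4$ to the curve $$X^4+Y^4+Z^4+X^2Y^2+Y^2Z^2+Z^2X^2+X^2YZ+XY^2Z+XYZ^2=0,$$ one has $N_q(C)\le (d-1)q+1$. (b) For every $d\ge 2$ with $d\in\{q+2,\;q+1,\;q,\;q-1,\;2\}$, and also for $d=\sqrt q+1$ when $q$ is a square, there exists a nonsingular plane curve $C$ of degree $d$ over $\mathbb{F}_q$ with $N_q(C)=(d-1)q+1$.
   Context: A plane curve $C$ of degree $d$ over $\mathbb{F}_q$ is given by a nonzero homogeneous polynomial $F(X,Y,Z)\in\mathbb{F}_q[X,Y,Z]$ of degree $d$. It is without an $\mathbb{F}_q$-linear component if $F$ has no factor of degree $1$ with coefficients in $\mathbb{F}_q$. $C(\mathbb{F}_q)$ is the set of points $(\alpha,\beta,\gamma)\in\mathbb{P}^2(\mathbb{F}_q)$ with $F(\alpha,\beta,\gamma)=0$, and $N_q(C)=\#C(\mathbb{F}_q)$. Two curves are projectively equivalent over $\mathbb{F}_q$ if one is carried to the other by an element of $PGL_3(\mathbb{F}_q)$ (i.e. their equations agree up to an invertible $\mathbb{F}_q$-linear change of variables and a nonzero scalar factor). Nonsingular means that $F$ and its partial derivatives have no common zero in $\mathbb{P}^2(\overline{\mathbb{F}}_q)$. *)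

(* Defs.v *)
From HB Require Import structures.
From mathcomp Require Import all_boot all_order all_algebra all_field.
From mathcomp Require Import mpoly.

Set Implicit Arguments.
Unset Strict Implicit.
Unset Printing Implicit Defensive.

Import GRing.Theory.
Local Open Scope ring_scope.

(* The variables X, Y, Z are 'X_0, 'X_1, 'X_2; vectors of homogeneous
   coordinates are row vectors. *)
Section PlaneCurves.

Variable F : finFieldType.
Implicit Types (f g : {mpoly F[3]}) (d : nat).

(* A curve has positive degree: nonzero constants are excluded. *)
Definition is_plane_curve d f : Prop :=
  [/\ (0 < d)%N, f != 0 & f \is d.-homog].

(* [msize l = 2] says that l has total degree 1. *)
Definition no_linear_component f : Prop :=
  ~ exists l g : {mpoly F[3]}, msize l = 2%N /\ f = l * g.

(* The point of P^2(F) with homogeneous coordinates v != 0, as the class of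
   all nonzero multiples of v. *)
Definition proj_point (v : 'rV[F]_3) : {set 'rV[F]_3} :=
  [set a *: v | a : F & a != 0].

Definition rational_points f : {set {set 'rV[F]_3}} :=
  [set proj_point v | v : 'rV[F]_3 & (v != 0) && (f.@[fun i => v 0 i] == 0)].

Definition num_points f : nat := #|rational_points f|.

Definition linear_subst (A : 'M[F]_3) f : {mpoly F[3]} :=
  f \mPo [tuple \sum_(j < 3) A i j *: 'X_j | i < 3].

Definition proj_equiv f g : Prop :=
  exists (A : 'M[F]_3) (c : F),
    [/\ A \in unitmx, c != 0 & g = c *: linear_subst A f].

Definition alg_closure : closedFieldType :=
  projT1 (countable_algebraic_closure F).

Definition to_alg_closure : {rmorphism F -> alg_closure} :=
  sval (projT2 (countable_algebraic_closure F)).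

Definition nonsingular f : Prop :=
  let fbar := map_mpoly to_alg_closure f in
  ~ exists v : 'rV[alg_closure]_3,
      [/\ v != 0,
          fbar.@[fun i => v 0 i] = 0
        & forall k : 'I_3, (mderiv k fbar).@[fun i => v 0 i] = 0].

Definition exceptional_quartic : {mpoly F[3]} :=
  let X : {mpoly F[3]} := 'X_(0 : 'I_3) in
  let Y : {mpoly F[3]} := 'X_(1 : 'I_3) in
  let Z : {mpoly F[3]} := 'X_(2 : 'I_3) in
  X ^+ 4 + Y ^+ 4 + Z ^+ 4
  + X ^+ 2 * Y ^+ 2 + Y ^+ 2 * Z ^+ 2 + Z ^+ 2 * X ^+ 2
  + X ^+ 2 * Y * Z + X * Y ^+ 2 * Z + X * Y * Z ^+ 2.

End PlaneCurves.

Arguments exceptional_quartic F : clear implicits.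

(* Main.v *)
(* For d < q, each prime factor of the equation has a least k < d for which the coefficient
   of s^k in F (X + s X^q) is not divisible by the factor. Every smooth rational point carries
   a formal branch, along which that coefficient vanishes to order k + 1, so Bezout's theorem
   gives N (k + 1) <= d (d - k + k q), and hence the bound.
     For d >= q the bound comes from lines: a rational line meets the curve in n points and is
   tangent at t of them with n + t <= d. Summing over all lines, N (q + 2) <= d (q^2 + q + 1),
   which settles d = q + 1 and leaves only N = q^2 - q + 2 when d = q. In that case the set M of
   the 2 q - 1 rational points off the curve meets all lines; since a form of degree 2 (q - 1)
   cannot be nonzero at exactly one rational point, M minus a point R is never covered by
   q - 2 lines avoiding R. Counting then forces q = 4, and M is a Fano plane on which
   the quartic is constant in suitable coordinates, so that the quartic is the exceptional one.
     The extremal curves are explicit: X Z - Y^2, the Hermitian curve, a diagonal curve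
   of degree q - 1, and two four-term curves of degrees q and q + 1. In degree q + 2 take
   det (A P, P, P^q), where A is the companion matrix of a polynomial t^3 - t + c without
   roots in F_q: it vanishes at every rational point. *)

Require Import Defs.
From HB Require Import structures.
From mathcomp Require Import all_boot all_order all_algebra all_field.
From mathcomp Require Import mpoly ring zify.
From Stdlib Require Import Classical.

Set Implicit Arguments.
Unset Strict Implicit.
Unset Printing Implicit Defensive.

Import GRing.Theory.
Local Open Scope ring_scope.

(** * Factorial polynomial rings *)

(** The upper bounds use nonsingularity at rational points only, a property that every factor of the
    equation inherits. Below degree q the curve may be reducible, and Bezout's theorem needs two
    curves without common component; this is why polynomial rings are shown to be factorial. A prime
    factor of degree e has at most e q - (q - 1) points, any other product of factors at most q
    times its degree, and one saving of q - 1 is enough. The order k cannot be fixed in advance: for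
    the Hermitian curve of degree r + 1, q = r^2, the coefficient of s is the r-th power of the
    equation and the least k is r, where N (r + 1) <= (r + 1) (1 + r q) is sharp. Bezout's theorem
    is needed only at rational points, for branches known modulo a power of t, so it reduces to a
    dimension count over F. In degree q, the number 2 (q - 1) is a multiple of q - 1, so that values
    depend only on the point, and is below 3 (q - 1), so that values over F^3 sum to 0. A form of
    degree q vanishing at all rational points is zero; hence the exceptional quartic is recognized
    by its values alone. *)

Section Factoriality.

Variable R : idomainType.

Definition divides (a b : R) : Prop := exists c, b = a * c.

Definition prime_elt (p : R) : Prop :=
  [/\ p != 0, p \isn't a GRing.unit
    & forall a b, divides p (a * b) -> divides p a \/ divides p b].

(** The factors are asked to be prime rather than irreducible, so uniqueness of the factorization is
    built in and never has to be stated. *)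
Definition is_factorial : Prop := forall a, a != 0 -> exists (u : R) (s : seq R),
  [/\ u \is a GRing.unit, {in s, forall p, prime_elt p} & a = u * \prod_(p <- s) p].

Lemma dividesMr a b c : divides a b -> divides a (b * c).
Proof. by case=> d ->; exists (d * c); rewrite mulrA. Qed.

Lemma dividesMl a b c : divides a b -> divides a (c * b).
Proof. by rewrite mulrC; apply: dividesMr. Qed.

Lemma dividesD a b c : divides a b -> divides a c -> divides a (b + c).
Proof. by case=> x -> [y ->]; exists (x + y); rewrite mulrDr. Qed.

Lemma dividesB a b c : divides a b -> divides a c -> divides a (b - c).
Proof. by case=> x -> [y ->]; exists (x - y); rewrite mulrBr. Qed.

Lemma divides_trans a b c : divides a b -> divides b c -> divides a c.
Proof. by case=> x -> [y ->]; exists (x * y); rewrite mulrA. Qed.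

Lemma prime_elt_prod p u (s : seq R) :
    prime_elt p -> u \is a GRing.unit -> divides p (u * \prod_(x <- s) x) ->
  exists2 x, x \in s & divides p x.
Proof.
case=> p0 pu pP uu; elim: s => [|x s IHs].
  rewrite big_nil mulr1 => -[c uE]; move: uu; rewrite uE unitrM.
  by rewrite (negPf pu).
rewrite big_cons mulrCA => /pP[px|/IHs[y ys py]]; first by exists x; rewrite ?mem_head.
by exists y; rewrite // inE ys orbT.
Qed.

Lemma prime_elt_divides_sym p x :
  prime_elt p -> prime_elt x -> divides p x -> divides x p.
Proof.
case=> p0 pu _ [x0 xu xP] [c xE].
have [//|[e cE]] : divides x p \/ divides x c by apply: xP; exists 1; rewrite mulr1 xE.
have : x * (p * e) = x * 1.
  by rewrite mulr1 [RHS]xE cE mulrCA.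
move/(mulfI x0) => pe; case/negP: pu; apply/unitrPr; by exists e.
Qed.

End Factoriality.

Section PolyFactoriality.

Variable R : idomainType.
Hypothesis factR : is_factorial R.

Implicit Types (p c : R) (f g r b : {poly R}).

(** Stands for content 1: the coefficient ring comes with prime factorizations but without a gcd. *)
Definition const_primitive f : Prop :=
  forall p, prime_elt p -> ~ divides p%:P f.

Lemma dividesXr p f : p != 0 -> divides p%:P (f * 'X) -> divides p%:P f.
Proof.
move=> p0 [c fE]; have c0 : root c 0.
  have := congr1 (fun h : {poly R} => h`_0) fE.
  rewrite coefMX coefCM eqxx => /esym/eqP.
  by rewrite mulf_eq0 (negPf p0) /= -horner_coef0.
have [c' cE] := factor_theorem c 0 c0; exists c'.
by move: fE; rewrite cE subr0 mulrA => /(mulIf (negbT (polyX_eq0 R))).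
Qed.

(** Gauss's lemma. If [p] divides a product, it divides the product of the constant terms, hence one
    of them; removing this term from its factor and dividing by ['X] leaves a smaller instance. *)
Lemma prime_elt_polyC p : prime_elt p -> prime_elt p%:P.
Proof.
move=> [p0 pu pP]; split; first by rewrite polyC_eq0.
  by rewrite poly_unitE size_polyC p0 coefC eqxx.
elim/poly_ind => [|f c IHf] g; first by move=> _; left; exists 0; rewrite mulr0.
elim/poly_ind: g => [|g e IHg]; first by move=> _; right; exists 0; rewrite mulr0.
have const x y : divides x y -> divides x%:P y%:P.
  by case=> z ->; exists z%:P; rewrite polyCM.
move=> pfg; have : divides p (c * e).
  case: pfg => h hE; exists h`_0.
  have := congr1 (fun h : {poly R} => h`_0) hE.
  by rewrite coef0M coefCM !coefD !coefMX !coefC !eqxx !add0r.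
case/pP => [/const pc|/const pe].
  have : divides p%:P (f * (g * 'X + e%:P)).
    apply: dividesXr => //; have := dividesB pfg (dividesMr (g * 'X + e%:P) pc).
    by rewrite mulrDl addrK mulrAC.
  case/IHf; [left|by right]; apply: dividesD pc; exact: dividesMr.
have : divides p%:P ((f * 'X + c%:P) * g).
  apply: dividesXr => //; have := dividesB pfg (dividesMl (f * 'X + c%:P) pe).
  by rewrite mulrDr addrK mulrA.
case/IHg; [by left|right]; apply: dividesD pe; exact: dividesMr.
Qed.

(** Every prime constant of [c] divides [f * r], hence [r] by Gauss's lemma because [f] is
    primitive; the primes are cancelled one at a time. *)
Lemma const_primitive_cancel c f b r :
    c != 0 -> const_primitive f -> c%:P * b = f * r ->
  exists r', b = f * r'.
Proof.
move=> /factR[u [s [uu + ->]]] primf.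
elim: s b r => [|p s IHs] b r sP.
  rewrite big_nil mulr1 => bE; exists ((u^-1)%:P * r).
  by rewrite mulrCA -bE mulrA -polyCM mulVr // mul1r.
rewrite big_cons mulrCA polyCM -mulrA => bE.
have pp : prime_elt p by apply: sP; rewrite mem_head.
have [p0 _ _] := pp; have p0' : p%:P != 0 by rewrite polyC_eq0.
have : divides p%:P (f * r) by rewrite -bE; exists ((u * \prod_(x <- s) x)%:P * b).
have [_ _ pcP] := prime_elt_polyC pp.
case/pcP => [/(primf _ pp)//|[r1 rE]].
apply: (IHs _ r1) => [x xs|]; first by apply: sP; rewrite inE xs orbT.
by apply: (mulfI p0'); rewrite bE rE mulrCA.
Qed.

(** Each prime constant of [c] divides [g] or [r] by Gauss's lemma and is divided out there; sizes
    are unaffected since only constants are removed. *)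
Lemma const_distribute c f g r :
    c != 0 -> c%:P * f = g * r ->
  exists g' r', [/\ f = g' * r', size g' = size g & size r' = size r].
Proof.
move=> /factR[u [s [uu + ->]]].
elim: s f g r => [|p s IHs] f g r sP.
  rewrite big_nil mulr1 => fE; exists ((u^-1)%:P * g), r; split => //.
    by rewrite -mulrA -fE mulrA -polyCM mulVr // mul1r.
  rewrite size_Cmul //; apply: contraTneq uu => /eqP.
  by rewrite invr_eq0 => /eqP->; rewrite unitr0.
rewrite big_cons mulrCA polyCM -mulrA => fE.
have pp : prime_elt p by apply: sP; rewrite mem_head.
have [p0 _ _] := pp; have p0' : p%:P != 0 by rewrite polyC_eq0.
have {}sP x : x \in s -> prime_elt x by move=> xs; apply: sP; rewrite inE xs orbT.
have : divides p%:P (g * r) by rewrite -fE; exists ((u * \prod_(x <- s) x)%:P * f).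
have [_ _ pcP] := prime_elt_polyC pp.
case/pcP => -[h hE].
  have [|g' [r' [-> szg szr]]] := IHs f h r sP.
    by apply: (mulfI p0'); rewrite fE hE mulrA.
  by exists g', r'; rewrite szg hE size_Cmul.
have [|g' [r' [-> szg szr]]] := IHs f g h sP.
  by apply: (mulfI p0'); rewrite fE hE mulrCA.
by exists g', r'; rewrite szr hE size_Cmul.
Qed.

(** If [f] is coprime to [a], it divides [b] up to a constant. Otherwise their gcd has positive
    degree, and irreducibility makes it associated to [f]. *)
Lemma prime_elt_poly f :
    const_primitive f -> (1 < size f)%N ->
    (forall g r, f = g * r -> (1 < size g)%N -> (size r <= 1)%N) ->
  prime_elt f.
Proof.
move=> primf sf irrf; have f0 : f != 0 by rewrite -size_poly_gt0 ltnW.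
split => //.
  by rewrite poly_unitE gtn_eqF.
move=> a b [h abE]; have dvdab : f %| a * b by rewrite abE dvdp_mulr.
(* Over a domain [%|] is divisibility up to a nonzero constant; this constant is cancelled by
   primitivity. *)
have fin x : f %| x -> divides f x.
  case/Pdiv.Idomain.dvdpP => -[c y] /= c0; rewrite -mul_polyC mulrC.
  move=> xE; apply: (@const_primitive_cancel c f x y) => //.
  by rewrite mulrC xE mulrC.
have [cop|ncop] := boolP (coprimep f a).
  by right; apply: fin; rewrite -(Gauss_dvdpr _ cop).
left; apply: fin; have g0 : gcdp f a != 0 by rewrite gcdp_eq0 negb_and f0.
have gsz : (1 < size (gcdp f a))%N.
  by rewrite ltn_neqAle eq_sym -coprimep_def ncop size_poly_gt0.
case/Pdiv.Idomain.dvdpP: (dvdp_gcdl f a) => -[c y] /= c0.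
rewrite -mul_polyC mulrC [y * _]mulrC => fE.
have [|g' [r' [fE' szg szr]]] := @const_distribute c f (gcdp f a) y c0.
  by rewrite mulrC.
have := irrf _ _ fE'; rewrite szg => /(_ gsz) szr1.
have fg : f %= gcdp f a.
  rewrite eqp_sym -dvdp_size_eqp ?dvdp_gcdl //.
  have r0 : r' != 0 by apply: contraNneq f0 => z0; rewrite fE' z0 mulr0.
  have g'0 : g' != 0 by apply: contraNneq f0 => z0; rewrite fE' z0 mul0r.
  move: szr1; rewrite -ltnS -[size r']prednK ?size_poly_gt0 // !ltnS leqn0 => /eqP szr1.
  rewrite -szg fE' size_mul // -[size r']prednK ?size_poly_gt0 // szr1.
  by rewrite addn1.
by rewrite (eqp_dvdl _ fg) dvdp_gcdr.
Qed.

(** A prime constant dividing [f] also divides its leading coefficient, so the number of prime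
    factors of the latter bounds how often a constant can be extracted; this is the induction
    measure. *)
Lemma const_content f : f != 0 -> exists s f',
  [/\ {in s, forall p, prime_elt p}, const_primitive f', size f' = size f
    & f = (\prod_(p <- s) p)%:P * f'].
Proof.
move=> f0; have [u [s [uu]]] := factR (etrans (congr1 negb (lead_coef_eq0 f)) f0).
have [n] := ubnP (size s); elim: n => // n IHn in s f f0 *.
rewrite ltnS => szs sP lcE.
have [primf|] := classic (const_primitive f).
  by exists [::], f; rewrite big_nil mul1r; split.
move=> nprim; have [p npf] := not_all_ex_not _ _ nprim.
have [pp /NNPP pf] := imply_to_and _ _ npf.
have [x xs px] : exists2 x, x \in s & divides p x.
  apply: (prime_elt_prod pp uu); rewrite -lcE; case: pf => h ->.
  by exists (lead_coef h); rewrite lead_coefM lead_coefC.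
have xp := prime_elt_divides_sym pp (sP _ xs) px.
have [h fE] : divides x%:P f.
  apply: divides_trans pf; case: xp => e ->.
  by exists e%:P; rewrite polyCM.
have [x0 _ _] := sP _ xs.
have h0 : h != 0 by apply: contraNneq f0 => h0; rewrite fE h0 mulr0.
have [|||s' [f' [s'P primf' sz hE]]] := IHn (rem x s) h h0.
- by rewrite size_rem //; case: (s) xs szs.
- by move=> y /mem_rem; apply: sP.
- apply: (mulfI x0); have := lcE; rewrite fE lead_coefM lead_coefC => ->.
  by rewrite (big_rem x) //= mulrCA.
exists (x :: s'), f'; split => //.
- by move=> y; rewrite inE => /predU1P[->|/s'P]; [apply: sP|].
- by rewrite sz fE size_Cmul.
- by rewrite big_cons polyCM -mulrA -hE.
Qed.

(** Once the content is split off, a primitive polynomial is either prime by [prime_elt_poly] or a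
    product of two polynomials of smaller degree. *)
Theorem is_factorial_poly : is_factorial {poly R}.
Proof.
move=> f; have [n] := ubnP (size f); elim: n => // n IHn in f *.
rewrite ltnS => szf f0; have [s [f' [sP primf' sz fE]]] := const_content f0.
have f'0 : f' != 0 by rewrite -size_poly_eq0 sz size_poly_eq0.
suff [u [t [uu tP f'E]]] : exists (u : {poly R}) (t : seq {poly R}),
    [/\ u \is a GRing.unit, {in t, forall p : {poly R}, prime_elt p} & f' = u * \prod_(p <- t) p].
  exists u, (map polyC s ++ t); split => //.
    move=> p; rewrite mem_cat => /orP[/mapP[y /sP yp ->]|/tP//].
    exact: prime_elt_polyC.
  by rewrite fE f'E big_cat /= big_map rmorph_prod mulrCA.
have [sz1|sz1] := leqP (size f') 1.
  rewrite (size1_polyC sz1) in primf' f'0 *; rewrite polyC_eq0 in f'0.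
  have [u [[|p t] [uu tP uE]]] := factR f'0.
    exists (f'`_0)%:P, [::]; split; rewrite ?big_nil ?mulr1 //.
    by rewrite uE big_nil mulr1 rmorph_unit.
  have := primf' p (tP _ (mem_head _ _)); case.
  by rewrite uE big_cons mulrCA polyCM; exists (u * \prod_(x <- t) x)%:P.
have [[g [r [f'E szg szr]]]|irr] := classic (exists g r,
    [/\ f' = g * r, (1 < size g)%N & (1 < size r)%N]); last first.
  exists 1, [:: f']; split; rewrite ?unitr1 ?big_seq1 ?mul1r //.
  move=> x; rewrite inE => /eqP->; apply: prime_elt_poly => // g r f'E szg.
  by rewrite leqNgt; apply/negP => szr; apply: irr; exists g, r.
have g0 : g != 0 by rewrite -size_poly_gt0 ltnW.
have r0 : r != 0 by rewrite -size_poly_gt0 ltnW.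
have szgr : size f' = (size g + size r).-1 by rewrite f'E size_mul.
have [||u1 [t1 [u1u t1P gE]]] := IHn g => //.
  apply: leq_trans szf; rewrite -sz szgr -(prednK (ltnW szr)) addnS /= -addn1.
  by rewrite leq_add2l -ltnS prednK // ltnW.
have [||u2 [t2 [u2u t2P rE]]] := IHn r => //.
  apply: leq_trans szf; rewrite -sz szgr -(prednK (ltnW szg)) addSn /= addnC -addn1.
  by rewrite leq_add2l -ltnS prednK // ltnW.
exists (u1 * u2), (t1 ++ t2); split; first by rewrite unitrM u1u.
  by move=> x; rewrite mem_cat => /orP[/t1P|/t2P].
by rewrite f'E gE rE big_cat /= mulrACA.
Qed.

End PolyFactoriality.

Lemma mpoly_rmorph_ext (R S : comNzRingType) n (f g : {rmorphism {mpoly R[n]} -> S}) :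
    (forall c, f c%:MP = g c%:MP) -> (forall i, f 'X_i = g 'X_i) -> f =1 g.
Proof.
move=> fgC fgX p; rewrite [p]mpolyE !rmorph_sum; apply: eq_bigr => m _.
rewrite -mul_mpolyC !rmorphM fgC mpolyXE_id !rmorph_prod; congr (_ * _).
by apply: eq_bigr => i _; rewrite !rmorphXn /= fgX.
Qed.

Lemma factorial_transport (R S : idomainType) (f : {rmorphism R -> S})
    (g : {rmorphism S -> R}) :
  cancel f g -> cancel g f -> is_factorial R -> is_factorial S.
Proof.
move=> fK gK factR a a0; have ga0 : g a != 0.
  by apply: contraNneq a0 => ga0; rewrite -(gK a) ga0 rmorph0.
have [u [s [uu sP gaE]]] := factR _ ga0; exists (f u), (map f s); split.
- exact: rmorph_unit.
- move=> _ /mapP[p /sP[p0 pu pP] ->]; split.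
  + by apply: contraNneq p0 => fp0; rewrite -(fK p) fp0 rmorph0.
  + by apply: contraNN pu => /(rmorph_unit g); rewrite fK.
  + move=> x y [c xyE]; have : divides p (g x * g y).
      by exists (g c); rewrite -rmorphM xyE rmorphM fK.
    case/pP=> -[e eE]; [left|right]; exists (f e); by rewrite -rmorphM -eE gK.
- by rewrite -(gK a) gaE rmorphM rmorph_prod big_map.
Qed.

Section MultiToUni.

Variables (R : idomainType) (n : nat).

(** The inverse of [muni]; through this isomorphism factoriality passes from n to n + 1
    variables. *)
Definition of_uni : {poly {mpoly R[n]}} -> {mpoly R[n.+1]} :=
  horner_eval 'X_ord_max \o map_poly (@mwiden n R).

HB.instance Definition _ := GRing.RMorphism.on of_uni.

Lemma of_uniC c : of_uni c%:P = mwiden c.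
Proof. by rewrite /of_uni /= map_polyC /= /horner_eval hornerC. Qed.

Lemma of_uniX : of_uni 'X = 'X_ord_max.
Proof. by rewrite /of_uni /= map_polyX /horner_eval hornerX. Qed.

Lemma muniXU (i : 'I_n.+1) :
  muni ('X_i : {mpoly R[n.+1]}) =
  if unlift ord_max i is Some j then ('X_j)%:P else 'X.
Proof.
rewrite muniE msuppX big_seq1 mcoeffX eqxx scale1r mnm1E.
case: unliftP => [j|] ->.
  rewrite eq_sym (negPf (neq_lift _ _)) expr0 alg_polyC; congr ('X_[_])%:P.
  apply/mnmP => k; rewrite mnmE !mnm1E; congr (nat_of_bool _).
  by rewrite -!val_eqE /= /bump leqNgt ltn_ord add0n.
rewrite eqxx expr1 -[RHS]scale1r; congr (_ *: _); rewrite -mpolyX0; congr ('X_[_]).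
apply/mnmP => k; rewrite mnmE !mnm1E mnm0E -val_eqE /= gtn_eqF //.
Qed.

Lemma muniK : cancel (@muni n R) of_uni.
Proof.
have E : (of_uni \o @muni n R) =1 idfun.
  apply: mpoly_rmorph_ext => [c|i] /=; first by rewrite muniC of_uniC mwidenC.
  rewrite muniXU; case: unliftP => [j|] ->; last exact: of_uniX.
  rewrite of_uniC mwidenX mnmwiden1; congr ('X_[U_( _)]).
  by apply: val_inj; rewrite /= /bump leqNgt ltn_ord.
exact: E.
Qed.

Lemma muni_mwiden (p : {mpoly R[n]}) : muni (mwiden p) = p%:P.
Proof.
have E : (@muni n R \o @mwiden n R) =1 polyC.
  apply: mpoly_rmorph_ext => [c|i] /=; first by rewrite mwidenC muniC.
  rewrite mwidenX mnmwiden1 muniXU; case: unliftP => [j /(congr1 val)|/(congr1 val)] /=.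
    by rewrite /bump leqNgt ltn_ord add0n => ij; congr ('X_[U_( _)])%:P; apply: val_inj.
  by move=> im; have := ltn_ord i; rewrite im ltnn.
exact: E.
Qed.

Lemma of_uniK : cancel of_uni (@muni n R).
Proof.
elim/poly_ind => [|p c IHp]; first by rewrite !rmorph0.
have -> : of_uni (p * 'X + c%:P) = of_uni p * 'X_ord_max + mwiden c.
  by rewrite -of_uniC -of_uniX -rmorphM -rmorphD.
rewrite muniD muniM IHp muni_mwiden muniXU.
by case: unliftP => // j /eqP; rewrite (negPf (neq_lift _ _)).
Qed.

End MultiToUni.

Theorem is_factorial_mpoly (R : idomainType) n :
  is_factorial R -> is_factorial {mpoly R[n]}.
Proof.
move=> factR; elim: n => [|n IHn].
  apply: (@factorial_transport _ _ (@mpolyC 0 R) (mcoeff 0%MM)) factR.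
    exact: mpolyCK.
  by move=> p; rewrite [RHS]nvar0_mpolyC.
exact: (factorial_transport (@of_uniK R n) (@muniK R n) (is_factorial_poly IHn)).
Qed.

Lemma is_factorial_field (F : fieldType) : is_factorial F.
Proof.
move=> a a0; exists a, [::]; split => //; first by rewrite unitfE.
by rewrite big_nil mulr1.
Qed.

(** The degree is an argument of [P] because 0 is homogeneous of every degree. Building forms by
    multiplication with one variable avoids monomial expansions in later proofs. *)
Lemma homog_ind (R : comNzRingType) n (P : nat -> {mpoly R[n]} -> Prop) :
    (forall d, P d 0) -> (forall d p q, P d p -> P d q -> P d (p + q)) ->
    (forall d c p, P d p -> P d (c *: p)) -> P 0%N 1 ->
    (forall d p i, P d p -> P d.+1 (p * 'X_i)) ->
  forall d p, p \is d.-homog -> P d p.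
Proof.
move=> P0 PD PZ P1 PX.
have Pm m : P (mdeg m) 'X_[m].
  have [d] := ubnP (mdeg m); elim: d => // d IHd in m *; rewrite ltnS => md.
  have [/eqP|m0] := eqVneq (mdeg m) 0%N.
    by rewrite mdeg_eq0 => /eqP->; rewrite mdeg0 mpolyX0.
  have [i mi] : exists i, m i != 0%N.
    apply/existsP; rewrite -negb_forall; apply: contra m0 => /forallP m0.
    by rewrite mdegE big1 // => i _; apply/eqP.
  have mE : m = (m - U_(i) + U_(i))%MM by rewrite submK // lep1mP.
  move: md; rewrite mE mdegD mdeg1 addn1 => md.
  by rewrite mpolyXD; apply: PX; apply: IHd.
move=> d p /dhomogP hp; rewrite [p]mpolyE big_seq; apply: (big_ind (P d)) => //.
  exact: PD.
by move=> m /hp <-; apply/PZ/Pm.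
Qed.

(** * Expansion of forms along parametrised lines, and gradings *)

Section Evaluation.

Variables (R S : comNzRingType) (n : nat) (iota : {rmorphism R -> S}).
Implicit Types (p : {mpoly R[n]}) (V W : 'I_n -> S).

Lemma mmap_eq V W p : V =1 W -> mmap iota V p = mmap iota W p.
Proof.
by move=> VW; apply: eq_bigr => m _; rewrite (mmap1_eq _ VW).
Qed.

Lemma mmapM V p q : mmap iota V (p * q) = mmap iota V p * mmap iota V q.
Proof. exact: rmorphM. Qed.

Lemma mmapXU V i : mmap iota V 'X_i = V i.
Proof. by rewrite mmapX mmap1U. Qed.

Lemma rmorph_mmap (T : comNzRingType) (psi : {rmorphism S -> T}) V p :
  psi (mmap iota V p) = mmap (psi \o iota) (psi \o V) p.
Proof.
rewrite rmorph_sum; apply: eq_bigr => m _; rewrite rmorphM; congr (_ * _).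
by rewrite rmorph_prod; apply: eq_bigr => i _; rewrite rmorphXn.
Qed.

Lemma mmap_scale d p V c :
  p \is d.-homog -> mmap iota (fun i => c * V i) p = c ^+ d * mmap iota V p.
Proof.
move: d p; apply: homog_ind => [d|d p q IHp IHq|d e p IHp||d p i IHp].
- by rewrite !rmorph0 mulr0.
- by rewrite !mmapD IHp IHq mulrDr.
- by rewrite !mmapZ IHp mulrCA.
- by rewrite !rmorph1 mulr1.
- by rewrite !mmapM !mmapXU IHp exprSr mulrACA.
Qed.

(** The expansion of p(V + t W) in powers of t. The ring [S] is left free so that [V] and [W] may be
    points over the field, formal branches, or the generic point (X : Y : Z). *)
Definition along V W p : {poly S} :=
  mmap (polyC \o iota) (fun i => (V i)%:P + (W i)%:P * 'X) p.

HB.instance Definition _ V W := GRing.RMorphism.copy (along V W)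
  (mmap (polyC \o iota) (fun i => (V i)%:P + (W i)%:P * 'X)).

Lemma alongM V W p q : along V W (p * q) = along V W p * along V W q.
Proof. exact: rmorphM. Qed.

Lemma alongD V W p q : along V W (p + q) = along V W p + along V W q.
Proof. exact: rmorphD. Qed.

Lemma alongXU V W i : along V W 'X_i = (V i)%:P + (W i)%:P * 'X.
Proof. by rewrite /along mmapX mmap1U. Qed.

Lemma alongZ V W c p : along V W (c *: p) = (iota c)%:P * along V W p.
Proof. by rewrite /along mmapZ. Qed.

Lemma horner_along V W p a : (along V W p).[a] = mmap iota (fun i => V i + W i * a) p.
Proof.
rewrite -/(horner_eval a _) /along rmorph_sum; apply: eq_bigr => m _.
rewrite rmorphM /= /horner_eval hornerC; congr (_ * _).
rewrite -/(horner_eval a _) rmorph_prod; apply: eq_bigr => i _.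
by rewrite rmorphXn /= /horner_eval hornerD hornerM !hornerC hornerX.
Qed.

Lemma along_coef0 V W p : (along V W p)`_0 = mmap iota V p.
Proof.
by rewrite -horner_coef0 horner_along; apply: mmap_eq => i; rewrite mulr0 addr0.
Qed.

Lemma along_coef1 V W p :
  (along V W p)`_1 = \sum_i W i * mmap iota V (mderiv i p).
Proof.
elim/mpolyind: p => [|c m p _ _ IHp].
  by rewrite rmorph0 coef0 big1 // => i _; rewrite mderiv0 rmorph0 mulr0.
rewrite alongD coefD {}IHp alongZ coefCM.
under [RHS]eq_bigr => i _ do rewrite mderivD mderivZ mmapD mmapZ mulrDr.
rewrite big_split /=; congr (_ + _).
under [RHS]eq_bigr => i _ do rewrite mulrCA.
rewrite -mulr_sumr; congr (_ * _).
have [d] := ubnP (mdeg m); elim: d => // d IHd in m *.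
rewrite ltnS => md.
have [/eqP|m0] := eqVneq (mdeg m) 0%N.
  rewrite mdeg_eq0 => /eqP->; rewrite mpolyX0 rmorph1 coef1 /= big1 // => i _.
  by rewrite mderivC rmorph0 mulr0.
have [j mj] : exists j, m j != 0%N.
  apply/existsP; rewrite -negb_forall; apply: contra m0 => /forallP m0.
  by rewrite mdegE big1 // => i _; apply/eqP.
have mE : m = (m - U_(j) + U_(j))%MM by rewrite submK // lep1mP.
move: md; rewrite mE mdegD mdeg1 addn1 => md.
rewrite mpolyXD alongM alongXU mulrDr coefD mulrA coefMX coefMC (IHd _ md) /=.
under [RHS]eq_bigr => i _ do rewrite mderivM mmapD !mmapM mulrDr.
rewrite big_split /= mulr_suml; congr (_ + _).
  by apply: eq_bigr => i _; rewrite mmapXU mulrA.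
rewrite (bigD1 j) //= big1 ?addr0 => [|i ij].
  have UU : (U_(j) - U_(j) = 0)%MM by apply/mnmP => k; rewrite mnmBE subnn mnm0E.
  rewrite mderivX mnm1E eqxx scale1r UU mpolyX0 rmorph1 mulr1.
  by rewrite coefMC along_coef0 mulrC.
by rewrite mderivX mnm1E eq_sym (negPf ij) scale0r rmorph0 !mulr0.
Qed.

(** The homogenization of [f] to degree [d], evaluated at (a : b); a drop of the degree of [f] below
    [d] is a zero at infinity. *)
Definition bihomog d (a b : S) (f : {poly S}) : S :=
  \sum_(j < d.+1) a ^+ (d - j) * b ^+ j * f`_j.

(** The two claims are proved together: the induction step of the second one discards the
    coefficient of index d + 1, which is zero by the first. *)
Lemma along_homog d p V W a b : p \is d.-homog ->
  (size (along V W p) <= d.+1)%N /\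
  mmap iota (fun i => a * V i + b * W i) p = bihomog d a b (along V W p).
Proof.
move: d p; apply: homog_ind => [d|d p q [sp IHp] [sq IHq]|d e p [sp IHp]||d p i [sp IHp]].
- rewrite !rmorph0 size_poly0; split=> //; rewrite /bihomog big1 // => j _.
  by rewrite coef0 mulr0.
- split; first by rewrite alongD (leq_trans (size_polyD _ _)) // geq_max sp.
  rewrite mmapD alongD IHp IHq -big_split /=; apply: eq_bigr => j _.
  by rewrite coefD mulrDr.
- split; first by rewrite alongZ mul_polyC (leq_trans (size_scale_leq _ _)).
  rewrite mmapZ alongZ IHp mulr_sumr; apply: eq_bigr => j _.
  by rewrite coefCM mulrCA.
- rewrite !rmorph1 size_poly1; split=> //.
  by rewrite /bihomog big_ord1 coef1 !mulr1.
- split.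
    rewrite alongM alongXU (leq_trans (size_polyMleq _ _)) //.
    have : (size ((V i)%:P + (W i)%:P * 'X)%R <= 2)%N.
      by rewrite addrC size_MXaddC; case: ifP; rewrite // ltnS size_polyC leq_b1.
    by move=> s2; have := leq_add sp s2; rewrite addn2; case: (_ + _)%N.
  rewrite mmapM alongM mmapXU alongXU IHp /bihomog.
  set f := along V W p in sp *.
  have coefE j : (f * ((V i)%:P + (W i)%:P * 'X))`_j =
      f`_j * V i + (if j is j'.+1 then f`_j' else 0) * W i.
    rewrite mulrDr coefD coefMC mulrA coefMX coefMC; congr (_ + _).
    by case: j => [|j] /=; rewrite ?mul0r.
  under [RHS]eq_bigr => j _ do rewrite coefE mulrDr.
  rewrite big_split /= mulrDr; congr (_ + _).
    rewrite [RHS]big_ord_recr /= [f`_d.+1]nth_default // mul0r mulr0 addr0 mulr_suml.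
    by apply: eq_bigr => j _; rewrite subSn -1?ltnS // exprS; ring.
  rewrite [RHS]big_ord_recl /= mul0r mulr0 add0r mulr_suml.
  by apply: eq_bigr => j _; rewrite /bump /= add1n subSS exprS; ring.
Qed.

Lemma size_along d p V W : p \is d.-homog -> (size (along V W p) <= d.+1)%N.
Proof. by move=> hp; case: (along_homog V W 0 0 hp). Qed.

Lemma mmap_line d p V W a b : p \is d.-homog ->
  mmap iota (fun i => a * V i + b * W i) p = bihomog d a b (along V W p).
Proof. by move=> hp; case: (along_homog V W a b hp). Qed.

(** [W] is the point at infinity of the parametrised line, where a form of degree [d] takes its top
    coefficient as value. *)
Lemma along_coef_top d p V W :
  p \is d.-homog -> (along V W p)`_d = mmap iota W p.
Proof.
move=> hp; rewrite (_ : mmap iota W p = mmap iota (fun i => 0 * V i + 1 * W i) p).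
  rewrite (mmap_line V W 0 1 hp) /bihomog big_ord_recr /= subnn expr0 expr1n !mul1r.
  rewrite big1 ?add0r // => j _; rewrite expr0n subn_eq0 leqNgt ltn_ord.
  by rewrite !mul0r.
by apply: mmap_eq => i; rewrite mul0r mul1r add0r.
Qed.

End Evaluation.

Lemma map_along (R S T : comNzRingType) n (iota : {rmorphism R -> S})
    (psi : {rmorphism S -> T}) V W (p : {mpoly R[n]}) :
  map_poly psi (along iota V W p) = along (psi \o iota) (psi \o V) (psi \o W) p.
Proof.
rewrite /along rmorph_sum; apply: eq_bigr => m _.
rewrite rmorphM /= map_polyC; congr (_ * _).
rewrite rmorph_prod; apply: eq_bigr => i _.
by rewrite rmorphXn /= rmorphD rmorphM /= !map_polyC map_polyX.
Qed.

(** With the powers of ['X] removed, both factors have nonzero constant terms; comparing orders at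
    0, the two cofactors multiply to a constant and are constant themselves. *)
Lemma poly_monomial_factor (S : idomainType) (A B : {poly S}) c n :
  c != 0 -> A * B = c%:P * 'X^n -> exists i x, A = x%:P * 'X^i.
Proof.
move=> c0 ABE; have AB0 : A * B != 0 by rewrite ABE mulf_neq0 ?polyC_eq0 ?expf_neq0 ?polyX_eq0.
have := AB0; rewrite mulf_eq0 negb_or => /andP[A0 B0].
have [i [A' + AE]] := multiplicity_XsubC A 0; rewrite A0 implyTb => A'0.
have [j [B' + BE]] := multiplicity_XsubC B 0; rewrite B0 implyTb => B'0.
rewrite subr0 in AE BE.
have {}ABE : A' * B' * 'X^(i + j) = c%:P * 'X^n by rewrite exprD -ABE AE BE; ring.
have A'B'0 : ~~ root (A' * B') 0 by rewrite rootM negb_or A'0.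
have Xn0 m : ('X^m : {poly S}) != 0 by rewrite expf_neq0 ?polyX_eq0.
exists i; have [lt|gt|eqn] := ltngtP (i + j) n.
- case/negP: A'B'0; move: ABE; rewrite -(subnK (ltnW lt)) [in RHS]exprD mulrA => /(mulIf (Xn0 _)) ->.
  by rewrite rootM orbC rootE hornerXn expr0n subn_eq0 leqNgt lt eqxx.
- move: ABE; rewrite -(subnK (ltnW gt)) [in LHS]exprD mulrA => /(mulIf (Xn0 _)).
  move/(congr1 (fun f => f.[0])); rewrite hornerM hornerXn expr0n subn_eq0 leqNgt gt mulr0.
  by rewrite hornerC => /esym/eqP; rewrite (negPf c0).
- move: ABE; rewrite eqn => /(mulIf (Xn0 _)) A'B'E.
  have A'n0 : A' != 0 by apply: contraNneq A'0 => ->; rewrite root0.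
  have B'n0 : B' != 0 by apply: contraNneq B'0 => ->; rewrite root0.
  have : (size A' <= 1)%N.
    have := size_mul A'n0 B'n0; rewrite A'B'E size_polyC c0 -subn1.
    move: B'n0; rewrite -size_poly_gt0; case: (size B') => // k _.
    by rewrite addnS subn1 /= => ->; apply: leq_addr.
  by move/size1_polyC=> A'E; exists A'`_0; rewrite {1}AE {1}A'E.
Qed.

Section Homogeneous.

Variables (R : idomainType) (n : nat).
Implicit Types p A B : {mpoly R[n]}.

(** Multiplying every variable by an additional variable turns the grading into the degree in that
    variable: coefficient k is the homogeneous part of degree k. *)
Definition graded p : {poly {mpoly R[n]}} :=
  mmap (polyC \o @mpolyC n R) (fun i => 'X * ('X_i)%:P) p.

Lemma gradedM p q : graded (p * q) = graded p * graded q.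
Proof. exact: mmapM. Qed.

Lemma mmap_polyC_id p : mmap (polyC \o @mpolyC n R) (fun i => ('X_i)%:P) p = p%:P.
Proof.
rewrite [in RHS](mpolyE p) rmorph_sum; apply: eq_bigr => m _ /=.
by rewrite -mul_mpolyC rmorphM mpolyXE_id rmorph_prod; congr (_ * _); apply: eq_bigr => i _;
  rewrite rmorphXn.
Qed.

Lemma graded_homog d p : p \is d.-homog -> graded p = 'X^d * p%:P.
Proof.
move=> hp; rewrite /graded.
by rewrite (mmap_scale _ (fun i => ('X_i)%:P) 'X hp) mmap_polyC_id.
Qed.

Lemma coef_graded p k : (graded p)`_k = pihomog mdeg k p.
Proof.
rewrite pihomogE coef_sum [RHS]big_mkcond /=; apply: eq_bigr => m _.
rewrite (_ : mmap1 _ m = ('X_[m])%:P * 'X^(mdeg m)).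
  rewrite mulrA -polyCM coefCM coefXn eq_sym; case: eqP => _; last by rewrite mulr0.
  by rewrite mulr1 mul_mpolyC.
rewrite /mmap1 mpolyXE_id rmorph_prod /= mdegE -prodrXr -big_split /=.
by apply: eq_bigr => i _; rewrite exprMn mulrC rmorphXn.
Qed.

(** [graded] is multiplicative and sends a form to a monomial over a domain; a factor of such a
    monomial is again a monomial. *)
Lemma homog_factor d A B : A * B != 0 -> A * B \is d.-homog ->
  exists i j, [/\ (i + j)%N = d, A \is i.-homog & B \is j.-homog].
Proof.
move=> AB0 hAB.
have factor A' B' : A' * B' != 0 -> A' * B' \is d.-homog -> exists i, A' \is i.-homog.
  move=> nz hAB'; have [i [x gA]] : exists i x, graded A' = x%:P * 'X^i.
    apply: (@poly_monomial_factor _ _ (graded B') (A' * B') d nz).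
    by rewrite -gradedM (graded_homog hAB') mulrC.
  have AE : A' = x.
    have : (graded A').[1] = A'.
      rewrite -[RHS](hornerC A' 1) -mmap_polyC_id /graded -!/(horner_eval 1 _) !rmorph_mmap.
      apply: mmap_eq => i'; rewrite /= /horner_eval hornerM hornerX mul1r //.
    by rewrite gA hornerM hornerC hornerXn expr1n mulr1.
  exists i; rewrite homog_piE -coef_graded gA coefCM coefXn eqxx mulr1 AE; exact/eqP.
have [a hA] := factor _ _ AB0 hAB.
have [b hB] : exists j, B \is j.-homog by apply: (factor B A); rewrite mulrC.
exists a, b; split=> //; apply: dhomog_uniq AB0 (dhomogM hA hB) hAB.
Qed.

End Homogeneous.

Lemma ord3_ind (P : 'I_3 -> Prop) : P 0 -> P 1 -> P 2 -> forall i, P i.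
Proof.
move=> P0 P1 P2 [[|[|[|//]]] lt3].
- by rewrite (_ : Ordinal lt3 = 0) //; apply: val_inj.
- by rewrite (_ : Ordinal lt3 = 1) //; apply: val_inj.
- by rewrite (_ : Ordinal lt3 = 2) //; apply: val_inj.
Qed.

Lemma sum3 (A : nmodType) (f : 'I_3 -> A) : \sum_i f i = f 0 + f 1 + f 2.
Proof.
rewrite !big_ord_recl big_ord0 addr0 addrA; congr (f _ + f _ + f _); exact: val_inj.
Qed.

(** * Vectors, lines and rational points *)

Section Vectors.

Variable K : comNzRingType.
Implicit Types u v w : 'rV[K]_3.

Lemma row3P u v : u 0 0 = v 0 0 -> u 0 1 = v 0 1 -> u 0 2 = v 0 2 -> u = v.
Proof. by move=> *; apply/rowP; apply: ord3_ind. Qed.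

Definition dot u v : K := u 0 0 * v 0 0 + u 0 1 * v 0 1 + u 0 2 * v 0 2.

Definition cross u v : 'rV[K]_3 :=
  \row_i [:: u 0 1 * v 0 2 - u 0 2 * v 0 1; u 0 2 * v 0 0 - u 0 0 * v 0 2;
             u 0 0 * v 0 1 - u 0 1 * v 0 0]`_i.

Lemma cross0 u v : cross u v 0 0 = u 0 1 * v 0 2 - u 0 2 * v 0 1.
Proof. by rewrite mxE. Qed.

Lemma cross1 u v : cross u v 0 1 = u 0 2 * v 0 0 - u 0 0 * v 0 2.
Proof. by rewrite mxE. Qed.

Lemma cross2 u v : cross u v 0 2 = u 0 0 * v 0 1 - u 0 1 * v 0 0.
Proof. by rewrite mxE. Qed.

Definition crossE := (cross0, cross1, cross2).

Lemma dotE u v : dot u v = \sum_i u 0 i * v 0 i.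
Proof. by rewrite sum3. Qed.

Lemma dotC u v : dot u v = dot v u. Proof. rewrite /dot; ring. Qed.

Lemma dotDr u v w : dot u (v + w) = dot u v + dot u w.
Proof. rewrite /dot !mxE; ring. Qed.

Lemma dotZr a u v : dot u (a *: v) = a * dot u v.
Proof. rewrite /dot !mxE; ring. Qed.

Lemma dotZl a u v : dot (a *: u) v = a * dot u v.
Proof. rewrite /dot !mxE; ring. Qed.

Lemma dot_crossl u v : dot u (cross u v) = 0.
Proof. rewrite /dot !crossE; ring. Qed.

Lemma dot_crossr u v : dot v (cross u v) = 0.
Proof. rewrite /dot !crossE; ring. Qed.

Lemma crossC u v : cross u v = - cross v u.
Proof. by apply: row3P; rewrite [RHS]mxE !crossE; ring. Qed.

Lemma crossZl a u v : cross (a *: u) v = a *: cross u v.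
Proof. by apply: row3P; rewrite [RHS]mxE !crossE !mxE; ring. Qed.

Lemma crossZr a u v : cross u (a *: v) = a *: cross u v.
Proof. by apply: row3P; rewrite [RHS]mxE !crossE !mxE; ring. Qed.

Lemma crossDr u v w : cross u (v + w) = cross u v + cross u w.
Proof. by apply: row3P; rewrite [RHS]mxE !crossE !mxE; ring. Qed.

Lemma crossvv u : cross u u = 0.
Proof. by apply: row3P; rewrite !crossE !mxE; ring. Qed.

Lemma cross_cross u v w : cross u (cross v w) = dot u w *: v - dot u v *: w.
Proof. by apply: row3P; rewrite !crossE !mxE /dot; ring. Qed.

(* Cramer's rule for a vector w in the span of u, v and a coordinate vector. *)
Lemma cross_cramer u v w i j :
  cross u v 0 i * w 0 j =
    dot (cross u v) w * (i == j)%:R + cross w v 0 i * u 0 j + cross u w 0 i * v 0 j.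
Proof.
by move: i j; apply: ord3_ind; apply: ord3_ind; rewrite /dot !crossE /=; ring.
Qed.

End Vectors.

Section FieldVectors.

Variable K : fieldType.
Implicit Types u v w : 'rV[K]_3.

Lemma row3_neq0 v : v != 0 -> exists i, v 0 i != 0.
Proof.
move=> v0; apply/existsP; rewrite -negb_forall; apply: contra v0 => /forallP v0.
by apply/eqP/rowP => i; rewrite mxE; apply/eqP.
Qed.

(** The triple product of a coordinate vector with [u] and [v] reads v_i u = u_i v when u and v have
    zero cross product. *)
Lemma cross_eq0P u v : u != 0 -> cross u v = 0 -> exists a, v = a *: u.
Proof.
move=> /row3_neq0[i ui0] uv0; exists (v 0 i / u 0 i).
have := cross_cross (delta_mx 0 i) u v; rewrite uv0.
rewrite (_ : cross _ 0 = 0); last by apply: row3P; rewrite !crossE !mxE; ring.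
have dotd w : dot (delta_mx 0 i) w = w 0 i.
  rewrite dotE (bigD1 i) //= big1 ?addr0 ?mxE ?eqxx ?mul1r // => j ji.
  by rewrite mxE (negPf ji) mul0r.
rewrite !dotd => /esym/eqP; rewrite subr_eq0 => /eqP E.
by rewrite mulrC -scalerA E scalerA mulVf // scale1r.
Qed.

Lemma dot_surj v : v != 0 -> exists w, dot v w = 1.
Proof.
case/row3_neq0 => i vi0; exists (delta_mx 0 i *+ 0 + (v 0 i)^-1 *: delta_mx 0 i).
rewrite mulr0n add0r dotZr dotE (bigD1 i) //= big1 ?addr0 ?mxE ?eqxx => [|j ji].
  by rewrite mulr1 mulVf.
by rewrite mxE (negPf ji) andbF mulr0.
Qed.

Lemma line_basis l : l != 0 -> exists (v w : 'rV[K]_3) c, c != 0 /\ cross v w = c *: l.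
Proof.
case/row3_neq0; apply: ord3_ind => li0.
- exists (\row_j [:: - l 0 1; l 0 0; 0]`_j), (\row_j [:: - l 0 2; 0; l 0 0]`_j), (l 0 0).
  by split => //; apply: row3P; rewrite !crossE !mxE /=; ring.
- exists (\row_j [:: - l 0 1; l 0 0; 0]`_j), (\row_j [:: 0; - l 0 2; l 0 1]`_j), (l 0 1).
  by split => //; apply: row3P; rewrite !crossE !mxE /=; ring.
- exists (\row_j [:: - l 0 2; 0; l 0 0]`_j), (\row_j [:: 0; - l 0 2; l 0 1]`_j), (l 0 2).
  by split => //; apply: row3P; rewrite !crossE !mxE /=; ring.
Qed.

Lemma line_span v w x : cross v w != 0 -> dot (cross v w) x = 0 ->
  exists a b, x = a *: v + b *: w.
Proof.
case/row3_neq0 => i ni0 x0; set n := cross v w in ni0 *.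
exists (cross x w 0 i / n 0 i), (cross v x 0 i / n 0 i); apply/rowP => j.
apply: (mulfI ni0); have addE (a b : 'rV[K]_3) : (a + b) 0 j = a 0 j + b 0 j by rewrite mxE.
have scaleE c (a : 'rV[K]_3) : (c *: a) 0 j = c * a 0 j by rewrite mxE.
rewrite cross_cramer x0 mul0r add0r addE !scaleE mulrDr.
by congr (_ + _); rewrite mulrA (mulrC (n 0 i)) divfK.
Qed.

Lemma line_indep v w a b : cross v w != 0 -> a *: v + b *: w = 0 -> a = 0 /\ b = 0.
Proof.
move=> n0 E; split; apply/eqP.
  have : cross (a *: v + b *: w) w = a *: cross v w.
    by rewrite crossC crossDr opprD -!crossC !crossZl crossvv scaler0 addr0.
  rewrite E -[0](scale0r w) crossZl scale0r => /esym/eqP.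
  by rewrite scaler_eq0 (negPf n0) orbF.
have : cross v (a *: v + b *: w) = b *: cross v w.
  by rewrite crossDr !crossZr crossvv scaler0 add0r.
rewrite E -[0](scale0r w) crossZr scale0r => /esym/eqP.
by rewrite scaler_eq0 (negPf n0) orbF.
Qed.

Definition coords v : 'I_3 -> K := fun i => v 0 i.

Definition linform v : {mpoly K[3]} := \sum_i v 0 i *: 'X_i.

Lemma meval_linform v w : (linform v).@[coords w] = dot v w.
Proof.
rewrite /linform raddf_sum /= dotE; apply: eq_bigr => i _.
by rewrite mevalZ mevalXU.
Qed.

Lemma linform_homog v : linform v \is 1.-homog.
Proof. by apply: rpred_sum => i _; apply: rpredZ; rewrite dhomogX /= mdeg1. Qed.

Lemma linform_eq0 v : (linform v == 0) = (v == 0).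
Proof.
apply/eqP/eqP => [v0|->]; last first.
  by rewrite /linform big1 // => i _; rewrite mxE scale0r.
apply/rowP => i; rewrite mxE; have := congr1 (mcoeff U_(i)) v0.
rewrite mcoeff0 raddf_sum (bigD1 i) //= big1 ?addr0 => [|j ji].
  by rewrite mcoeffZ mcoeffXU eqxx mulr1.
by rewrite mcoeffZ mcoeffXU (negPf ji) mulr0.
Qed.

Lemma msize_linform v : v != 0 -> msize (linform v) = 2%N.
Proof.
rewrite -linform_eq0 => l0; rewrite -mlead_deg //.
by rewrite (dhomog_mf (linform_homog v)) ?mlead_supp.
Qed.

(* Modulo the linear form of the line, the generic point is a combination of two
   points of the line. *)
Lemma along_eq0_factor d (f : {mpoly K[3]}) v w :
    f \is d.-homog -> cross v w != 0 ->
    along idfun (coords v) (coords w) f = 0 ->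
  exists g, f = linform (cross v w) * g.
Proof.
move=> hf n0 f0; have [i ni0] := row3_neq0 n0; set n := cross v w in n0 ni0 *.
pose C : {rmorphism K -> {mpoly K[3]}} := @mpolyC 3 K.
pose x : 'rV[{mpoly K[3]}]_3 := \row_j 'X_j.
pose v' := map_mx C v; pose w' := map_mx C w.
pose al := cross x w' 0 i; pose be := cross v' x 0 i.
pose y j := al * C (v 0 j) + be * C (w 0 j).
pose e j : {mpoly K[3]} := (i == j)%:R.
have n'E k : cross v' w' 0 k = C (n 0 k).
  by move: k; apply: ord3_ind; rewrite !crossE !mxE /= -!rmorphM -rmorphB.
have dotn : dot (cross v' w') x = linform n.
  rewrite dotE; apply: eq_bigr => k _.
  by rewrite n'E [x 0 k]mxE -mul_mpolyC.
have xj j : x 0 j = 'X_j by rewrite mxE.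
have xE j : (C (n 0 i)) * 'X_j = y j + e j * linform n.
  have E : C (n 0 i) * x 0 j = linform n * (i == j)%:R + al * v' 0 j + be * w' 0 j.
    by rewrite -(n'E i) -dotn; apply: cross_cramer.
  have v'E : v' 0 j = C (v 0 j) by rewrite mxE.
  have w'E : w' 0 j = C (w 0 j) by rewrite mxE.
  by rewrite -(xj j) E v'E w'E -addrA addrC [linform n * _]mulrC.
(* By [xE], the value of [p] at [linform n] is f(n_i X) = n_i^d f. Its constant term is f(y), where
   y is a point of the line with coordinates in the polynomial ring, and so it vanishes; hence
   [linform n] divides f. *)
pose p := along C y e f.
have p0 : p`_0 = 0.
  rewrite along_coef0 /y (mmap_line C (fun j => C (v 0 j)) (fun j => C (w 0 j)) al be hf).
  rewrite (_ : along _ _ _ _ = map_poly C (along idfun (coords v) (coords w) f)).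
    by rewrite f0 rmorph0 /bihomog big1 // => j _; rewrite coef0 mulr0.
  by rewrite map_along.
have [g pE] : exists g, p = g * ('X - 0%:P).
  by apply: factor_theorem; rewrite rootE horner_coef0 p0.
have : p.[linform n] = C (n 0 i ^+ d) * f.
  rewrite horner_along rmorphXn -{2}(comp_mpoly_id f) /comp_mpoly.
  rewrite -(mmap_scale _ _ _ hf); apply: mmap_eq => j.
  by rewrite -xE tnth_mktuple.
rewrite pE subr0 hornerM hornerX => E.
exists (C (n 0 i ^- d) * g.[linform n]).
rewrite mulrCA [linform n * _]mulrC E mulrA -rmorphM /= mulVf ?rmorph1 ?mul1r //.
by rewrite expf_neq0.
Qed.

End FieldVectors.

Section Points.

Variable F : finFieldType.
Local Notation q := #|F|.
Local Notation V3 := 'rV[F]_3.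
Implicit Types u v w : V3.

Lemma card_field_gt1 : (1 < q)%N.
Proof. exact: finNzRing_gt1. Qed.

(** The choice depends only on the class of [v], so points of the plane become vectors and equality
    of points becomes equality of vectors. The class contains [v], hence the default 0 is never
    reached. *)
Definition rep v : V3 := odflt 0 [pick w in proj_point v].

Lemma mem_proj_point v : v \in proj_point v.
Proof. by apply/imsetP; exists 1; rewrite ?scale1r // inE oner_neq0. Qed.

Lemma repP v : exists2 a : F, a != 0 & rep v = a *: v.
Proof.
rewrite /rep; case: pickP => [w /imsetP[a a0 ->]|/(_ v)]; first by rewrite inE in a0; exists a.
by rewrite /= mem_proj_point.
Qed.

Lemma proj_pointZ (a : F) v : a != 0 -> proj_point (a *: v) = proj_point v.
Proof.
move=> a0; apply/setP => w; apply/imsetP/imsetP => -[b b0 ->]; rewrite inE in b0.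
  by exists (b * a); rewrite ?scalerA // inE mulf_neq0.
by exists (b / a); rewrite ?scalerA ?divfK // inE mulf_neq0 ?invr_eq0.
Qed.

Lemma repZ (a : F) v : a != 0 -> rep (a *: v) = rep v.
Proof. by move=> a0; rewrite /rep proj_pointZ. Qed.

Lemma rep_eq0 v : (rep v == 0) = (v == 0).
Proof. by have [a a0 ->] := repP v; rewrite scaler_eq0 (negPf a0). Qed.

Lemma rep_id v : rep (rep v) = rep v.
Proof. by have [a a0 aE] := repP v; rewrite [X in rep X]aE repZ. Qed.

(** The same representatives serve for lines, [l] standing for the zeros of [dot l]; incidence is
    then symmetric and every count can be dualized. *)
Definition points : {set V3} := [set v | (v != 0) && (rep v == v)].

Lemma rep_points v : v != 0 -> rep v \in points.
Proof. by move=> v0; rewrite inE rep_eq0 v0 rep_id /=. Qed.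

Lemma points_neq0 P : P \in points -> P != 0.
Proof. by rewrite inE => /andP[]. Qed.

Lemma points_rep P : P \in points -> rep P = P.
Proof. by rewrite inE => /andP[_ /eqP]. Qed.

Lemma points_eq P Q (a : F) : P \in points -> Q \in points -> Q = a *: P -> Q = P.
Proof.
move=> hP hQ QE; have a0 : a != 0.
  by apply: contraNneq (points_neq0 hQ) => a0; rewrite QE a0 scale0r.
by rewrite -(points_rep hQ) QE repZ // points_rep.
Qed.

Lemma cross_points_neq0 P Q :
  P \in points -> Q \in points -> P != Q -> cross P Q != 0.
Proof.
move=> hP hQ; apply: contraNneq => /(cross_eq0P (points_neq0 hP))[a QE].
by rewrite (points_eq hP hQ QE).
Qed.

Lemma big_points (T : Type) (idx : T) (op : Monoid.com_law idx) (g : V3 -> T) :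
  \big[op/idx]_(v | v != 0) g v =
  \big[op/idx]_(P in points) \big[op/idx]_(a : F | a != 0) g (a *: P).
Proof.
rewrite (partition_big rep (mem points)) /= => [|v v0]; last exact: rep_points.
apply: eq_bigr => P hP; have [i Pi0] := row3_neq0 (points_neq0 hP).
rewrite (reindex_onto (fun a => a *: P) (fun v => v 0 i / P 0 i)) /=.
  apply: eq_bigl => a; rewrite !mxE mulfK // eqxx andbT scaler_eq0.
  rewrite (negPf (points_neq0 hP)) orbF; have [//|a0] := eqVneq a 0.
  by rewrite repZ // points_rep ?eqxx.
move=> v /andP[v0 /eqP vP]; have [a a0 va] := repP v.
have vE : v = a^-1 *: P by rewrite -vP va scalerA mulVf // scale1r.
by rewrite {1}vE mxE mulfK // -vE.
Qed.

Lemma card_nonzero : #|[pred a : F | a != 0]| = q.-1.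
Proof. by rewrite -(cardC1 (0 : F)); apply: eq_card. Qed.

Definition scale_inv (B : pred V3) := forall (a : F) v, a != 0 -> B (a *: v) = B v.

Lemma card_vectors B : scale_inv B ->
  #|[set v | (v != 0) && B v]| = (q.-1 * #|[set P in points | B P]|)%N.
Proof.
move=> Binv; rewrite -!sum1dep_card big_mkcondr /= big_points.
rewrite big_mkcondr big_distrr /=; apply: eq_bigr => P hP.
rewrite (eq_bigr (fun=> if B P then 1%N else 0%N)) => [|a a0]; last by rewrite Binv.
by rewrite sum_nat_const card_nonzero.
Qed.

Lemma card_points : (q.-1 * #|points| = q ^ 3 - 1)%N.
Proof.
have := @card_vectors predT (fun _ _ _ => erefl).
rewrite (_ : [set P in points | predT P] = points); last by apply/setP => v; rewrite inE andbT.
move=> <-; rewrite (_ : [set v | _] = [set~ 0]); last by apply/setP => v; rewrite !inE andbT.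
by rewrite cardsC1 card_mx mul1n subn1.
Qed.

Lemma card_pointsE : #|points| = (q ^ 2 + q + 1)%N.
Proof.
have := card_points; have := card_field_gt1; case: (q) => [|[|n]] // _ /= E.
apply/eqP; rewrite -(eqn_pmul2l (ltn0Sn n)) E; apply/eqP; rewrite !expnS expn0; nia.
Qed.

(** The points of the line are v + u w, each for exactly one u, and the point w at infinity, which
    the boolean [B w] counts. *)
Lemma card_line (B : pred V3) l v w c : scale_inv B -> l != 0 -> c != 0 ->
    cross v w = c *: l ->
  #|[set P in points | (dot l P == 0) && B P]| =
  (#|[set u : F | B (v + u *: w)%R]| + B w)%N.
Proof.
move=> Binv l0 c0 vwE; have n0 : cross v w != 0 by rewrite vwE scaler_eq0 negb_or c0.
have Brep x : B (rep x) = B x by have [a a0 ->] := repP x; rewrite Binv.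
have lrep x : (dot l (rep x) == 0) = (dot l x == 0).
  by have [a a0 ->] := repP x; rewrite dotZr mulf_eq0 (negPf a0).
have on_line x : (dot l x == 0) = (dot (cross v w) x == 0).
  by rewrite vwE dotZl mulf_eq0 (negPf c0).
have lv : dot l v == 0 by rewrite on_line dotC dot_crossl.
have lw : dot l w == 0 by rewrite on_line dotC dot_crossr.
have aff0 (u : F) : v + u *: w != 0.
  apply/eqP; rewrite -[v]scale1r => /(line_indep n0)[/eqP].
  by rewrite oner_eq0.
have w0 : w != 0.
  apply/eqP => w0; have [|_ /eqP] := @line_indep _ v w 0 1 n0.
    by rewrite w0 !scaler0 scale0r addr0.
  by rewrite oner_eq0.
have affw (u b : F) : v + u *: w != b *: w.
  apply/eqP => E; have [|/eqP] := @line_indep _ v w 1 (u - b) n0.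
    by rewrite scale1r scalerBl addrA E subrr.
  by rewrite oner_eq0.
have repI (u u' : F) : rep (v + u *: w) = rep (v + u' *: w) -> u = u'.
  have [a a0 ->] := repP (v + u *: w); have [b b0 ->] := repP (v + u' *: w).
  move=> E; have [|] := @line_indep _ v w (a - b) (a * u - b * u') n0.
    by rewrite !scalerBl -!scalerA addrACA -opprD -!scalerDr E subrr.
  by move=> /eqP; rewrite subr_eq0 => /eqP-> /eqP; rewrite subr_eq0 => /eqP/(mulfI b0).
rewrite (_ : [set P in points | _] = [set rep (v + u *: w) | u in [set u : F | B (v + u *: w)]]
    :|: [set P | (P == rep w) && B w]); last first.
  apply/setP => P; rewrite !inE; apply/idP/orP.
    case/andP => hP /andP[lP BP]; have {}hP : P \in points by rewrite inE.
    have [a [b PE]] := line_span n0 (eqP (etrans (esym (on_line P)) lP)).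
    have [a0|a0] := eqVneq a 0.
      have {}PE : P = b *: w by rewrite PE a0 scale0r add0r.
      have b0 : b != 0 by apply: contraNneq (points_neq0 hP) => b0; rewrite PE b0 scale0r.
      right; rewrite -(Binv b) // -PE BP andbT -(points_rep hP) PE repZ //.
    left; apply/imsetP; exists (b / a).
      have : B (a *: (v + (b / a) *: w)).
        by rewrite scalerDr scalerA mulrCA divff // mulr1 -PE.
      by rewrite Binv // inE.
    rewrite -(points_rep hP) PE -[in RHS](repZ _ a0) scalerDr scalerA.
    by rewrite mulrCA divff // mulr1.
  case=> [/imsetP[u]|/andP[/eqP-> Bw]].
    rewrite inE => Bu ->; have := rep_points (aff0 u); rewrite inE => ->.
    by rewrite lrep Brep Bu dotDr dotZr (eqP lv) (eqP lw) mulr0 addr0 eqxx.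
  by have := rep_points w0; rewrite inE lrep Brep Bw lw => ->.
rewrite cardsU (_ : _ :&: _ = set0) ?cards0 ?subn0; last first.
  apply/setP => P; rewrite !inE; apply/negP => /andP[/imsetP[u _ ->] /andP[/eqP E _]].
  have [a a0 aE] := repP (v + u *: w); have [b b0 bE] := repP w.
  case/eqP: (affw u (b / a)); apply: (scalerI a0); rewrite -aE E bE scalerA.
  by rewrite mulrCA divff // mulr1.
rewrite card_imset; last exact: repI; congr (_ + _)%N.
case: (B w).
  rewrite (_ : [set P | _] = [set rep w]) ?cards1 //.
  by apply/setP => P; rewrite !inE andbT.
rewrite (_ : [set P | _] = set0) ?cards0 //.
by apply/setP => P; rewrite !inE andbF.
Qed.

Lemma card_line_points l : l != 0 -> #|[set P in points | dot l P == 0]| = q.+1.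
Proof.
move=> l0; have [v [w [c [c0 vwE]]]] := line_basis l0.
have := @card_line predT l v w c (fun _ _ _ => erefl) l0 c0 vwE.
rewrite (_ : [set P in points | _ && _] = [set P in points | dot l P == 0]).
  by move=> ->; rewrite cardsE addn1; congr S; apply: eq_card.
by apply/setP => P; rewrite !inE andbT.
Qed.

Lemma line_through P Q l : P \in points -> Q \in points -> P != Q -> l \in points ->
  (dot l P == 0) && (dot l Q == 0) = (l == rep (cross P Q)).
Proof.
move=> hP hQ PQ hl; have n0 := cross_points_neq0 hP hQ PQ.
apply/andP/eqP => [[/eqP lP /eqP lQ]|->]; last first.
  have [a a0 ->] := repP (cross P Q).
  by rewrite !dotZl ![dot (cross _ _) _]dotC dot_crossl dot_crossr mulr0 eqxx.
have [a lE] : exists a, l = a *: cross P Q.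
  apply: cross_eq0P n0 _; rewrite crossC cross_cross lP lQ !scale0r subrr oppr0 //.
rewrite -(points_rep hl) lE repZ //; apply: contraNneq (points_neq0 hl) => a0.
by rewrite lE a0 scale0r.
Qed.

Lemma num_pointsE d (f : {mpoly F[3]}) : f \is d.-homog ->
  num_points f = #|[set P in points | f.@[coords P] == 0]|.
Proof.
move=> hf; have fZ (a : F) v : a != 0 -> (f.@[coords (a *: v)] == 0) = (f.@[coords v] == 0).
  move=> a0; rewrite (_ : f.@[_] = a ^+ d * f.@[coords v]).
    by rewrite mulf_eq0 expf_eq0 (negPf a0) andbF.
  by rewrite /meval -(mmap_scale _ _ _ hf); apply: mmap_eq => i; rewrite /coords mxE.
have pI : {in points &, injective (@proj_point F)}.
  move=> P Q hP hQ E; have := mem_proj_point Q; rewrite -E => /imsetP[a _ QE].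
  by rewrite (points_eq hP hQ QE).
rewrite -(card_in_imset (f := @proj_point F)) => [|P Q]; last first.
  by rewrite !inE => /andP[hP _] /andP[hQ _]; apply: pI; rewrite inE.
apply: eq_card => S; apply/imsetP/imsetP => -[v].
  rewrite inE => /andP[v0 fv] ->; have [a a0 aE] := repP v.
  exists (rep v); last by rewrite aE proj_pointZ.
  by rewrite inE rep_points //= aE fZ.
rewrite inE => /andP[hv fv] ->; exists v => //.
by rewrite inE points_neq0.
Qed.

End Points.

(** Exchanging the two ends of the line reverses the coefficients, so the behaviour at infinity can
    be read off at the origin. *)
Lemma along_rev (R S : comNzRingType) n (iota : {rmorphism R -> S}) V W d
    (p : {mpoly R[n]}) j :
  p \is d.-homog -> (j <= d)%N -> (along iota V W p)`_j = (along iota W V p)`_(d - j).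
Proof.
move=> hp jd.
have -> : along iota V W p =
    mmap (polyC \o iota) (fun i => 'X * (W i)%:P + 1 * (V i)%:P) p.
  by apply: mmap_eq => i; ring.
rewrite (mmap_line (polyC \o iota) (fun i => (W i)%:P) (fun i => (V i)%:P) 'X 1 hp).
rewrite -(map_along iota (@polyC S)) /bihomog coef_sum.
rewrite (bigD1 (inord (d - j))) //= big1 => [|k kj].
  rewrite addr0 inordK ?ltnS ?leq_subr // subKn // expr1n mulr1 coef_map /=.
  by rewrite coefMC coefXn eqxx mul1r.
rewrite expr1n mulr1 coef_map /= coefMC coefXn; case: eqP => [jE|]; last by rewrite mul0r.
case/eqP: kj; apply: val_inj; rewrite /= inordK ?ltnS ?leq_subr // jE subKn //.
by rewrite -ltnS.
Qed.

(** Zeros on the projective line: infinity is a zero if the coefficient of index [d] vanishes, a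
    double one if the next coefficient vanishes too. After division by all distinct linear factors,
    the double roots are still roots of the quotient [g]. *)
Lemma card_roots_double (F : finFieldType) (p : {poly F}) d :
    p != 0 -> (0 < d)%N -> (size p <= d.+1)%N ->
  (#|[set u | root p u]| + (p`_d == 0)%R
     + (#|[set u | root p u && root p^`() u]|
          + ((p`_d == 0)%R && (p`_(d.-1) == 0)%R)) <= d)%N.
Proof.
move=> p0 d0 sp; set A := [set u | _]; set B := [set u | _ && _].
pose prodA (X : {set F}) := \prod_(u in X) ('X - u%:P).
have prodAE X : prodA X = \prod_(u <- enum X) ('X - u%:P) by rewrite /prodA big_enum.
have [g pE] : exists g, p = g * prodA A.
  have /dvdpP : prodA A %| p.
    rewrite prodAE uniq_roots_dvdp //; first by apply/allP => u; rewrite mem_enum inE.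
    by rewrite uniq_rootsE enum_uniq.
  by [].
have g0 : g != 0 by apply: contraNneq p0 => g0; rewrite pE g0 mul0r.
have szA : size (prodA A) = #|A|.+1 by rewrite prodAE size_prod_XsubC cardE.
have rB : (#|B| < size g)%N.
  rewrite cardE; apply: max_poly_roots; rewrite ?enum_uniq //.
  apply/allP => u; rewrite mem_enum inE => /andP[pu p'u].
  have uA : u \in A by rewrite inE.
  have AE : prodA A = ('X - u%:P) * prodA (A :\ u) by rewrite /prodA (big_setD1 u).
  have Au : ~~ root (prodA (A :\ u)) u.
    by rewrite prodAE root_prod_XsubC mem_enum in_setD1 eqxx.
  move: p'u; rewrite pE AE mulrCA derivM derivXsubC mul1r rootE hornerD !hornerM.
  rewrite hornerXsubC subrr mul0r addr0 mulf_eq0 -!rootE (negPf Au) orbF //.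
have szp : size p = (#|A| + size g)%N.
  by rewrite pE size_mul // -?size_poly_eq0 szA // addnS addnC.
have [pd|pd] := eqVneq p`_d 0; last first.
  by rewrite /= !addn0 -ltnS; apply: leq_trans sp; rewrite szp ltn_add2l.
have sp1 : (size p <= d)%N.
  move: sp; rewrite leq_eqVlt => /predU1P[spE|//].
  by move: p0; rewrite -lead_coef_eq0 lead_coefE spE /= pd eqxx.
have [pd1|pd1] := eqVneq p`_(d.-1) 0; last first.
  by rewrite /= addn0 addn1 addSn; apply: leq_trans sp1; rewrite szp ltn_add2l.
have sp2 : (size p < d)%N.
  move: sp1; rewrite leq_eqVlt => /predU1P[spE|//].
  by move: p0; rewrite -lead_coef_eq0 lead_coefE spE pd1 eqxx.
by rewrite /= !addn1 addSn addnS; apply: leq_trans sp2; rewrite szp ltnS ltn_add2l.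
Qed.

(** * The bound from counting along lines *)

Section LineBound.

Variable F : finFieldType.
Local Notation q := #|F|.
Local Notation V3 := 'rV[F]_3.
Implicit Types (v w : V3) (f : {mpoly F[3]}).

Definition grad f v : V3 := \row_i (mderiv i f).@[coords v].

(** The restriction is required to be nonzero as a polynomial: from degree q + 1 on, a curve may
    pass through all rational points of a line that is not one of its components. *)
Definition line_free f : Prop :=
  forall v w, cross v w != 0 -> along idfun (coords v) (coords w) f != 0.

(** Only rational points are considered. Unlike nonsingularity over the closure, this refers to the
    finite field alone, and it passes to factors by the product rule. *)
Definition smooth f : Prop :=
  forall v, v != 0 -> f.@[coords v] = 0 -> grad f v != 0.

Lemma meval_scale d f (a : F) v :
  f \is d.-homog -> f.@[coords (a *: v)] = a ^+ d * f.@[coords v].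
Proof.
move=> hf; rewrite /meval -(mmap_scale _ _ _ hf); apply: mmap_eq => i.
by rewrite /coords mxE.
Qed.

Lemma mderiv_homog d f i : f \is d.+1.-homog -> mderiv i f \is d.-homog.
Proof.
move/dhomogP => hf; apply/dhomogP => m hm.
have : (mderiv i f)@_m != 0 by rewrite -mcoeff_msupp.
rewrite mcoeff_deriv => nz; apply: succn_inj.
have /hf : (m + U_(i))%MM \in msupp f.
  by rewrite mcoeff_msupp; apply: contraNneq nz => ->; rewrite mul0rn.
by rewrite /= mdegD mdeg1 addn1.
Qed.

Lemma euler d f v : f \is d.-homog -> dot v (grad f v) = d%:R * f.@[coords v].
Proof.
move=> hf; rewrite dotE; under eq_bigr => i _ do rewrite mxE.
move: d f hf; apply: homog_ind => [d|d p q' IHp IHq|d e p IHp||d p i IHp].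
- by rewrite meval0 mulr0 big1 // => i _; rewrite mderiv0 meval0 mulr0.
- rewrite mevalD mulrDr -IHp -IHq -big_split; apply: eq_bigr => i _.
  by rewrite mderivD mevalD mulrDr.
- rewrite mevalZ mulrCA -IHp mulr_sumr; apply: eq_bigr => i _.
  by rewrite mderivZ mevalZ mulrCA.
- by rewrite mul0r big1 // => i _; rewrite mderivC meval0 mulr0.
- under eq_bigr => j _ do rewrite mderivM mevalD !mevalM mulrDr mulrA.
  rewrite big_split -mulr_suml IHp mevalM mevalXU -natr1 mulrDl mul1r mulrA; congr (_ + _).
  rewrite (bigD1 i) //= big1 ?addr0 => [|j ji].
    rewrite mderivX mnm1E eqxx scale1r.
    have UU : (U_(i) - U_(i) = 0)%MM by apply/mnmP => k; rewrite mnmBE subnn mnm0E.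
    by rewrite UU mpolyX0 meval1 mulr1 mulrC.
  by rewrite mderivX mnm1E eq_sym (negPf ji) scale0r meval0 !mulr0.
Qed.

Lemma along_coef1_grad f v w : (along idfun (coords v) (coords w) f)`_1 = dot w (grad f v).
Proof.
by rewrite along_coef1 dotE; apply: eq_bigr => i _; rewrite mxE.
Qed.

Lemma horner_along_coords f v w u :
  (along idfun (coords v) (coords w) f).[u] = f.@[coords (v + u *: w)].
Proof.
by rewrite horner_along; apply: mmap_eq => i; rewrite /coords !mxE mulrC.
Qed.

Lemma deriv_along f v w u :
  (along idfun (coords v) (coords w) f)^`().[u] = dot w (grad f (v + u *: w)).
Proof.
set p := along _ _ _ f; rewrite -along_coef1_grad.
have -> : along idfun (coords (v + u *: w)) (coords w) f = p \Po ('X + u%:P).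
  rewrite /p /along -[RHS]/(comp_poly ('X + u%:P) _) rmorph_mmap.
  apply: eq_bigr => m _; rewrite /= comp_polyC; congr (_ * _).
  apply: mmap1_eq => i; rewrite /= comp_polyD comp_polyM !comp_polyC comp_polyX.
  by rewrite /coords !mxE polyCD polyCM; ring.
have h (r : {poly F}) : r`_1 = r^`().[0].
  by rewrite horner_coef0 coef_deriv mulr1n.
by rewrite h deriv_comp derivD derivX derivC addr0 mulr1 horner_comp hornerD hornerX hornerC add0r.
Qed.

Definition on_curve f : pred V3 := fun P => f.@[coords P] == 0.

Definition num_on_line f l : nat := #|[set P in points F | (dot l P == 0) && on_curve f P]|.

(** The number of rational points whose tangent line is [l]. A smooth point has exactly one tangent
    line, so these numbers add up to the number of points. *)
Definition num_tangent f l : nat := #|[set P in points F | on_curve f P && (rep (grad f P) == l)]|.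

Lemma on_curve_inv d f : f \is d.-homog -> scale_inv (on_curve f).
Proof.
move=> hf a v a0; rewrite /on_curve (meval_scale a v hf) mulf_eq0 expf_eq0 (negPf a0).
by rewrite andbF.
Qed.

Lemma line_bound d f l : (0 < d)%N -> f \is d.-homog -> line_free f -> smooth f ->
  l \in points F -> (num_on_line f l + num_tangent f l <= d)%N.
Proof.
move=> d0 hf linef smf hl; have l0 := points_neq0 hl.
have [v [w [c [c0 vwE]]]] := line_basis l0.
have n0 : cross v w != 0 by rewrite vwE scaler_eq0 negb_or c0.
have oinv := on_curve_inv hf.
(* Proportionality to [l], instead of equality of representatives, gives a scale-invariant
   predicate, to which [card_line] applies. *)
pose T P := on_curve f P && (cross l (grad f P) == 0).
have Tinv : scale_inv T.
  move=> a P a0; rewrite /T oinv //; congr (_ && _).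
  case: (d) d0 hf => // d' _ hf.
  have -> : grad f (a *: P) = a ^+ d' *: grad f P.
    by apply/rowP => i; rewrite !mxE (meval_scale a P (mderiv_homog i hf)).
  by rewrite crossZr scaler_eq0 expf_eq0 (negPf a0) andbF.
set p := along idfun (coords v) (coords w) f.
have p0 : p != 0 by apply: linef.
have pd : p`_d = f.@[coords w] by rewrite (along_coef_top _ _ _ hf).
have tan x b : dot l b = 0 -> T x -> dot b (grad f x) = 0.
  move=> lb /andP[_ /eqP/(cross_eq0P l0)[e ->]].
  by rewrite dotZr dotC lb mulr0.
have lv : dot l v = 0.
  by apply: (mulfI c0); rewrite mulr0 -dotZl -vwE dotC dot_crossl.
have lw : dot l w = 0.
  by apply: (mulfI c0); rewrite mulr0 -dotZl -vwE dotC dot_crossr.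
apply: leq_trans (card_roots_double p0 d0 (size_along _ _ _ hf)).
rewrite /num_on_line (card_line oinv l0 c0 vwE).
have -> : [set u : F | on_curve f (v + u *: w)] = [set u | root p u].
  by apply/setP => u; rewrite !inE rootE horner_along_coords.
rewrite pd -/(on_curve f w) leq_add2l.
apply: (@leq_trans #|[set P in points F | (dot l P == 0) && T P]|).
  apply: subset_leq_card; apply/subsetP => P; rewrite !inE => /andP[hP /andP[cP /eqP tP]].
  have hP' : P \in points F by rewrite inE.
  have [a a0 aE] := repP (grad f P).
  rewrite hP /T cP -tP aE crossZl crossvv scaler0 eqxx andbT dotZl dotC (euler P hf).
  by rewrite (eqP cP) !mulr0 eqxx.
rewrite (card_line Tinv l0 c0 vwE); apply: leq_add.
  apply: subset_leq_card; apply/subsetP => u; rewrite !inE => Tu.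
  rewrite rootE horner_along_coords rootE deriv_along (tan _ w lw Tu) eqxx andbT.
  by case/andP: Tu.
case Tw : (T w) => //; rewrite lt0b; have [cw _] := andP Tw.
(* The coefficient of index d - 1 is the derivative at [w] in the direction [v], found after
   exchanging the two ends of the line. *)
rewrite cw /= /p (along_rev idfun (coords v) (coords w) hf (leq_pred d)).
rewrite (_ : d - d.-1 = 1)%N; last by case: (d) d0 => // k _; rewrite subSnn.
by rewrite along_coef1_grad (tan _ v lv Tw).
Qed.

Lemma sum_num_on_line d f : f \is d.-homog ->
  (\sum_(l in points F) num_on_line f l = num_points f * q.+1)%N.
Proof.
move=> hf; rewrite (num_pointsE hf) -sum_nat_const.
rewrite (eq_bigr (fun l => \sum_(P in [set P in points F | on_curve f P]) (dot l P == 0)%R))%N.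
  rewrite exchange_big; apply: eq_bigr => P; rewrite in_set => /andP[hP _].
  rewrite -(card_line_points (points_neq0 hP)) -sum1dep_card [RHS]big_mkcondr /=.
  by apply: eq_bigr => l _; rewrite dotC; case: eqP.
move=> l _; rewrite /num_on_line -sum1dep_card [LHS]big_mkcond [RHS]big_mkcond /=.
apply: eq_bigr => P _; rewrite !inE.
by case: (P != 0); case: (rep P == P); case: (on_curve f P); case: (dot l P == 0).
Qed.

Lemma sum_num_tangent d f : f \is d.-homog -> smooth f ->
  (\sum_(l in points F) num_tangent f l = num_points f)%N.
Proof.
move=> hf smf; rewrite (num_pointsE hf) -sum1dep_card.
rewrite [RHS](partition_big (fun P => rep (grad f P)) (mem (points F))) /=.
  by apply: eq_bigr => l _; rewrite /num_tangent -sum1dep_card; apply: eq_bigl => P; rewrite andbA.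
by move=> P /andP[hP cP]; rewrite rep_points // smf ?points_neq0 //; apply/eqP.
Qed.

Lemma num_points_bound d f : (0 < d)%N -> f \is d.-homog -> line_free f -> smooth f ->
  (num_points f * (q + 2) <= d * (q ^ 2 + q + 1))%N.
Proof.
move=> d0 hf linef smf; rewrite -card_pointsE.
rewrite addn2 mulnS addnC -(sum_num_on_line hf) -(sum_num_tangent hf smf) -big_split.
rewrite mulnC -sum_nat_const; apply: leq_sum => l hl; exact: line_bound.
Qed.

End LineBound.

(** * A Bezout bound *)

Section Bezout.

Variable F : finFieldType.
Local Notation V3 := 'rV[F]_3.
Implicit Types (f g h : {mpoly F[3]}).

Lemma separating_form (u v : V3) : cross u v != 0 -> exists l, dot l u = 0 /\ dot l v = 1.
Proof.
case/dot_surj => w hw; exists (cross w u); split; first by rewrite dotC dot_crossr.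
by rewrite -hw /dot !crossE; ring.
Qed.

Definition branch_eval (gam : 'I_3 -> {poly F}) f : {poly F} := mmap (@polyC F) gam f.

HB.instance Definition _ gam :=
  GRing.RMorphism.copy (branch_eval gam) (mmap (@polyC F) gam).

Lemma branch_evalZ gam c f : branch_eval gam (c *: f) = c *: branch_eval gam f.
Proof. by rewrite /branch_eval mmapZ mul_polyC. Qed.

Lemma branch_evalD gam f1 f2 :
  branch_eval gam (f1 + f2) = branch_eval gam f1 + branch_eval gam f2.
Proof. exact: mmapD. Qed.

Lemma branch_evalM gam f1 f2 :
  branch_eval gam (f1 * f2) = branch_eval gam f1 * branch_eval gam f2.
Proof. exact: mmapM. Qed.

Definition branch_coef (gam : 'I_3 -> {poly F}) k : V3 := \row_i (gam i)`_k.

Lemma branch_linform gam l k :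
  (branch_eval gam (linform l))`_k = dot l (branch_coef gam k).
Proof.
rewrite /linform rmorph_sum /= coef_sum dotE; apply: eq_bigr => i _.
by rewrite branch_evalZ coefZ mxE /branch_eval mmapXU.
Qed.

(** The projection onto degree [t] makes the map total and linear for all degrees; it is
    multiplication by [f] as soon as the degrees add up ([val_homog_mul]). *)
Definition homog_mul s t f (a : dhomog 3 F s) : dhomog 3 F t :=
  DHomog (pihomogP mdeg t (val a * f)).

Lemma val_homog_mul s d t f (a : dhomog 3 F s) :
  f \is d.-homog -> (s + d)%N = t -> val (homog_mul t f a) = val a * f.
Proof.
by move=> hf <-; rewrite /= pihomog_dE //; apply: dhomogM hf; exact: valP.
Qed.

Lemma homog_mul_linear s t f : linear (@homog_mul s t f).
Proof. by move=> c a b; apply: val_inj; rewrite /= mulrDl -scalerAl linearP. Qed.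

HB.instance Definition _ s t f :=
  GRing.isLinear.Build F (dhomog 3 F s) (dhomog 3 F t) _ (@homog_mul s t f)
    (@homog_mul_linear s t f).

Definition combination s1 s2 t f g (ab : dhomog 3 F s1 * dhomog 3 F s2) : dhomog 3 F t :=
  homog_mul t f ab.1 + homog_mul t g ab.2.

Lemma combination_linear s1 s2 t f g : linear (@combination s1 s2 t f g).
Proof.
by move=> c [a1 a2] [b1 b2]; rewrite /combination !linearP /= scalerDr addrACA.
Qed.

HB.instance Definition _ s1 s2 t f g :=
  GRing.isLinear.Build F (dhomog 3 F s1 * dhomog 3 F s2)%type (dhomog 3 F t) _
    (@combination s1 s2 t f g) (@combination_linear s1 s2 t f g).

(** Together with [combination] this is the Koszul complex of [f] and [g]; the sign makes the
    composite zero. *)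
Definition syzygy s t1 t2 f g (c : dhomog 3 F s) : dhomog 3 F t1 * dhomog 3 F t2 :=
  (homog_mul t1 g c, homog_mul t2 (- f) c).

Lemma syzygy_linear s t1 t2 f g : linear (@syzygy s t1 t2 f g).
Proof. by move=> c a b; rewrite /syzygy !linearP. Qed.

HB.instance Definition _ s t1 t2 f g :=
  GRing.isLinear.Build F (dhomog 3 F s) (dhomog 3 F t1 * dhomog 3 F t2)%type _
    (@syzygy s t1 t2 f g) (@syzygy_linear s t1 t2 f g).

Lemma dim_dhomog m : dim (dhomog 3 F m) = 'C(m + 2, m).
Proof. by []. Qed.

Lemma double_dim_dhomog m : (2 * dim (dhomog 3 F m) = m.+1 * m.+2)%N.
Proof.
rewrite dim_dhomog -bin_sub ?leq_addr // addKn bin2 addn2 /= mul2n.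
rewrite -[RHS]odd_double_half mulnC oddM /= negbK.
by case: odd.
Qed.

Variables (f g : {mpoly F[3]}) (d e : nat).
Hypotheses (hf : f \is d.-homog) (hg : g \is e.-homog).
Hypotheses (primef : prime_elt f) (ndvd : ~ divides f g).

Variables (I : finType) (K : nat) (gam : I -> 'I_3 -> {poly F}).
Local Notation pt i := (branch_coef (gam i) 0).
Local Notation dir i := (branch_coef (gam i) 1).
Hypotheses (pt_neq : forall i j, i != j -> cross (pt i) (pt j) != 0).
Hypotheses (dirP : forall i, cross (pt i) (dir i) != 0).
Hypotheses (branchf : forall i, 'X^K %| branch_eval (gam i) f).
Hypotheses (branchg : forall i, 'X^K %| branch_eval (gam i) g).

Definition jet m (h : dhomog 3 F m) : {ffun I * 'I_K -> F^o} :=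
  [ffun ik : I * 'I_K => (branch_eval (gam ik.1) (val h))`_ik.2].

Lemma jet_is_linear m : linear (@jet m).
Proof.
move=> c a b; apply/ffunP => ik; rewrite !ffunE /=.
by rewrite branch_evalD branch_evalZ coefD coefZ.
Qed.

HB.instance Definition _ m :=
  GRing.isLinear.Build F (dhomog 3 F m) {ffun I * 'I_K -> F^o} _ (@jet m) (@jet_is_linear m).

(** K-th powers of linear forms through the other points kill all jets there. A form [M] with a
    simple zero along branch i, raised to the power k, sets the order at i, and a form [N] that is
    nonzero at i fills up the degree. *)
Lemma jet_separating m i (k : 'I_K) : (#|I| * K <= m)%N ->
  exists h : dhomog 3 F m,
    [/\ jet h (i, k) != 0, forall k' : 'I_K, (k' < k)%N -> jet h (i, k') = 0
      & forall j (k' : 'I_K), j != i -> jet h (j, k') = 0].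
Proof.
move=> mlarge.
have sepP j : exists l : V3, j != i -> dot l (pt j) = 0 /\ dot l (pt i) = 1.
  have [->|/pt_neq/separating_form[l lP]] := eqVneq j i; first by exists 0.
  by exists l.
have [L LP] := fin_all_exists sepP.
have [M [M0 M1]] := separating_form (dirP i).
have [N N1] : exists l, dot l (pt i) = 1.
  have pi0 : pt i != 0.
    by apply: contraNneq (dirP i) => ->; apply/eqP/row3P; rewrite !crossE !mxE; ring.
  by have [l lP] := dot_surj pi0; exists l; rewrite dotC.
pose A := \prod_(j | j != i) linform (L j) ^+ K.
have hA : A \is (#|I|.-1 * K).-homog.
  have -> : #|I|.-1 = #|[pred j | j != i]|.
    exact: esym (cardC1 i).
  rewrite /A -sum_nat_const.
  apply: (big_rec2 (fun (p : {mpoly F[3]}) n => p \is n.-homog)) => [|j p n ji hp].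
    exact: dhomog1.
  by apply: dhomogM hp; rewrite -{2}[K]mul1n; apply: dhomogMn (linform_homog _).
pose h := A * linform M ^+ k * linform N ^+ (m - #|I|.-1 * K - k).
have I0 : (0 < #|I|)%N by apply/card_gt0P; exists i.
have mk : (#|I|.-1 * K + k <= m)%N.
  apply: leq_trans mlarge; rewrite -(prednK I0) mulSn addnC leq_add2r.
  exact: ltnW (ltn_ord k).
have hh : h \is m.-homog.
  have -> : m = ((#|I|.-1 * K + 1 * k) + 1 * (m - #|I|.-1 * K - k))%N.
    by rewrite !mul1n; move: mk; lia.
  by apply: dhomogM; [apply: dhomogM => //|];
    apply: dhomogMn (linform_homog _).
exists (DHomog hh).
have jetE j k' : jet (DHomog hh) (j, k') = (branch_eval (gam j) h)`_k' by rewrite ffunE.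
have [y yE y0] : exists2 y, branch_eval (gam i) h = 'X^k * y & y`_0 != 0.
  have [w wE] : exists w, branch_eval (gam i) (linform M) = w * ('X - 0%:P).
    by apply: factor_theorem; rewrite rootE horner_coef0 branch_linform M0.
  rewrite subr0 in wE; have w0 : w`_0 = 1.
    by rewrite -M1 -branch_linform wE coefMX.
  exists (branch_eval (gam i) A * w ^+ k * branch_eval (gam i) (linform N) ^+ (m - #|I|.-1 * K - k)).
    by rewrite !rmorphM !rmorphXn /= wE exprMn; ring.
  rewrite -!horner_coef0 !hornerM !horner_exp !horner_coef0 w0 branch_linform N1 !expr1n !mulr1.
  rewrite -horner_coef0 rmorph_prod horner_prod; apply/prodf_neq0 => j ji.
  by rewrite rmorphXn horner_exp horner_coef0 branch_linform (LP j ji).2 expr1n oner_neq0.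
split=> [|k' k'k|j k' ji]; rewrite jetE.
- by rewrite yE coefXnM ltnn subnn.
- by rewrite yE coefXnM k'k.
- have [w wE] : exists w, branch_eval (gam j) (linform (L j)) = w * ('X - 0%:P).
    by apply: factor_theorem; rewrite rootE horner_coef0 branch_linform (LP j ji).1.
  rewrite /h /A (bigD1 j) //= !rmorphM rmorphXn /= wE subr0 exprMn.
  by rewrite mulrAC -!mulrA mulrCA coefXnM ltn_ord.
Qed.

(** The separating forms give a triangular system at each point, solved downwards from the highest
    coefficient. *)
Lemma jet_surj m : (#|I| * K <= m)%N -> limg (linfun (@jet m)) = fullv.
Proof.
move=> mlarge; set U := limg _.
pose del i k : {ffun I * 'I_K -> F^o} := [ffun x => (x == (i, k))%:R].
have ffE (z : {ffun I * 'I_K -> F^o}) : z = \sum_x z x *: del x.1 x.2.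
  apply/ffunP => x; rewrite sum_ffunE (bigD1 x) //= big1 ?addr0 => [|y yx].
    by rewrite !ffunE -surjective_pairing eqxx /GRing.scale /= mulr1.
  by rewrite !ffunE -surjective_pairing eq_sym (negPf yx) scaler0.
have delU i k : del i k \in U.
  have [n] := ubnP (K - k); elim: n => // n IHn in k *; rewrite ltnS => kn.
  have [h [hk hlt hj]] := jet_separating i k mlarge.
  have hU : jet h \in U by rewrite -(lfunE (@jet m)) memv_img ?memvf.
  have : jet h (i, k) *: del i k \in U.
    have -> : jet h (i, k) *: del i k =
        jet h - \sum_(x | x != (i, k)) jet h x *: del x.1 x.2.
      by rewrite {2}(ffE (jet h)) (bigD1 (i, k)) //= addrK.
    apply: rpredB => //; apply: rpred_sum => -[j k'] /= jk.
    have [ji|/hj->] := eqVneq j i; last by rewrite scale0r mem0v.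
    rewrite ji in jk *; have [/hlt->|kk'] := ltnP k' k; first by rewrite scale0r mem0v.
    apply: rpredZ; apply: IHn; apply: leq_trans kn; apply: ltn_sub2l.
      by apply: leq_ltn_trans kk' _.
    rewrite ltn_neqAle kk' andbT; apply: contraNneq jk => kE.
    by apply/eqP; congr (_, _); apply: val_inj.
  rewrite rpredZeq => /orP[|//] /eqP hk0; by move: hk; rewrite hk0 eqxx.
apply/eqP; rewrite eqEsubv subvf /=; apply/subvP => z _.
by rewrite (ffE z); apply: rpred_sum => x _; apply: rpredZ.
Qed.

(** Let M be the number of jet conditions and s(n) = (n + 1)(n + 2)/2 the dimension of forms of
    degree n. In degree M + d + e the combinations a f + b g satisfy all conditions, which are
    independent. As [f] is prime and does not divide [g], the only relations between combinations
    are the Koszul ones. Hence M <= s(M + d + e) - s(M + d) - s(M + e) + s(M) = d e. *)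
Theorem bezout : (#|I| * K <= d * e)%N.
Proof.
pose M := (#|I| * K)%N.
pose m := (M + e + d)%N.
pose J := linfun (@jet m).
have dimJ : (\dim (lker J) + #|I| * K = dim (dhomog 3 F m))%N.
  have := limg_ker_dim J fullv; rewrite capfv jet_surj; last by rewrite /m; lia.
  rewrite !dimvf => <-; congr (_ + _)%N.
  transitivity (#|{: I * 'I_K}| * 1)%N => //.
  by rewrite card_prod card_ord muln1.
pose phi := linfun (@combination (M + e) (M + d) m f g).
pose psi := linfun (@syzygy M (M + e) (M + d) f g).
have valphi a b : val (phi (a, b)) = val a * f + val b * g.
  have me : (M + e + d)%N = m by [].
  have md : (M + d + e)%N = m by rewrite addnAC.
  by rewrite lfunE -(val_homog_mul a hf me) -(val_homog_mul b hg md).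
have imphi : (limg phi <= lker J)%VS.
  apply/subvP => _ /memv_imgP[[a b] _ ->]; rewrite memv_ker lfunE; apply/eqP/ffunP => -[i k].
  rewrite !ffunE /= -/(val (phi (a, b))) valphi branch_evalD !branch_evalM.
  have [/dvdpP[x ->] /dvdpP[y ->]] := (branchf i, branchg i).
  by rewrite !mulrA -mulrDl coefMXn ltn_ord.
have kerphi : (lker phi <= limg psi)%VS.
  apply/subvP => -[a b]; rewrite memv_ker => /eqP/(congr1 val); rewrite valphi /= => ab0.
  have [_ _ fP] := primef.
  have [c bE] : divides f (val b).
    have : divides f (val b * g).
      by exists (- val a); apply/eqP; rewrite mulrN -addr_eq0 addrC [f * _]mulrC ab0.
    by case/fP.
  have hc : c \is M.-homog.
    have [c0|c0] := eqVneq c 0; first by rewrite c0 rpred0.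
    have fc0 : f * c != 0 by rewrite mulf_neq0 //; case: primef.
    have [|i [j [ij hi hj]]] := @homog_factor _ _ (M + d) f c fc0.
      by rewrite -bE; apply: valP.
    have di : d = i by apply: dhomog_uniq hf hi; case: primef.
    by move: hj; rewrite -(addKn i j) ij -di addnK.
  apply/memv_imgP; exists (- DHomog hc); rewrite ?memvf // lfunE.
  congr (_, _); apply: val_inj.
    rewrite (val_homog_mul _ hg) // /= mulNr; apply: (mulIf (_ : f != 0)); first by case: primef.
    apply/eqP; rewrite mulNr -addr_eq0; rewrite bE in ab0.
    by rewrite -[X in _ == X]ab0; apply/eqP; ring.
  have hNf : - f \is d.-homog by rewrite rpredN.
  by rewrite (val_homog_mul _ hNf) //= mulrNN mulrC.
have := limg_ker_dim phi fullv; rewrite capfv.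
have := dimvS imphi; have := dimvS kerphi.
have := limg_ker_dim psi fullv; rewrite !dimvf.
have -> : dim (dhomog 3 F (M + e) * dhomog 3 F (M + d))%type =
  (dim (dhomog 3 F (M + e)) + dim (dhomog 3 F (M + d)))%N by [].
have := double_dim_dhomog m; have := double_dim_dhomog M.
have := double_dim_dhomog (M + e); have := double_dim_dhomog (M + d).
move: dimJ; rewrite -/M /m.
move: (dim _) (dim _) (dim _) (dim _) (\dim _ : nat) (\dim _) (\dim _) (\dim _) (\dim _).
move=> D1 D2 D3 D4 k1 k2 k3 k4 k5 E1 E2 E3 E4 E5 E6 le1 le2 E7.
have : (2 * (M + D2 + D1) <= 2 * (D3 + D4))%N by rewrite leq_mul2l /=; lia.
rewrite !mulnDr E2 E3 E4 E5; lia.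
Qed.

End Bezout.

Lemma horner_taylor2 (S : comNzRingType) (p : {poly S}) z :
  exists r, p.[z] = p`_0 + p`_1 * z + r * z ^+ 2.
Proof.
elim/poly_ind: p => [|p c _]; first by exists 0; rewrite horner0 !coef0; ring.
elim/poly_ind: p => [|p c' _].
  by exists 0; rewrite mul0r add0r !coefC hornerC /=; ring.
exists p.[z]; rewrite !hornerE !coefD !coefMX !coefC /= !coefD !coefMX !coefC /=; ring.
Qed.

Lemma along_scale_dir (R S : comNzRingType) n (iota : {rmorphism R -> S}) V W c
    (p : {mpoly R[n]}) :
  along iota V (fun i => c * W i) p = along iota V W p \Po (c%:P * 'X).
Proof.
rewrite /along -[RHS]/(comp_poly (c%:P * 'X) _) rmorph_mmap.
apply: eq_bigr => m _; rewrite /= comp_polyC; congr (_ * _).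
apply: mmap1_eq => i; rewrite /= comp_polyD comp_polyM !comp_polyC comp_polyX.
by rewrite polyCM; ring.
Qed.

Lemma coef_comp_scale (S : comNzRingType) (p : {poly S}) c j :
  (p \Po (c%:P * 'X))`_j = c ^+ j * p`_j.
Proof.
elim/poly_ind: p j => [|p a IHp] j; first by rewrite comp_poly0 !coef0 mulr0.
rewrite comp_poly_MXaddC mulrA !coefD !coefMX !coefC; case: j => [|j] /=.
  by rewrite expr0 !add0r mul1r.
by rewrite !addr0 coefMC IHp exprS; ring.
Qed.

Lemma dvdp_bigsum (R : idomainType) (I : finType) (P : pred I) (a : {poly R}) (G : I -> {poly R}) :
  (forall i, P i -> a %| G i) -> a %| \sum_(i | P i) G i.
Proof.
by move=> aG; apply: (big_ind (fun x => a %| x)) => [||//]; [exact: dvdp0 | exact: dvdp_add].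
Qed.

Lemma mmap_ext (R S : comNzRingType) n (iota iota' : R -> S) V W (p : {mpoly R[n]}) :
  iota =1 iota' -> V =1 W -> mmap iota V p = mmap iota' W p.
Proof. by move=> ii VW; apply: eq_bigr => m _; rewrite ii (mmap1_eq _ VW). Qed.

Lemma coef_along_ext (R S T : comNzRingType) n (iota : {rmorphism R -> S})
    (iota' : {rmorphism R -> T}) (psi : {rmorphism S -> T}) V W V' W' (p : {mpoly R[n]}) k :
    (forall c, psi (iota c) = iota' c) -> (forall i, psi (V i) = V' i) ->
    (forall i, psi (W i) = W' i) ->
  psi (along iota V W p)`_k = (along iota' V' W' p)`_k.
Proof.
move=> ii VV WW; rewrite -(coef_map psi) map_along; congr (_`_k); congr polyseq.
by apply: mmap_ext => [c|i] /=; rewrite ?ii ?VV ?WW.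
Qed.

Lemma exprD_card (F : finFieldType) (S : comNzRingType) (iota : {rmorphism F -> S}) (x y : S) :
  (x + y) ^+ #|F| = x ^+ #|F| + y ^+ #|F|.
Proof.
have [p p_pr pF] := finPcharP F.
apply: exprDn_pchar; rewrite (card_pprimeChar pF) pnatX; apply/orP; left.
by rewrite pnatE // (rmorph_pchar iota).
Qed.

Lemma natr_card (F : finFieldType) : #|F|%:R = 0 :> F.
Proof.
have [p p_pr pF] := finPcharP F; apply/eqP; rewrite -(dvdn_pcharf pF).
have := card_field_gt1 F; rewrite {1 2}(card_pprimeChar pF).
by case: logn => // n _; rewrite expnS dvdn_mulr.
Qed.

Lemma frobenius_mmap (F : finFieldType) (S : comNzRingType) (iota : {rmorphism F -> S})
    n V (p : {mpoly F[n]}) :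
  mmap iota (fun i => V i ^+ #|F|) p = mmap iota V p ^+ #|F|.
Proof.
have q0 : #|F| != 0%N by rewrite -lt0n ltnW ?card_field_gt1.
elim/mpolyind: p => [|c m p _ _ IHp]; first by rewrite !mmap0 expr0n (negPf q0).
have ic : iota c ^+ #|F| = iota c by rewrite -rmorphXn expf_card.
rewrite !mmapD (exprD_card iota) IHp !mmapZ exprMn ic; congr (_ * _ + _).
rewrite !mmapX /mmap1 -prodrXl; apply: eq_bigr => i _.
by rewrite -!exprM mulnC.
Qed.

Lemma coef_along_homog (R : comNzRingType) n n' s t (V W : 'I_n -> {mpoly R[n']}) d
    (p : {mpoly R[n]}) k :
    (forall i, V i \is s.-homog) -> (forall i, W i \is t.-homog) ->
    p \is d.-homog -> (k <= d)%N ->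
  (along (@mpolyC n' R) V W p)`_k \is ((d - k) * s + k * t).-homog.
Proof.
move=> hV hW hp; move: k.
suff : p \is d.-homog /\
    forall k, (k <= d)%N -> (along (@mpolyC n' R) V W p)`_k \is ((d - k) * s + k * t).-homog.
  by case.
move: d p hp; apply: homog_ind => [d|d p p' [hp IHp] [hp' IHp']|d c p [hp IHp]||d p i [hp IHp]].
- by split=> [|k _]; rewrite ?rpred0 // rmorph0 coef0 rpred0.
- split=> [|k kd]; first exact: rpredD.
  by rewrite alongD coefD; apply: rpredD; [apply: IHp | apply: IHp'].
- split=> [|k kd]; first exact: rpredZ.
  by rewrite alongZ coefCM mul_mpolyC; apply: rpredZ; apply: IHp.
- split=> [|k]; first exact: dhomog1.
  rewrite leqn0 => /eqP->; rewrite rmorph1 coef1 subnn !mul0n; exact: dhomog1.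
split=> [|k kd]; first by rewrite -addn1; apply: dhomogM; rewrite ?dhomogX /= ?mdeg1.
rewrite alongM alongXU mulrDr mulrA coefD coefMC coefMX coefMC; apply: rpredD.
  have [kd1|kd1] := leqP k d; last first.
    by rewrite nth_default ?mul0r ?rpred0 // (leq_trans (size_along _ _ _ hp)).
  rewrite subSn // (_ : ((d - k).+1 * s + k * t = (d - k) * s + k * t + s)%N).
    by apply: dhomogM; rewrite ?IHp.
  by rewrite mulSn -addnA addnC.
case: k kd => [|k] kd /=; first by exact: rpred0.
rewrite subSS mulSn addnA addnAC; apply: dhomogM; rewrite ?IHp //.
Qed.

(** * Formal branches and degrees below q *)

Section Branches.

Variable F : finFieldType.
Local Notation q := #|F|.
Local Notation V3 := 'rV[F]_3.
Implicit Types (v w : V3) (f g : {mpoly F[3]}) (gam : 'I_3 -> {poly F}).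

Definition branch f v K gam : Prop :=
  [/\ branch_coef gam 0 = v, cross v (branch_coef gam 1) != 0
    & 'X^K %| branch_eval gam f].

Lemma branch_eval_coef0 gam f : (branch_eval gam f)`_0 = f.@[coords (branch_coef gam 0)].
Proof.
rewrite -horner_coef0 -/(horner_eval 0 _) /branch_eval rmorph_mmap.
apply: eq_bigr => m _; rewrite /= /horner_eval hornerC; congr (_ * _).
by apply: mmap1_eq => i; rewrite /= horner_coef0 /coords mxE.
Qed.

(** Newton's iteration: the tangent line has contact of order 2, and each step corrects one more
    coefficient. *)
Lemma branch_exists d f v K : f \is d.-homog -> v != 0 -> f.@[coords v] = 0 ->
  grad f v != 0 -> exists gam, branch f v K gam.
Proof.
move=> hf v0 fv gv.
suff H n : exists gam, branch f v n.+2 gam.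
  have [gam [g0 g1 gK]] := H K; exists gam; split => //.
  by apply: dvdp_trans gK; rewrite -addn2 exprD dvdp_mulr.
elim: n => [|n [gam [g0 g1 /dvdpP[h fgam]]]].
  have [x [y [c [c0 xyE]]]] := line_basis gv.
  have n0 : cross x y != 0 by rewrite xyE scaler_eq0 negb_or c0.
  have gE u : dot u (grad f v) = c^-1 * dot u (cross x y).
    by rewrite xyE dotZr mulKf.
  (* Euler's formula puts [v] on its own tangent line, which is spanned by [x] and [y]; one of these
     two differs from [v] as a point. *)
  have [tau [vtau tauf]] : exists tau, cross v tau != 0 /\ dot tau (grad f v) = 0.
    have vn : dot (cross x y) v = 0.
      by rewrite xyE dotZl dotC (euler v hf) fv !mulr0.
    have [a [b vE]] := line_span n0 vn.
    have [b0|b0] := eqVneq b 0.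
      exists y; rewrite gE dot_crossr mulr0; split=> //.
      rewrite vE b0 scale0r addr0 crossZl scaler_eq0 negb_or n0 andbT.
      by apply: contraNneq v0 => a0; rewrite vE a0 b0 !scale0r addr0.
    exists x; rewrite gE dot_crossl mulr0; split=> //.
    rewrite vE crossC crossDr !crossZr crossvv scaler0 add0r oppr_eq0.
    by rewrite scaler_eq0 negb_or b0.
  pose gam i : {poly F} := (v 0 i)%:P + (tau 0 i)%:P * 'X.
  have gamE : branch_eval gam f = along idfun (coords v) (coords tau) f by [].
  exists gam; split.
  - by apply/rowP => i; rewrite mxE /gam coefD coefMX !coefC addr0.
  - have -> : branch_coef gam 1 = tau; last by [].
    by apply/rowP => i; rewrite mxE /gam coefD coefMX !coefC add0r.
  rewrite gamE; set p := along _ _ _ f.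
  have p0 : p`_0 = 0 by rewrite along_coef0.
  have p1 : p`_1 = 0 by rewrite along_coef1_grad.
  have -> : p = \sum_(i < 2) p`_i *: 'X^i + 'X^2 * (\poly_(i < size p) p`_(i + 2)).
    apply/polyP => i; rewrite coefD coefXnM !big_ord_recl big_ord0 /= p0 p1 !scale0r !addr0 coef0 add0r.
    case: i => [|[|i]]; rewrite ?p0 ?p1 //= subn2 /= coef_poly addn2; case: ltnP => // ip.
    by rewrite nth_default // (leq_trans ip) // -addn2 leq_addr.
  by rewrite !big_ord_recl big_ord0 /= p0 p1 !scale0r !addr0 add0r dvdp_mulr.
have [e he] := dot_surj gv.
(* Adding c t^(n+2) e changes f(gam) by c t^(n+2) modulo t^(n+3), because [e] has product 1 with the
   gradient; this [c] cancels the leading term. *)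
pose c := - h`_0.
pose gam' i : {poly F} := gam i + (e 0 i)%:P * (c%:P * 'X^(n.+2)).
have gam'E : branch_eval gam' f =
    (along (@polyC F) gam (fun i => (e 0 i)%:P) f).[c%:P * 'X^(n.+2)].
  by rewrite horner_along.
have coefg' i k : (k < n.+2)%N -> (gam' i)`_k = (gam i)`_k.
  by move=> kn; rewrite coefD mulrA -polyCM coefCM coefXn ltn_eqF // mulr0 addr0.
exists gam'; split.
- by apply/rowP => i; rewrite mxE coefg' // -g0 mxE.
- suff -> : branch_coef gam' 1 = branch_coef gam 1 by [].
  by apply/rowP => i; rewrite !mxE coefg'.
have [r rE] := horner_taylor2 (along (@polyC F) gam (fun i => (e 0 i)%:P) f) (c%:P * 'X^(n.+2)).
rewrite gam'E rE along_coef0 -/(branch_eval gam f) fgam along_coef1.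
set a := \sum_i _; have a0 : a`_0 = 1.
  rewrite -horner_coef0 /a horner_sum -he dotC dotE; apply: eq_bigr => i _.
  rewrite hornerM hornerC -/(branch_eval gam _) horner_coef0 branch_eval_coef0 g0.
  by rewrite [grad f v 0 i]mxE.
have hac : root (h + c%:P * a) 0.
  by rewrite rootE hornerD hornerM hornerC !horner_coef0 a0 mulr1 subrr.
have [h' h'E] := factor_theorem _ _ hac.
apply/dvdpP; exists (h' + r * c%:P ^+ 2 * 'X^(n.+1)).
transitivity ((h + c%:P * a) * 'X^(n.+2) + r * (c%:P * 'X^(n.+2)) ^+ 2); first by ring.
rewrite h'E subr0 !exprS; ring.
Qed.

(** For k = 1 this is X^q f_X + Y^q f_Y + Z^q f_Z, which vanishes at a point of the curve when the
    tangent line there contains the Frobenius image of the point. *)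
Definition polar k f : {mpoly F[3]} :=
  (along (@mpolyC 3 F) (fun i => 'X_i) (fun i => 'X_i ^+ q) f)`_k.

Lemma polar_homog d k f :
  f \is d.-homog -> (k <= d)%N -> polar k f \is (d - k + k * q).-homog.
Proof.
move=> hf kd; rewrite -[(d - k)%N]muln1; apply: coef_along_homog hf kd => i.
  by rewrite dhomogX /= mdeg1.
by rewrite -{2}[q]mul1n; apply: dhomogMn; rewrite dhomogX /= mdeg1.
Qed.

Lemma mmap_mpolyC_id f : mmap (@mpolyC 3 F) (fun i => 'X_i) f = f.
Proof.
rewrite -[RHS]comp_mpoly_id /comp_mpoly; apply: mmap_eq => i.
by rewrite tnth_mktuple.
Qed.

Lemma polar0 f : polar 0 f = f.
Proof. by rewrite /polar along_coef0 mmap_mpolyC_id. Qed.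

Lemma branch_polar gam k f :
  branch_eval gam (polar k f) = (along (@polyC F) gam (fun i => gam i ^+ q) f)`_k.
Proof.
apply: (coef_along_ext (psi := branch_eval gam)) => [c|i|i] /=.
- by rewrite /branch_eval mmapC.
- by rewrite /branch_eval mmapXU.
- by rewrite rmorphXn /= /branch_eval mmapXU.
Qed.

Lemma branch_polar_line d gam f (a b : {poly {poly F}}) : f \is d.-homog ->
  mmap (polyC \o @polyC F) (fun i => a * (gam i)%:P + b * (gam i ^+ q)%:P) f =
  \sum_(j < d.+1) a ^+ (d - j) * b ^+ j * (branch_eval gam (polar j f))%:P.
Proof.
move=> hf; rewrite (mmap_line _ (fun i => (gam i)%:P) (fun i => (gam i ^+ q)%:P) a b hf).
apply: eq_bigr => j _; rewrite branch_polar; congr (_ * _).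
by rewrite -(coef_along_ext (iota := @polyC F) (psi := polyC) (V := gam) (W := fun i => gam i ^+ q)).
Qed.

Lemma branch_frobenius gam f :
  mmap (@polyC F) (fun i => gam i ^+ q) f = branch_eval gam f ^+ q.
Proof. exact: frobenius_mmap. Qed.

Lemma frobenius_branch_root gam i : root (gam i ^+ q - gam i) 0.
Proof.
by rewrite rootE hornerD hornerN horner_exp expf_card subrr.
Qed.

(* With [delta = gam ^ q - gam], divisible by t, the coefficient of u^j in f (gam + u delta)
   is divisible by t^j, and these coefficients add up to f (gam ^ q) = f (gam) ^ q. On the
   other hand they are triangular combinations of the [polar j f] along the branch. *)
Lemma branch_polar_vanish d f gam k :
    f \is d.-homog -> (k <= d)%N -> 'X^(k.+1) %| branch_eval gam f ->
    (forall j, (j < k)%N -> divides f (polar j f)) ->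
  'X^(k.+1) %| branch_eval gam (polar k f).
Proof.
move=> hf kd fgam polf; pose c j := branch_eval gam (polar j f).
have cdvd j : (j < k)%N -> 'X^(k.+1) %| c j.
  by case/polf => h; rewrite /c => ->; rewrite branch_evalM dvdp_mulr.
have [del delE] := fin_all_exists (fun i => factor_theorem _ _ (frobenius_branch_root gam i)).
pose B := along (@polyC F) gam (fun i => 'X * del i) f.
have Bj j : 'X^j %| B`_j by rewrite /B along_scale_dir coef_comp_scale dvdp_mulr.
have BE : B = \sum_(j < d.+1) (1 - 'X) ^+ (d - j) * 'X^j * (c j)%:P.
  rewrite -branch_polar_line //; apply: mmap_eq => i.
  have -> : 'X * del i = gam i ^+ q - gam i by rewrite delE subr0 mulrC.
  by rewrite rmorphB /=; ring.
have Bi i : B`_i = \sum_(j < d.+1) ((1 - 'X) ^+ (d - j) * 'X^j)`_i * c j.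
  by rewrite BE coef_sum; apply: eq_bigr => j _; rewrite coefMC.
have coef0 i j : (i < j)%N -> ((1 - 'X : {poly {poly F}}) ^+ (d - j) * 'X^j)`_i = 0.
  by move=> ij; rewrite coefMXn ij.
have Blt i : (i < k)%N -> 'X^(k.+1) %| B`_i.
  move=> ik; rewrite Bi; apply: dvdp_bigsum => j _.
  have [jk|kj] := ltnP j k; first by rewrite dvdp_mull // cdvd.
  by rewrite coef0 ?mul0r ?dvdp0 // (leq_trans ik).
have Bgt i : (k < i)%N -> 'X^(k.+1) %| B`_i.
  by move=> ki; apply: dvdp_trans (Bj i); rewrite -(subnK ki) exprD dvdp_mull.
have sumB : \sum_(i < d.+1) B`_i = branch_eval gam f ^+ q.
  transitivity B.[1].
    rewrite (horner_coef_wide _ (size_along _ _ _ hf)).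
    by apply: eq_bigr => i _; rewrite expr1n mulr1.
  rewrite horner_along -branch_frobenius; apply: mmap_eq => i.
  by rewrite mulr1 mulrC -['X]subr0 -delE addrC subrK.
have Bk : 'X^(k.+1) %| B`_k.
  have kO : (k < d.+1)%N by rewrite ltnS.
  have -> : B`_k = branch_eval gam f ^+ q - \sum_(i < d.+1 | i != Ordinal kO) B`_i.
    by rewrite -sumB (bigD1 (Ordinal kO)) //= addrK.
  apply: dvdp_sub; last apply: dvdp_bigsum => i /= ik.
    by rewrite -(prednK (ltnW (card_field_gt1 F))) [branch_eval gam f ^+ _]exprS dvdp_mulr.
  by case: (ltngtP i k) ik => [/Blt//|/Bgt//|ik]; rewrite -val_eqE /= ik eqxx.
have kO : (k < d.+1)%N by rewrite ltnS.
move: Bk; rewrite Bi (bigD1 (Ordinal kO)) //= coefMXn ltnn subnn -horner_coef0.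
rewrite horner_exp hornerD hornerN hornerX hornerC subr0 expr1n mul1r dvdp_addl //.
apply: dvdp_bigsum => j; rewrite -val_eqE /= => jk.
case: (ltngtP j k) jk => [jk _|kj _|//].
  by rewrite dvdp_mull // cdvd.
by rewrite coef0 // mul0r dvdp0.
Qed.

(* Otherwise f would vanish on the tangent line at v: the tangent line would contain the
   Frobenius image of the branch, which is constant to the order q > d. *)
Lemma polar_not_divisible d f v :
    f \is d.-homog -> line_free f -> (d < q)%N -> v != 0 -> f.@[coords v] = 0 ->
    grad f v != 0 ->
  exists2 k, (k < d)%N & ~ divides f (polar k f).
Proof.
move=> hf linef dq v0 fv gv; apply: NNPP => nok.
(* The case k = d is automatic: the top coefficient is f(X^q, Y^q, Z^q) = f^q. *)
have polf k : (k <= d)%N -> divides f (polar k f).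
  rewrite leq_eqVlt => /predU1P[->|kd]; last by apply: NNPP => nf; apply: nok; exists k.
  exists (f ^+ q.-1); rewrite -exprS prednK ?(ltnW (card_field_gt1 F)) //.
  rewrite /polar (along_coef_top _ _ _ hf) frobenius_mmap mmap_mpolyC_id //.
have [gam [g0 g1 gK]] := branch_exists d.+1 hf v0 fv gv.
have [del delE] := fin_all_exists (fun i => factor_theorem _ _ (frobenius_branch_root gam i)).
(* Compare the coefficients of t in gam^q - gam = t del; the q-th power contributes none because its
   derivative is zero. *)
have tauE i : (- del i)`_0 = branch_coef gam 1 0 i.
  have : (gam i ^+ q - gam i)`_1 = (del i)`_0 by rewrite delE subr0 coefMX.
  rewrite coefN mxE => <-; rewrite coefB (_ : (gam i ^+ q)`_1 = 0) ?sub0r ?opprK //.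
  have := coef_deriv (gam i ^+ q) 0; rewrite mulr1n => <-; rewrite deriv_exp.
  by rewrite coefMn -mulr_natr natr_card mulr0.
(* Expanded from gam^q towards gam, each coefficient of f is a combination of polars, hence a
   multiple of f(gam) and of t^(d+1). Coefficient i carries a factor t^i from the direction; for i
   <= d, dividing it out leaves a multiple of t. At t = 0 the quotients are the coefficients of f on
   the tangent line. *)
pose B := along (@polyC F) (fun i => gam i ^+ q) (fun i => 'X * - del i) f.
have BE : B = \sum_(j < d.+1) 'X ^+ (d - j) * (1 - 'X) ^+ j * (branch_eval gam (polar j f))%:P.
  rewrite -branch_polar_line //; apply: mmap_eq => i.
  have -> : 'X * - del i = gam i - gam i ^+ q by rewrite mulrN mulrC -['X]subr0 -delE opprB.
  by rewrite rmorphB /=; ring.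
have Bdvd i : 'X^(d.+1) %| B`_i.
  rewrite BE coef_sum; apply: dvdp_bigsum => j _; rewrite coefMC dvdp_mull //.
  have [h ->] := polf j (ltn_ord j : (j <= d)%N).
  by rewrite branch_evalM dvdp_mulr.
case/eqP: (linef _ _ g1); apply/polyP => i; rewrite coef0.
have [di|di] := ltnP d i; first by rewrite nth_default // (leq_trans (size_along _ _ _ hf)).
have := Bdvd i; rewrite /B along_scale_dir coef_comp_scale.
rewrite -(subnKC (leqW di)) exprD dvdp_mul2l ?expf_neq0 ?polyX_eq0 //.
rewrite subSn // exprS => /dvdpP[h hE].
have := congr1 (horner_eval 0) hE; rewrite /horner_eval hornerM [in RHS]hornerM hornerX mul0r mulr0.
rewrite -/(horner_eval 0 _).
rewrite (coef_along_ext (psi := horner_eval 0) (iota' := idfun) (V' := coords v)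
  (W' := coords (branch_coef gam 1))) // => j.
- by rewrite /= /horner_eval hornerC.
- by rewrite rmorphXn /= /horner_eval expf_card horner_coef0 -g0 /coords mxE.
- by rewrite /= /horner_eval horner_coef0 tauE.
Qed.

End Branches.

Lemma ex_least (P : nat -> Prop) n : P n -> exists2 k, (k <= n)%N /\ P k & forall j, (j < k)%N -> ~ P j.
Proof.
elim/ltn_ind: n => n IHn Pn; have [[j jn Pj]|nlt] := classic (exists2 j, (j < n)%N & P j).
  have [k [kj Pk] kmin] := IHn j jn Pj; exists k => //; split=> //.
  exact: leq_trans kj (ltnW jn).
by exists n => // j jn Pj; apply: nlt; exists j.
Qed.

Section SmallDegree.

Variable F : finFieldType.
Local Notation q := #|F|.
Local Notation V3 := 'rV[F]_3.
Implicit Types (v w : V3) (f g h : {mpoly F[3]}).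

Lemma prime_form_bound d f : (1 < d)%N -> (d < q)%N -> f \is d.-homog ->
  prime_elt f -> line_free f -> smooth f -> (num_points f <= (d - 1) * q + 1)%N.
Proof.
move=> d1 dq hf primef linef smf; rewrite (num_pointsE hf).
set A := [set _ in _ | _]; have [/eqP A0|] := posnP #|A|; first by rewrite (eqP A0).
case/card_gt0P => v; rewrite in_set => /andP[/points_neq0 v0 /eqP fv].
(* The least order depends on [f] alone: one rational point suffices to bound it by d - 1, and it
   then serves for the branches at all points. *)
have [k' k'd k'P] := polar_not_divisible hf linef dq v0 fv (smf _ v0 fv).
have [k [kk' kP] kmin] := @ex_least (fun k => ~ divides f (polar k f)) k' k'P.
have kd : (k < d)%N by apply: leq_ltn_trans k'd.
have k0 : (0 < k)%N.
  by rewrite lt0n; apply/eqP => k0; apply: kP; rewrite k0 polar0; exists 1; rewrite mulr1.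
pose I : finType := {P : V3 | P \in A}.
have IP (i : I) : [/\ val i \in points F, val i != 0 & f.@[coords (val i)] = 0].
  by have := valP i; rewrite in_set => /andP[hi /eqP ->]; rewrite points_neq0.
have [gam gamP] : exists gam : I -> 'I_3 -> {poly F}, forall i, branch f (val i) k.+1 (gam i).
  apply: (fin_all_exists (P := fun i => branch f (val i) k.+1)) => i.
  by have [_ i0 fi] := IP i; apply: branch_exists hf i0 fi (smf _ i0 fi).
have := @bezout F f (polar k f) d (d - k + k * q) hf (polar_homog hf (ltnW kd)) primef kP
  I k.+1 gam.
have -> : #|I| = #|A| by rewrite card_sig.
move=> bz; have {}bz : (#|A| * k.+1 <= d * (d - k + k * q))%N.
  apply: bz => [i j ij|i|i|i].
  - have [-> _ _] := gamP i; have [-> _ _] := gamP j.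
    have [hi _ _] := IP i; have [hj _ _] := IP j.
    by apply: cross_points_neq0 => //; rewrite (inj_eq val_inj).
  - by have [-> ? _] := gamP i.
  - by have [] := gamP i.
  - have [_ _ fi] := gamP i; apply: branch_polar_vanish hf (ltnW kd) fi _ => j jk.
    by apply: NNPP; apply: kmin.
rewrite leqNgt; apply/negP => lt.
(* With d = k + m + 1 and q = d + r + 1, the difference ((d - 1) q + 2)(k + 1) - d (d - k + k q)
   equals m r + k + 1, so one point beyond the bound contradicts Bezout's theorem. *)
have [m dE] : exists m, d = (k + m.+1)%N by exists (d - k.+1)%N; move: kd; lia.
have [r qE] : exists r, q = (d + r.+1)%N by exists (q - d.+1)%N; move: dq; lia.
have : (((d - 1) * q + 2) * k.+1 <= d * (d - k + k * q))%N.
  by apply: leq_trans bz; rewrite leq_mul2r orbC; move: lt; rewrite addn1 addn2 => ->.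
have -> : (d - k = m.+1)%N by rewrite dE addKn.
have -> : (d - 1 = k + m)%N by rewrite dE addnS subn1.
rewrite qE dE; nia.
Qed.

Definition linear_factor_free f : Prop := forall l g, msize l = 2%N -> f <> l * g.

Lemma line_free_intro d f : f \is d.-homog -> linear_factor_free f -> line_free f.
Proof.
move=> hf lin v w n0; apply/eqP => /(along_eq0_factor hf n0)[g fE].
by apply: (lin _ _ (msize_linform n0) fE).
Qed.

Lemma gradM f g v : grad (f * g) v = g.@[coords v] *: grad f v + f.@[coords v] *: grad g v.
Proof.
by apply/rowP => i; rewrite !mxE mderivM mevalD !mevalM; congr (_ + _); rewrite mulrC.
Qed.

Lemma smooth_factor f g : smooth (f * g) -> smooth f.
Proof.
move=> sm v v0 fv; have := sm v v0; rewrite mevalM fv mul0r gradM fv scale0r addr0.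
by move/(_ erefl); rewrite scaler_eq0 negb_or => /andP[].
Qed.

Lemma num_pointsM d e f g : f \is d.-homog -> g \is e.-homog ->
  (num_points (f * g) <= num_points f + num_points g)%N.
Proof.
move=> hf hg; rewrite (num_pointsE (dhomogM hf hg)) (num_pointsE hf) (num_pointsE hg).
apply: leq_trans (leq_card_setU _ _); apply: subset_leq_card; apply/subsetP => P.
rewrite in_setU !in_set mevalM mulf_eq0 => /andP[-> /orP[] ->] //.
by rewrite orbT.
Qed.

(** [primeP] gives each prime factor of degree e a saving of q - 1 over e q, linear factors being
    excluded. One factor [p] keeps its saving; the product of the others is bounded by q times its
    degree. *)
Lemma small_degree_bound d f : (d < q)%N -> f != 0 -> f \is d.-homog ->
  linear_factor_free f -> smooth f -> (0 < d)%N -> (num_points f <= (d - 1) * q + 1)%N.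
Proof.
move=> dq f0 hf linf smf d0.
have primeP e p g : f = p * g -> prime_elt p -> p \is e.-homog -> (e <= d)%N ->
    (num_points p + (q - 1) <= e * q)%N.
  move=> fE primep hp ed; have [p0 pu _] := primep.
  have linp : linear_factor_free p.
    by move=> l h l2 pE; apply: (linf l (h * g) l2); rewrite fE pE mulrA.
  have smp : smooth p by apply: smooth_factor (g) _; rewrite -fE.
  have szp : msize p = e.+1 by rewrite -mlead_deg // (dhomog_mf hp) ?mlead_supp.
  case: e hp ed szp => [|[|e]] hp ed szp.
  - case/negP: pu; have [c c0 ->] := msize_poly1P _ (introT eqP szp).
    by rewrite rmorph_unit // unitfE.
  - by case: (linp p 1 szp); rewrite mulr1.
  have := prime_form_bound (isT : (1 < e.+2)%N) (leq_ltn_trans ed dq) hp primep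
    (line_free_intro hp linp) smp.
  by have := card_field_gt1 F; rewrite subn1 /= mulSn; lia.
have [u [s [uu sP fE]]] := is_factorial_mpoly (@is_factorial_field F) f0.
have prodP t : {subset t <= s} -> forall e g h, g = u * \prod_(p <- t) p -> f = g * h ->
    g \is e.-homog -> (e <= d)%N -> (num_points g <= e * q)%N.
  elim: t => [|p t IHt] ts e g h gE fgh hg ed.
    rewrite (num_pointsE hg) gE big_nil mulr1 (_ : [set _ in _ | _] = set0) ?cards0 //.
    apply/setP => P; rewrite in_set in_set0; apply/negP => /andP[_ /eqP uP].
    have := congr1 (meval (coords P)) (mulVr uu); rewrite mevalM uP mulr0 meval1 => /esym/eqP.
    by rewrite oner_eq0.
  have gE' : g = p * (u * \prod_(x <- t) x) by rewrite gE big_cons mulrCA.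
  have g0 : g != 0 by apply: contraNneq f0 => g0; rewrite fgh g0 mul0r.
  rewrite gE' in g0 hg; have [i [j [ij hi hj]]] := homog_factor g0 hg.
  have := num_pointsM hi hj; rewrite -gE' => /leq_trans; apply.
  rewrite -ij mulnDl leq_add //.
    have := @primeP i p (u * \prod_(x <- t) x * h); rewrite mulrA -gE'.
    move=> /(_ fgh (sP _ (ts _ (mem_head _ _))) hi) H.
    by apply: leq_trans (H _); [exact: leq_addr | move: ed; lia].
  apply: (IHt _ j _ (p * h)) => // [x xt||]; first by apply: ts; rewrite inE xt orbT.
    by rewrite fgh gE'; ring.
  by move: ed; lia.
have q1 := card_field_gt1 F.
case: s sP fE prodP => [|p s] sP fE prodP.
  (* Without prime factors [f] is a unit, hence of degree 0 and without zeros. *)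
  have := prodP [::] (fun _ => id) 0%N f 1 fE (esym (mulr1 f)); rewrite mul0n.
  have d0' : f \is 0.-homog.
    rewrite big_nil mulr1 in fE; have := mulVr uu; rewrite -fE => ff.
    have f10 : f^-1 * f != 0 by rewrite ff oner_neq0.
    have [|i [j [ij hi hj]]] := @homog_factor _ _ 0 f^-1 f f10; first by rewrite ff dhomog1.
    by move/eqP: ij; rewrite addn_eq0 => /andP[_ /eqP j0]; move: hj; rewrite j0.
  by move=> /(_ d0' (leq0n _)); rewrite leqn0 => /eqP->.
have fE' : f = p * (u * \prod_(x <- s) x) by rewrite fE big_cons mulrCA.
have [i [j [ij hi hj]]] : exists i j, [/\ (i + j)%N = d, p \is i.-homog &
    u * \prod_(x <- s) x \is j.-homog] by apply: homog_factor; rewrite -fE'.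
have Np : (num_points p + (q - 1) <= i * q)%N.
  by apply: primeP fE' (sP _ (mem_head _ _)) hi _; rewrite -ij leq_addr.
have Ns : (num_points (u * \prod_(x <- s) x) <= j * q)%N.
  apply: (prodP s _ j _ p) => // [x xs||]; first by rewrite inE xs orbT.
    by rewrite mulrC.
  by rewrite -ij leq_addl.
have := num_pointsM hi hj; rewrite -fE' -ij => /leq_trans; apply.
have i0 : (0 < i)%N by case: (i) Np; rewrite // mul0n; lia.
move: Np Ns; rewrite -addnBAC // mulnDl mulnBl mul1n.
have : (q <= i * q)%N by rewrite -{1}[q]mul1n leq_mul2r i0 orbT.
by lia.
Qed.

End SmallDegree.

(** * Degree q *)

Section PowerSums.

Variable F : finFieldType.
Local Notation q := #|F|.
Local Notation V3 := 'rV[F]_3.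

(** Replacing x by g x multiplies the sum by g^a, and some g has g^a different from 1 because x^a -
    1 has at most a roots. *)
Lemma power_sum (a : nat) : (a < q.-1)%N -> \sum_(x : F) x ^+ a = 0.
Proof.
(* With 0^0 = 1 the sum for a = 0 is q, which is zero in the field. *)
move=> aq; have [->|a0] := posnP a.
  under eq_bigr do rewrite expr0.
  by rewrite sumr_const natr_card.
have [g g0 ga] : exists2 g : F, g != 0 & g ^+ a != 1.
  apply/exists_inP; rewrite -negb_forall_in; apply/negP => /forall_inP all1.
  have p0 : ('X^a - 1 : {poly F}) != 0 by rewrite -size_poly_eq0 size_XnsubC.
  have := @max_poly_roots _ _ (enum [pred x : F | x != 0]) p0.
  rewrite enum_uniq size_XnsubC // -cardE card_nonzero ltnS leqNgt aq => H.
  suff : all (root ('X^a - 1)) (enum [pred x : F | x != 0]) by move/H => /(_ isT).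
  apply/allP => x; rewrite mem_enum => /all1/eqP xa.
  by rewrite rootE !hornerE xa subrr.
have E : \sum_x x ^+ a = g ^+ a * \sum_x x ^+ a.
  rewrite {1}(reindex_onto (fun x => g * x) (fun x => g^-1 * x)) => [|x _]; last by rewrite mulVKf.
  rewrite mulr_sumr; apply: eq_big => [x|x _]; first by rewrite mulKf ?eqxx.
  by rewrite exprMn.
apply/eqP; have : (1 - g ^+ a) * \sum_x x ^+ a == 0 by rewrite mulrBl mul1r -E subrr.
by rewrite mulf_eq0 subr_eq0 eq_sym (negPf ga).
Qed.

Lemma monomial_sum (m : 'I_3 -> nat) :
  \sum_(v : V3) \prod_i v 0 i ^+ m i = \prod_i \sum_(x : F) x ^+ m i.
Proof.
rewrite bigA_distr_bigA /=.
rewrite (reindex (fun v : V3 => [ffun i => v 0 i])) /=.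
  by apply: eq_bigr => v _; apply: eq_bigr => i _; rewrite ffunE.
exists (fun g : {ffun 'I_3 -> F} => \row_i g i) => [v _|g _].
  by apply/rowP => i; rewrite mxE ffunE.
by apply/ffunP => i; rewrite ffunE mxE.
Qed.

(** The argument of Chevalley and Warning: every monomial of such a form has an exponent below q -
    1, whose power sum vanishes. *)
Lemma form_sum_eq0 d (f : {mpoly F[3]}) :
  f \is d.-homog -> (d < 3 * q.-1)%N -> \sum_(v : V3) f.@[coords v] = 0.
Proof.
move=> hf dq; under eq_bigr do rewrite mevalE.
rewrite exchange_big /= big_seq big1 // => m mf.
rewrite -mulr_sumr monomial_sum; have md : mdeg m = d by have /dhomogP/(_ m mf) := hf.
have [i mi] : exists i, (m i < q.-1)%N.
  apply/existsP; apply: contraLR dq; rewrite negb_exists => /forallP mge.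
  rewrite -leqNgt -md mdegE (_ : 3 * q.-1 = \sum_(i < 3) q.-1)%N; last first.
    by rewrite sum_nat_const card_ord.
  by apply: leq_sum => i _; rewrite leqNgt.
by rewrite (bigD1 i) //= power_sum // mul0r mulr0.
Qed.

(** As q - 1 divides the degree, the value is the same on all nonzero multiples of a point. The sum
    over vectors is therefore q - 1 = -1 times the sum over points. *)
Lemma points_sum_eq0 (f : {mpoly F[3]}) :
  f \is (2 * q.-1).-homog -> \sum_(P in points F) f.@[coords P] = 0.
Proof.
have q1 : (0 < q.-1)%N by rewrite -subn1 subn_gt0 card_field_gt1.
move=> hf; have := form_sum_eq0 hf; rewrite ltn_pmul2r // => /(_ isT).
rewrite (bigD1 0) //= -[X in coords X](scale0r 0) (meval_scale _ _ hf).
rewrite expr0n muln_eq0 /= eqn0Ngt q1 mul0r add0r big_points.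
rewrite (eq_bigr (fun P => - f.@[coords P])) => [|P _].
  by rewrite sumrN => /eqP; rewrite oppr_eq0 => /eqP.
rewrite (eq_bigr (fun=> f.@[coords P])) => [|a a0].
  rewrite sumr_const card_nonzero -mulr_natr.
  have : (q.-1)%:R + 1 = 0 :> F by rewrite natr1 prednK ?natr_card // ltnW ?card_field_gt1.
  by move/eqP; rewrite addr_eq0 => /eqP->; rewrite mulrN1.
rewrite (meval_scale _ _ hf) mulnC exprM.
have -> : a ^+ q.-1 = 1; last by rewrite expr1n mul1r.
apply: (mulfI a0); rewrite -exprS prednK ?expf_card ?mulr1 //.
by rewrite ltnW ?card_field_gt1.
Qed.

Lemma form_nonzero_point (f : {mpoly F[3]}) R :
    f \is (2 * q.-1).-homog -> R \in points F ->
    (forall Q, Q \in points F -> Q != R -> f.@[coords Q] = 0) -> f.@[coords R] = 0.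
Proof.
move=> hf hR fz; have := points_sum_eq0 hf.
by rewrite (bigD1 R) //= big1 ?addr0 // => Q /andP[hQ QR]; rewrite fz.
Qed.

(** Otherwise [f] times the lines, filled up to degree 2 (q - 1) by a power of a form that is
    nonzero at [R], would be nonzero at [R] and at no other rational point. *)
Lemma cover_complement (f : {mpoly F[3]}) R (ls : seq V3) :
    f \is q.-homog -> R \in points F -> f.@[coords R] != 0 -> (size ls + 2 <= q)%N ->
    (forall l, l \in ls -> dot l R != 0) ->
    (forall Q, Q \in points F -> f.@[coords Q] != 0 -> Q != R ->
      exists2 l, l \in ls & dot l Q = 0) ->
  False.
Proof.
move=> hf hR fR szls lsR cov; have [l0 l0R] := dot_surj (points_neq0 hR).
pose h := \prod_(l <- ls) linform l * linform l0 ^+ (q - 2 - size ls).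
have hh : h \is (q - 2).-homog.
  have -> : (q - 2 = size ls + 1 * (q - 2 - size ls))%N by rewrite mul1n; move: szls; lia.
  apply: dhomogM; last exact: dhomogMn (linform_homog _).
  elim: (ls) => [|l s IHs]; first by rewrite big_nil dhomog1.
  by rewrite big_cons -[size _]/(1 + size s)%N; apply: dhomogM IHs; apply: linform_homog.
have hfh : f * h \is (2 * q.-1).-homog.
  by have -> : (2 * q.-1 = q + (q - 2))%N; [move: szls; lia | apply: dhomogM].
have hE Q : h.@[coords Q] = \prod_(l <- ls) dot l Q * dot l0 Q ^+ (q - 2 - size ls).
  rewrite mevalM rmorphXn /= meval_linform rmorph_prod; congr (_ * _).
  by apply: eq_bigr => l _; rewrite /= meval_linform.
suff : (f * h).@[coords R] = 0.
  apply/eqP; rewrite mevalM hE [dot l0 R]dotC l0R expr1n mulr1 mulf_neq0 // prodf_seq_neq0.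
  by apply/allP => l /lsR.
apply: (form_nonzero_point hfh hR) => Q hQ QR; rewrite mevalM hE.
have [->|fQ] := eqVneq f.@[coords Q] 0; first by rewrite mul0r.
have [l lls lQ] := cov Q hQ fQ QR.
by rewrite (big_rem l) //= lQ !mul0r mulr0.
Qed.

End PowerSums.

(** * Double counting of a set of points along lines *)

Section Incidence.

Variable F : finFieldType.
Local Notation q := #|F|.
Local Notation V3 := 'rV[F]_3.
Implicit Types (l P Q R : V3) (M B : {set V3}).

Definition line_card M l : nat := #|[set R in M | dot l R == 0]|.

Lemma line_cardE M l : line_card M l = (\sum_(R in M) (dot l R == 0)%R)%N.
Proof.
rewrite /line_card -sum1dep_card big_mkcondr /=.
by apply: eq_bigr => R _; case: eqP.
Qed.

Lemma card_lines_through P : P != 0 -> (\sum_(l in points F) (dot l P == 0)%R)%N = q.+1.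
Proof.
move=> P0; rewrite -(card_line_points P0) -sum1dep_card [RHS]big_mkcondr /=.
by apply: eq_bigr => l _; rewrite dotC; case: eqP.
Qed.

Lemma card_lines_through2 P Q : P \in points F -> Q \in points F -> P != Q ->
  (\sum_(l in points F) (dot l P == 0)%R * (dot l Q == 0)%R)%N = 1%N.
Proof.
move=> hP hQ PQ; have hl : rep (cross P Q) \in points F.
  exact/rep_points/cross_points_neq0.
rewrite (bigD1 _ hl) /= big1 ?addn0 => [|l /andP[hl' lPQ]].
  by rewrite mulnb line_through // eqxx.
by rewrite mulnb line_through // (negPf lPQ).
Qed.

Lemma sum_line_card M : M \subset points F ->
  (\sum_(l in points F) line_card M l = #|M| * q.+1)%N.
Proof.
move=> /subsetP sM; under eq_bigr do rewrite line_cardE.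
rewrite exchange_big -sum_nat_const; apply: eq_bigr => P /sM hP.
exact: card_lines_through (points_neq0 hP).
Qed.

Lemma sum_line_card_through M P : M \subset points F -> P \in points F -> P \notin M ->
  (\sum_(l in points F) (dot l P == 0)%R * line_card M l = #|M|)%N.
Proof.
move=> /subsetP sM hP PM.
under eq_bigr do rewrite line_cardE big_distrr /=.
rewrite exchange_big -sum1_card; apply: eq_bigr => Q QM /=.
by apply: card_lines_through2 => //; [apply: sM | apply: contraNneq PM => ->].
Qed.

Lemma sum_line_card_sqr M : M \subset points F ->
  (\sum_(l in points F) line_card M l ^ 2 = #|M| * (q + #|M|))%N.
Proof.
move=> /subsetP sM.
rewrite (eq_bigr (fun l => \sum_(P in M) \sum_(Q in M) (dot l P == 0)%R * (dot l Q == 0)%R))%N.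
  rewrite exchange_big -sum_nat_const; apply: eq_bigr => P PM /=.
  rewrite exchange_big (bigD1 P) //= (_ : \sum_(l in _) _ = q.+1)%N.
    rewrite (eq_bigr (fun=> 1%N)) => [|Q /andP[QM QP]].
      rewrite sum1_card addSnnS; congr (_ + _)%N.
      by rewrite [RHS](cardD1 P) PM add1n; congr S; apply: eq_card => Q; rewrite !inE andbC.
    by apply: card_lines_through2; rewrite ?sM // eq_sym.
  rewrite -(card_lines_through (points_neq0 (sM _ PM))).
  by apply: eq_bigr => l _; case: eqP.
by move=> l _; rewrite line_cardE expnS expn1 big_distrlr.
Qed.

Lemma common_points_le1 M l l' : M \subset points F ->
  l \in points F -> l' \in points F -> l != l' ->
  (#|[set R in M | (dot l R == 0%R) && (dot l' R == 0%R)]| <= 1)%N.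
Proof.
move=> /subsetP sM hl hl' ll'; apply/card_le1P => P; rewrite in_set => /and3P[PM lP l'P] Q.
rewrite in_set inE; apply/and3P/eqP => [[QM lQ l'Q]|->]; last by [].
(* Duality: two points lie on one line, read with the roles of points and lines exchanged. *)
have := @line_through F l l' P hl hl' ll' (sM _ PM).
have := @line_through F l l' Q hl hl' ll' (sM _ QM).
by rewrite ![dot _ l]dotC ![dot _ l']dotC lP lQ l'P l'Q /= => /esym/eqP-> /esym/eqP->.
Qed.

(* Join two points lying on different lines through R, taken from the largest classes. *)
Lemma cover_avoiding R B n : R \in points F -> B \subset points F -> R \notin B ->
    (forall l, l \in points F -> dot l R = 0 -> (line_card B l <= n)%N) ->
    (#|B| <= n.*2)%N ->
  exists ls : seq V3, [/\ (size ls <= n)%N, forall l, l \in ls -> dot l R != 0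
    & forall Q, Q \in B -> exists2 l, l \in ls & dot l Q = 0].
Proof.
move=> hR; elim: n B => [|n IHn] B sB RB lB cB.
  exists [::]; split=> // Q; move: cB; rewrite leqn0 cards_eq0 => /eqP->.
  by rewrite inE.
have [/eqP B0|[X0 X0B]] := set_0Vmem B.
  by exists [::]; split=> // Q; rewrite (eqP B0) inE.
have hB Z : Z \in B -> Z \in points F by move/(subsetP sB).
pose kap Z := rep (cross R Z).
have RZ Z : Z \in B -> R != Z by apply: contraTneq => <-.
have hkap Z : Z \in B -> kap Z \in points F.
  by move=> ZB; apply/rep_points/cross_points_neq0 => //; [apply: hB | apply: RZ].
have kapR Z : dot (kap Z) R = 0.
  by rewrite /kap; have [a a0 ->] := repP (cross R Z); rewrite dotZl dotC dot_crossl mulr0.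
have onkap Z l : Z \in B -> l \in points F -> dot l R = 0 -> (dot l Z == 0) = (l == kap Z).
  by move=> ZB hl lR; rewrite -(line_through hR (hB _ ZB) (RZ _ ZB) hl) lR eqxx.
have [|X XB Xmax] := @arg_maxnP _ X0 (mem B) (fun Z => line_card B (kap Z)) => //.
have {}XB : X \in B := XB.
(* One induction step: a line [x] avoiding [R] takes care of the points outside [C], and [C]
   satisfies the hypotheses for [n]. *)
have rest (C : {set V3}) (x : V3) : C \subset B -> (#|C| <= n.*2)%N ->
    (forall l, l \in points F -> dot l R = 0 -> (line_card C l <= n)%N) ->
    dot x R != 0 -> (forall Q, Q \in B -> Q \notin C -> dot x Q = 0) ->
  exists ls : seq V3, [/\ (size ls <= n.+1)%N, forall l, l \in ls -> dot l R != 0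
    & forall Q, Q \in B -> exists2 l, l \in ls & dot l Q = 0].
  move=> sC cC lC xR xQ.
  have [||||ls [szls lsR lsQ]] := IHn C => //.
  - exact: subset_trans sC sB.
  - by apply: contra RB; apply: (subsetP sC).
  exists (x :: ls); split=> [//|l|Q QB].
    by rewrite inE => /predU1P[->//|/lsR].
  have [QC|QC] := boolP (Q \in C).
    by have [l lls lQ] := lsQ Q QC; exists l; rewrite // inE lls orbT.
  by exists x; rewrite ?mem_head ?xQ.
have subC (C : {set V3}) l : C \subset B -> (line_card C l <= line_card B l)%N.
  move=> /subsetP sC; apply: subset_leq_card; apply/subsetP => Z.
  by rewrite !in_set => /andP[/sC-> ->].
(* If all of [B] lies on a single line through [R], there are at most n + 1 points, and a line
   through [X] alone is used up. *)
have [Y0 /andP[Y0B Y0X]|sameX] := pickP [pred Z | (Z \in B) && (kap Z != kap X)]; last first.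
  have cBn : (#|B| <= n.+1)%N.
    apply: leq_trans (lB (kap X) (hkap _ XB) (kapR X)); rewrite /line_card subset_leq_card //.
    apply/subsetP => Z ZB; rewrite in_set ZB onkap ?hkap //= eq_sym.
    by have := sameX Z; rewrite /= ZB => /negbFE.
  have XR : cross X R != 0.
    by rewrite crossC oppr_eq0; apply: cross_points_neq0 => //; [apply: hB | apply: RZ].
  have [x [xX xR]] := separating_form XR.
  have cC : (#|B :\ X| <= n)%N by move: cBn; rewrite (cardsD1 X) XB.
  apply: (rest (B :\ X) x).
  - exact: subsetDl.
  - by apply: leq_trans cC _; rewrite -addnn leq_addr.
  - move=> l _ _; apply: leq_trans cC; apply: subset_leq_card; apply/subsetP => Z.
    by rewrite in_set => /andP[].
  - by rewrite xR oner_neq0.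
  - by move=> Q QB; rewrite in_setD1 QB andbT negbK => /eqP->.
have PY0 : [pred Z | (Z \in B) && (kap Z != kap X)] Y0 by rewrite /= Y0B.
have [Y /andP[YB YX] Ymax] := arg_maxnP (fun Z => line_card B (kap Z)) PY0.
have YneX : Y != X by apply: contraNneq YX => ->.
apply: (rest (B :\ X :\ Y) (cross X Y)).
- by apply: subset_trans (subsetDl _ _) (subsetDl _ _).
- move: cB; rewrite (cardsD1 X) XB (cardsD1 Y (B :\ X)) in_setD1 YneX YB doubleS.
  by rewrite !add1n.
- move=> l hl lR; rewrite leqNgt; apply/negP => lC.
  have sC : B :\ X :\ Y \subset B by apply: subset_trans (subsetDl _ _) (subsetDl _ _).
  have [Z] : exists Z, Z \in [set Z in B :\ X :\ Y | dot l Z == 0].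
    by apply/set0Pn; rewrite -card_gt0; apply: leq_ltn_trans lC.
  rewrite in_set => /andP[ZC lZ]; have ZB := subsetP sC _ ZC.
  have lE : l = kap Z by apply/eqP; rewrite -onkap.
  have lgt : (n < line_card B l)%N by apply: leq_trans lC (subC _ _ sC).
  have notin W : W \in B -> W \notin B :\ X :\ Y -> l != kap W.
    move=> WB WC; rewrite -onkap //; apply/negP => lW.
    have : (line_card (B :\ X :\ Y) l < line_card B l)%N.
      apply: proper_card; apply/properP; split.
        apply/subsetP => T; rewrite in_set => /andP[TC lT].
        by rewrite in_set lT (subsetP sC _ TC).
      exists W; first by rewrite in_set WB.
      by rewrite in_set (negPf WC).
    by rewrite ltnNge (leq_trans (lB l hl lR) lC).
  have lX : l != kap X by apply: notin => //; rewrite !in_setD1 eqxx andbF.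
  have lY : l != kap Y by apply: notin => //; rewrite !in_setD1 eqxx.
  have cY : (line_card B l <= line_card B (kap Y))%N.
    by rewrite lE; apply: Ymax; rewrite /= ZB -lE.
  have cX : (line_card B (kap Y) <= line_card B (kap X))%N by apply: Xmax.
  (* A line through [R] that still has more than n points would differ from those of [X] and [Y],
     which are at least as large by their choice: three disjoint classes of more than n points in a
     set of at most 2 n + 2. *)
  have : (line_card B l + line_card B (kap Y) + line_card B (kap X) <= #|B|)%N.
    rewrite !line_cardE -!big_split -sum1_card; apply: leq_sum => Q QB /=.
    rewrite !onkap ?hkap //; case: (l =P kap Q) => [<-|_].
      by rewrite ![kap _ == l]eq_sym (negPf lX) (negPf lY).
    by case: (kap Y =P kap Q) => [<-|_]; [rewrite eq_sym (negPf YX) | case: eqP].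
  move/leq_trans/(_ cB); move: lgt cY cX; rewrite -addnn.
  move: (line_card B l) (line_card B (kap Y)) (line_card B (kap X)) => x y z.
  by clear; lia.
- apply: contraNneq YX => XYR.
  have E : dot (cross R X) Y = dot (cross X Y) R by rewrite /dot !crossE; ring.
  rewrite eq_sym -onkap ?hkap // /kap; have [a a0 ->] := repP (cross R X).
  by rewrite dotZl E XYR mulr0.
- move=> Q QB; rewrite !in_setD1 QB andbT negb_and !negbK => /orP[]/eqP->.
    by rewrite dotC dot_crossr.
  by rewrite dotC dot_crossl.
Qed.

End Incidence.

Section DegreeQ.

Variable F : finFieldType.
Local Notation q := #|F|.
Local Notation V3 := 'rV[F]_3.
Variable f : {mpoly F[3]}.
Hypotheses (hf : f \is q.-homog) (linef : line_free f) (smf : smooth f).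
Hypothesis many : ((q - 1) * q + 1 < num_points f)%N.

Definition off_curve : {set V3} := [set P in points F | f.@[coords P] != 0].
Local Notation M := off_curve.

Lemma off_curve_sub : M \subset points F.
Proof. by apply/subsetP => P; rewrite in_set => /andP[]. Qed.

Lemma off_curve_compl : (num_points f + #|M| = q ^ 2 + q + 1)%N.
Proof.
rewrite -card_pointsE (num_pointsE hf) -[RHS](cardsID [set P | f.@[coords P] == 0]).
congr (_ + _)%N; apply: eq_card => P; rewrite !in_set //.
by rewrite andbC.
Qed.

(** From q (q^2 + q + 1) = (q + 2)(q^2 - q + 3) - 6 the line bound leaves only N = q^2 - q + 2, and
    this value requires q + 2 >= 6. *)
Lemma degree_q_count : (3 < q)%N /\ #|M| = (2 * q - 1)%N.
Proof.
have q1 := card_field_gt1 F.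
have := num_points_bound (ltnW q1) hf linef smf; have := off_curve_compl; move: many q1.
move: (num_points f) (#|M|) (q) => N m n.
case: n => [|n] //; rewrite subSS subn0 !expnS expn0 muln1 => lt n1 E le.
have [r NE] : exists r, N = (n * n.+1 + 2 + r)%N by exists (N - (n * n.+1 + 2))%N; lia.
rewrite NE in le E; have r0 : r = 0%N by nia.
by rewrite r0 in le E; split; nia.
Qed.

Lemma off_line_card l : l \in points F -> (num_on_line f l + line_card M l = q.+1)%N.
Proof.
move=> hl; rewrite -(card_line_points (points_neq0 hl)).
rewrite -[RHS](cardsID [set P | f.@[coords P] == 0]).
congr (_ + _)%N; apply: eq_card => P; rewrite !in_set /on_curve.
  by rewrite andbA.
by rewrite andbC -!andbA; do !bool_congr.
Qed.

(** A line has q + 1 rational points, and at most d = q of them are on the curve. *)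
Lemma off_line_ge1 l : l \in points F -> (0 < line_card M l)%N.
Proof.
move=> hl; have := off_line_card hl.
have := line_bound (ltnW (card_field_gt1 F)) hf linef smf hl.
by move: (num_on_line f l) (num_tangent f l) (line_card M l); clear; move: (#|F|); lia.
Qed.

Lemma off_curve_cover R (ls : seq V3) : R \in M -> (size ls + 2 <= q)%N ->
    (forall l, l \in ls -> dot l R != 0) ->
    (forall Q, Q \in M -> Q != R -> exists2 l, l \in ls & dot l Q = 0) ->
  False.
Proof.
rewrite in_set => /andP[hR fR] szls lsR cov.
by apply: (cover_complement hf hR fR szls lsR) => Q hQ fQ; apply: cov; rewrite in_set hQ.
Qed.

Lemma cover_singly R (B : {set V3}) : R \in points F -> B \subset points F -> R \notin B ->
  exists ls : seq V3, [/\ (size ls <= #|B|)%N, forall l, l \in ls -> dot l R != 0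
    & forall Q, Q \in B -> exists2 l, l \in ls & dot l Q = 0].
Proof.
move=> hR sB RB; apply: cover_avoiding => // [l hl _|]; last by rewrite -addnn leq_addr.
by apply: subset_leq_card; apply/subsetP => Z; rewrite in_set => /andP[].
Qed.

(** If [l] meets the curve at a rational point P, each of the q other lines through P takes a point
    of the 2 q - 1 in [M]. Otherwise [l] takes q + 1 of them, leaving q - 2; for [R] among these,
    [l] and one line for each of the other q - 3 form a forbidden covering. *)
Lemma off_line_le l : l \in points F -> (line_card M l <= q - 1)%N.
Proof.
move=> hl; have [q3 cM] := degree_q_count.
have [n0|n0] := posnP (num_on_line f l); last first.
  case/card_gt0P: n0 => P; rewrite in_set /on_curve => /and3P[hP lP fP].
  have PM : P \notin M by rewrite in_set (eqP fP) eqxx andbF.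
  have := sum_line_card_through off_curve_sub hP PM.
  rewrite (bigD1 l) //= lP mul1n cM.
  have : (q <= \sum_(i in points F | i != l) (dot i P == 0)%R * line_card M i)%N.
    have := card_lines_through (points_neq0 hP); rewrite (bigD1 l) //= lP add1n => -[<-].
    apply: leq_sum => i /andP[hi _]; case: (dot i P == 0) => //.
    by rewrite mul1n off_line_ge1.
  move: (line_card M l) (\sum_(i in _ | _) _)%N; clear; move: (#|F|); lia.
have cl : line_card M l = q.+1 by have := off_line_card hl; rewrite n0.
have cMl : (#|M :\: [set R | dot l R == 0%R]| = q - 2)%N.
  have := cardsID [set R | dot l R == 0] M; rewrite cM.
  rewrite (_ : M :&: _ = [set R in M | dot l R == 0]); last by apply/setP => Z; rewrite !in_set.
  rewrite -/(line_card M l) cl; move: q3 (#|M :\: _|); clear; move: (#|F|). lia.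
have [R RMl] : exists R, R \in M :\: [set R | dot l R == 0].
  by apply/card_gt0P; rewrite cMl subn_gt0 ltnW.
have := RMl; rewrite in_setD in_set => /andP[lR RM]; have hR := subsetP off_curve_sub _ RM.
have [ls [szls lsR lsQ]] := @cover_singly R (M :\: [set R | dot l R == 0] :\ R) hR
  (subset_trans (subset_trans (subsetDl _ _) (subsetDl _ _)) off_curve_sub) (negbT (setD11 _ _)).
case: (@off_curve_cover R (l :: ls) RM).
- have : (#|M :\: [set R | dot l R == 0%R] :\ R| = q - 3)%N.
    have := cMl; rewrite (cardsD1 R) RMl; move: q3; clear; move: (#|F|); lia.
  by move: szls q3 => /= + + E; rewrite E; clear; move: (#|F|); lia.
- by move=> x; rewrite inE => /predU1P[->|/lsR].
- move=> Q QM QR; have [lQ|lQ] := eqVneq (dot l Q) 0; first by exists l; rewrite ?mem_head.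
  have [|x xls xQ] := lsQ Q; first by rewrite in_setD1 QR in_setD QM in_set lQ.
  by exists x; rewrite // inE xls orbT.
Qed.

(** With m the number of points of [M] on a line, this says that (m - 1)(m - 3), summed over all
    lines, is (q - 2)(q - 4); it is arranged without subtraction on the left. *)
Lemma off_line_moment :
  (\sum_(l in points F) (line_card M l ^ 2 + 3) =
   \sum_(l in points F) 4 * line_card M l + (q - 2) * (q - 4))%N.
Proof.
have [q3 cM] := degree_q_count.
rewrite big_split /= -big_distrr sum_nat_const /= card_pointsE.
rewrite (sum_line_card off_curve_sub) (sum_line_card_sqr off_curve_sub) cM.
have [n ->] : exists n, q = (n + 4)%N by exists (q - 4)%N; lia.
rewrite !expnS expn0; nia.
Qed.

(** If q > 4, the moment identity yields a line [l] with at least 4 points of [M]. Its complement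
    [A] in [M] then has at most 2 q - 5 points, too few for the two rich lines that the covering
    argument produces. *)
Lemma degree_q_small : q = 4%N.
Proof.
have [q3 cM] := degree_q_count; apply/eqP; rewrite eqn_leq q3 andbT leqNgt; apply/negP => q4.
have [l /andP[hl l4]|small] := pickP [pred l | (l \in points F) && (3 < line_card M l)%N]; last first.
  have : (\sum_(l in points F) (line_card M l ^ 2 + 3) <= \sum_(l in points F) 4 * line_card M l)%N.
    apply: leq_sum => l hl; have := small l; rewrite /= hl /= => /negbT; rewrite -leqNgt.
    by have := off_line_ge1 hl; case: (line_card M l) => [|[|[|[|]]]].
  rewrite off_line_moment -{2}[(\sum_(l in _) _)%N]addn0 leq_add2l leqn0 muln_eq0.
  by move: q4; clear; move: (#|F|); lia.
have lle := off_line_le hl.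
pose A := M :\: [set R | dot l R == 0].
have cA : (#|A| + line_card M l = 2 * q - 1)%N.
  rewrite -cM -(cardsID [set R | dot l R == 0] M) addnC; congr (_ + _)%N.
  by apply: eq_card => Z; rewrite !in_set.
have AM : A \subset M by exact: subsetDl.
(* Otherwise q - 3 lines avoiding [R] cover the rest of [A], and together with [l] they are q - 2
   lines covering all of [M] except [R]. *)
have big R : R \in A -> exists x, [/\ x \in points F, dot x R = 0 & (q - 1 <= line_card A x)%N].
  move=> RA; apply: NNPP => none; have RM := subsetP AM _ RA.
  have hR := subsetP off_curve_sub _ RM.
  have [||ls [szls lsR lsQ]] := @cover_avoiding F R (A :\ R) (q - 3) hR
      (subset_trans (subset_trans (subsetDl _ _) AM) off_curve_sub) (negbT (setD11 _ _)).
  - move=> x hx xR; rewrite leqNgt; apply/negP => xbig; apply: none; exists x; split=> //.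
    rewrite /line_card (cardsD1 R) in_set RA xR eqxx.
    have : (line_card (A :\ R) x <= #|[set R in A | dot x R == 0%R] :\ R|)%N.
      by apply: subset_leq_card; apply/subsetP => Z; rewrite !in_set -!andbA.
    by move: xbig q4; clear; move: (#|F|); lia.
  - have := cA; rewrite (cardsD1 R) RA -addnn; move: l4 q4; clear; move: (#|F|); lia.
  apply: (@off_curve_cover R (l :: ls) RM).
  - by move: szls q4 => /=; clear; move: (#|F|); lia.
  - move=> x; rewrite inE => /predU1P[->|/lsR//].
    by move: RA; rewrite in_setD in_set => /andP[].
  - move=> Q QM QR; have [lQ|lQ] := eqVneq (dot l Q) 0; first by exists l; rewrite ?mem_head.
    have [|x xls xQ] := lsQ Q; first by rewrite in_setD1 QR in_setD QM in_set lQ.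
    by exists x; rewrite // inE xls orbT.
have [R RA] : exists R, R \in A.
  by apply/card_gt0P; move: cA lle q4; clear; move: (#|F|); lia.
have [x [hx xR cx]] := big R RA.
(* [A] has at least q points while [x] carries at most q - 1 points of [M], so some [R'] in [A] lies
   off [x]. The rich lines of [R] and [R'] share at most one point and force 2 (q - 1) - 1 points
   into [A]. *)
have [sub|/subsetPn[R' R'A]] := boolP (A \subset [set R | dot x R == 0]).
  have : (#|A| <= q - 1)%N.
    apply: leq_trans (off_line_le hx); apply: subset_leq_card; apply/subsetP => Z ZA.
    by have := subsetP sub Z ZA; rewrite in_set => xZ; rewrite in_set (subsetP AM _ ZA).
  by move: cA lle q4; clear; move: (#|F|); lia.
rewrite in_set => xR'; have [y [hy yR' cy]] := big R' R'A.
have xy : x != y by apply: contraNneq xR' => ->; rewrite yR'.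
have := common_points_le1 (subset_trans AM off_curve_sub) hx hy xy.
have := cardsUI [set R in A | dot x R == 0] [set R in A | dot y R == 0].
have : (#|[set R in A | dot x R == 0%R] :|: [set R in A | dot y R == 0%R]| <= #|A|)%N.
  by apply: subset_leq_card; apply/subsetP => Z; rewrite in_setU !in_set => /orP[]/andP[].
rewrite (_ : [set R in A | dot x R == 0] :&: _ =
  [set R in A | (dot x R == 0) && (dot y R == 0)]); last first.
  by rewrite !setIdE -setIIr; congr (_ :&: _); apply/setP => Z; rewrite !inE.
by move: cx cy cA l4 q4; rewrite /line_card; clear; move: (#|F|); lia.
Qed.

(** For q = 4 the products (m - 1)(m - 3) sum to 0, and none is positive since 1 <= m <= 3; so all
    vanish. *)
Lemma degree_q_lines l : l \in points F -> line_card M l = 1%N \/ line_card M l = 3%N.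
Proof.
move=> hl; have := off_line_moment; rewrite degree_q_small subnn muln0 addn0 => E.
have le i : i \in points F -> (line_card M i ^ 2 + 3 <= 4 * line_card M i)%N.
  move=> hi; have := off_line_le hi; have := off_line_ge1 hi; rewrite degree_q_small.
  by case: (line_card M i) => [|[|[|[|]]]].
have : (line_card M l ^ 2 + 3 = 4 * line_card M l)%N.
  apply/eqP; rewrite eqn_leq le //= -(leq_add2r (\sum_(i in points F | i != l) (line_card M i ^ 2 + 3))).
  rewrite -(bigD1 l) // E (bigD1 l hl) /= leq_add2l; apply: leq_sum => i /andP[hi _]; exact: le.
have := off_line_le hl; rewrite degree_q_small.
by case: (line_card M l) => [|[|[|[|]]]] //; [left | right].
Qed.

End DegreeQ.

(** * The exceptional quartic recovered from the seven rational points off the curve *)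

Section FormsOfDegreeQ.

Variable F : finFieldType.
Local Notation q := #|F|.
Local Notation V3 := 'rV[F]_3.

Lemma power_sum_top : \sum_(x : F) x ^+ q.-1 = -1.
Proof.
have q1 := card_field_gt1 F.
rewrite (bigD1 0) //= expr0n -subn1 subn_eq0 leqNgt q1 add0r.
rewrite (eq_bigr (fun=> 1)) => [|x x0]; last first.
  by apply: (mulfI x0); rewrite -exprS subn1 prednK ?expf_card ?mulr1 // ltnW.
rewrite sumr_const card_nonzero; apply/eqP; rewrite -addr_eq0 natr1 prednK ?natr_card //.
exact: ltnW.
Qed.

(** The degree matters: X^q Y - X Y^q, of degree q + 1, vanishes at every rational point.
    Coefficients of pure q-th powers are values at coordinate vectors; all other exponents are at
    most q - 1 and are isolated by power sums. *)
Lemma form_eq0 (D : {mpoly F[3]}) :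
  D \is q.-homog -> (forall v : V3, D.@[coords v] = 0) -> D = 0.
Proof.
move=> hD Dz; have q1 := card_field_gt1 F; apply/mpolyP => m; rewrite mcoeff0.
have [md|/(dhomog_nemf_coeff hD)//] := eqVneq (mdeg m) q.
have [i|small] := pickP [pred i | (q <= m i)%N].
  rewrite /= => mi; have := Dz (delta_mx 0 i); rewrite mevalE.
  have mE m' j : m' \in msupp D -> (q <= m' j)%N -> m' = (U_(j) *+ q)%MM.
    move=> mf mj; have md' : mdeg m' = q by have /dhomogP/(_ _ mf) := hD.
    have := md'; rewrite mdegE (bigD1 j) //= => sumE.
    have mjE : m' j = q by move: mj sumE; move: (m' j) (\sum_(_ | _) _)%N (#|F|); clear; lia.
    have /eqP := sumE; rewrite mjE -{2}[(#|F|)]addn0 eqn_add2l sum_nat_eq0 => /forallP m0.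
    apply/mnmP => k; rewrite mulmnE mnm1E; have [<-|jk] := eqVneq j k; first by rewrite mul1n.
    by have := m0 k; rewrite eq_sym jk /= => /eqP.
  have [mD|/memN_msupp_eq0->//] := boolP (m \in msupp D).
  rewrite (bigD1_seq m) //= [X in _ + X]big_seq_cond [X in _ + X]big1 ?addr0 => [|m' /andP[m'D m'm]].
    rewrite big1 ?mulr1 // => j _; rewrite /coords mxE eqxx /=; have [->|ji] := eqVneq j i.
      by rewrite expr1n.
    by rewrite (mE m i mD mi) mulmnE mnm1E eq_sym (negPf ji) mul0n expr0.
  have [j jP] : exists j, (j != i) && (m' j != 0%N).
    apply/existsP; apply: contraR m'm; rewrite negb_exists => /forallP none.
    have md' : mdeg m' = q by have /dhomogP/(_ _ m'D) := hD.
    rewrite (mE m i mD mi) [X in X == _](mE m' i m'D) // -md' mdegE (bigD1 i) //= big1 ?addn0 // => j ji.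
    by have := none j; rewrite ji /= negbK => /eqP.
  case/andP: jP => ji m'j; rewrite (bigD1 j) //= /coords mxE (negPf ji) andbF expr0n (negPf m'j).
  by rewrite mul0r mulr0.
have {}small i : (m i <= q.-1)%N.
  by have := small i; rewrite /= => /negbT; rewrite -ltnNge; case: (#|F|) q1.
have [mD|/memN_msupp_eq0->//] := boolP (m \in msupp D).
(* The complementary monomial raises the monomial [m] to exponents q - 1 in all variables. Any other
   monomial of the same degree is smaller than [m] in some exponent, and the corresponding power sum
   vanishes. *)
have : \sum_(v : V3) D.@[coords v] * \prod_i v 0 i ^+ (q.-1 - m i) = 0.
  by rewrite big1 // => v _; rewrite Dz mul0r.
under eq_bigr do rewrite mevalE mulr_suml.
rewrite exchange_big /= (bigD1_seq m) //= [X in _ + X]big_seq_cond [X in _ + X]big1 ?addr0 => [|m' /andP[m'D m'm]].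
  rewrite (eq_bigr (fun v : V3 => D@_m * \prod_i v 0 i ^+ q.-1)) => [|v _]; last first.
    rewrite -mulrA -big_split; congr (_ * _); apply: eq_bigr => i _.
    by rewrite /coords /= -exprD subnKC.
  rewrite -mulr_sumr (@monomial_sum F (fun=> q.-1)).
  rewrite (eq_bigr (fun=> -1)) => [|i _]; last exact: power_sum_top.
  move=> /eqP; rewrite mulf_eq0 => /orP[/eqP//|].
  by rewrite prodf_seq_eq0 => /hasP[i _] /=; rewrite oppr_eq0 oner_eq0.
rewrite (eq_bigr (fun v : V3 => D@_m' * \prod_i v 0 i ^+ (m' i + (q.-1 - m i)))) => [|v _]; last first.
  rewrite -mulrA -big_split; congr (_ * _); apply: eq_bigr => i _.
  by rewrite /coords /= -exprD.
have [i mi] : exists i, (m' i < m i)%N.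
  apply/existsP; apply: contraR m'm; rewrite negb_exists => /forallP ge.
  have md' : mdeg m' = q by have /dhomogP/(_ _ m'D) := hD.
  have le j : (m j <= m' j)%N by rewrite leqNgt; apply: ge.
  have [_] := leqif_sum (fun j (_ : true) => leqif_eq (le j)).
  rewrite -!mdegE md md' eqxx => /esym/forallP mm'.
  by apply/eqP/mnmP => j; apply/esym/eqP; apply: mm'.
rewrite -mulr_sumr (@monomial_sum F (fun i => (m' i + (q.-1 - m i))%N)) (bigD1 i) //=.
rewrite power_sum ?mul0r ?mulr0 //; move: (small i) mi; clear; move: (#|F|.-1); lia.
Qed.

End FormsOfDegreeQ.

Section Determinants.

Variable K : fieldType.
Implicit Types u v w x : 'rV[K]_3.

Definition det3 u v w : K := dot (cross u v) w.

Lemma det3_rot u v w : det3 v w u = det3 u v w.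
Proof. rewrite /det3 /dot !crossE; ring. Qed.

Lemma det3_comb u v w a b c :
  det3 u v (a *: u + b *: v + c *: w) = c * det3 u v w.
Proof. rewrite /det3 /dot !crossE !mxE; ring. Qed.

Lemma det3_cross u v w : det3 u v w != 0 -> cross u v != 0.
Proof. by apply: contraNneq => uv; rewrite /det3 uv /dot !mxE !mul0r !addr0. Qed.

Lemma det3_span u v w x : det3 u v w != 0 ->
  exists a b c, x = a *: u + b *: v + c *: w.
Proof.
move=> D0; exists (det3 x v w / det3 u v w), (det3 u x w / det3 u v w), (det3 u v x / det3 u v w).
apply: (scalerI D0); rewrite !scalerDr !scalerA ![det3 u v w * _]mulrC !divfK //.
by apply: row3P; rewrite !mxE /det3 /dot !crossE; ring.
Qed.

Lemma det3_inj u v w a b c a' b' c' : det3 u v w != 0 ->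
    a *: u + b *: v + c *: w = a' *: u + b' *: v + c' *: w ->
  [/\ a = a', b = b' & c = c'].
Proof.
have det3E : [/\ dot (cross v w) (a *: u + b *: v + c *: w) = a * det3 u v w,
    dot (cross w u) (a *: u + b *: v + c *: w) = b * det3 u v w &
    dot (cross u v) (a *: u + b *: v + c *: w) = c * det3 u v w].
  by split; rewrite /det3 /dot !crossE !mxE; ring.
have [Ea Eb Ec] := det3E; move=> D0 E; split; apply: (mulIf D0).
- by rewrite -Ea E /det3 /dot !crossE !mxE; ring.
- by rewrite -Eb E /det3 /dot !crossE !mxE; ring.
- by rewrite -Ec E /det3 /dot !crossE !mxE; ring.
Qed.

End Determinants.

Section ExceptionalQuartic.

Variable F : finFieldType.
Local Notation q := #|F|.
Local Notation V3 := 'rV[F]_3.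
Implicit Types u v w : V3.

Lemma rep_inj u v : rep u = rep v -> exists2 a, a != 0 & v = a *: u.
Proof.
have [a a0 ->] := repP u; have [b b0 ->] := repP v => /(congr1 ( *:%R b^-1)).
rewrite !scalerA mulVf // scale1r => <-; exists (b^-1 * a) => //.
by rewrite mulf_neq0 ?invr_eq0.
Qed.

Lemma rep_scale P v a : P \in points F -> P = a *: v -> rep v = P.
Proof.
move=> hP E; have a0 : a != 0 by apply: contraTneq (points_neq0 hP) => a0; rewrite E a0 scale0r eqxx.
by rewrite -(repZ v a0) -E points_rep.
Qed.

Lemma card_three_sets (T : finType) (A B C : {set T}) :
  #|A| = 3%N -> #|B| = 3%N -> #|C| = 3%N ->
  #|A :&: B| = 1%N -> #|A :&: C| = 1%N -> #|B :&: C| = 1%N -> A :&: B :&: C = set0 ->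
  #|A :|: B :|: C| = 6%N.
Proof.
move=> A3 B3 C3 AB AC BC ABC; have := cardsUI (A :|: B) C; have := cardsUI A B.
have := cardsUI (A :&: C) (B :&: C); rewrite setIUl setIACA setIid ABC cards0; lia.
Qed.

(** The values do not depend on the representative of a point and add up to 0 over all points, to
    which only [u] and [v] contribute. *)
Lemma two_point_sum (H : {mpoly F[3]}) u v :
    H \is (2 * q.-1).-homog -> cross u v != 0 ->
    (forall w, H.@[coords w] != 0 -> (exists a, w = a *: u) \/ (exists a, w = a *: v)) ->
  H.@[coords u] + H.@[coords v] = 0.
Proof.
move=> hH uv only.
have u0 : u != 0.
  apply: contraNneq uv => ->; apply/eqP/row3P; rewrite !crossE !mxE; ring.
have v0 : v != 0.
  apply: contraNneq uv => ->; apply/eqP/row3P; rewrite !crossE !mxE; ring.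
have uv' : rep u != rep v.
  by apply: contraNneq uv => /rep_inj[a _ ->]; rewrite crossZr crossvv scaler0.
have Hrep w : H.@[coords (rep w)] = H.@[coords w].
  have [a a0 ->] := repP w; rewrite (meval_scale _ _ hH) mulnC exprM.
  have q1 := card_field_gt1 F.
  have -> : a ^+ q.-1 = 1 by apply: (mulfI a0); rewrite -exprS mulr1 prednK ?expf_card // ltnW.
  by rewrite expr1n mul1r.
have := points_sum_eq0 hH; rewrite (bigD1 (rep u)) ?rep_points //= (bigD1 (rep v)) /=; last first.
  by rewrite rep_points // eq_sym.
rewrite big1 ?addr0 ?Hrep // => P /andP[/andP[hP Pu] Pv]; apply/eqP/contraT => /only[] [a E].
  by rewrite (rep_scale hP E) eqxx in Pu.
by rewrite (rep_scale hP E) eqxx in Pv.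
Qed.


Variable f : {mpoly F[3]}.
Hypotheses (hf : f \is q.-homog) (linef : line_free f) (smf : smooth f).
Hypothesis many : ((q - 1) * q + 1 < num_points f)%N.
Local Notation M := (off_curve f).
Local Notation f_ v := (f.@[coords v]).

Lemma off_rep v : f_ v != 0 -> rep v \in M.
Proof.
move=> fv; have [a a0 E] := repP v; rewrite in_set rep_points.
  by rewrite E (meval_scale _ _ hf) mulf_neq0 ?expf_neq0.
apply: contraNneq fv => ->; rewrite -(scale0r 0) (meval_scale _ _ hf) mulf_eq0 expf_eq0 eqxx andbT.
by rewrite ltnW ?card_field_gt1.
Qed.

Lemma off_scale a v : a != 0 -> (f_ (a *: v) != 0) = (f_ v != 0).
Proof. by move=> a0; rewrite (meval_scale _ _ hf) mulf_eq0 expf_eq0 (negPf a0) andbF. Qed.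

Lemma off_line_three u v : f_ u != 0 -> f_ v != 0 -> cross u v != 0 ->
  #|[set R in M | dot (cross u v) R == 0]| = 3%N.
Proof.
move=> fu fv uv; have [a a0 aE] := repP (cross u v).
have -> : #|[set R in M | dot (cross u v) R == 0]| = line_card M (rep (cross u v)).
  by apply: eq_card => R; rewrite !inE aE dotZl mulf_eq0 (negPf a0).
have [|//] := degree_q_lines hf linef smf many (rep_points uv).
rewrite /line_card => /eqP/cards1P[T TE].
have mem w : f_ w != 0 -> dot (cross u v) w = 0 -> rep w = T.
  move=> fw lw; apply/set1P; rewrite -TE in_set off_rep //=.
  by have [b b0 ->] := repP w; rewrite aE dotZl dotZr lw !mulr0.
have := mem u fu; rewrite dotC dot_crossl => /(_ erefl); rewrite -(mem v fv) => [/rep_inj[b _ vE]|].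
  by rewrite vE crossZr crossvv scaler0 eqxx in uv.
by rewrite dotC dot_crossr.
Qed.

Lemma off_line_mem u v a b : f_ (a *: u + b *: v) != 0 ->
  rep (a *: u + b *: v) \in [set R in M | dot (cross u v) R == 0].
Proof.
move=> fab; rewrite in_set off_rep //=; have [c _ ->] := repP (a *: u + b *: v).
by rewrite dotZr dotDr !dotZr ![dot (cross u v) _]dotC dot_crossl dot_crossr !mulr0 addr0 mulr0.
Qed.

Lemma rep_neq u v : cross u v != 0 -> rep u != rep v.
Proof. by apply: contraNneq => /rep_inj[a _ ->]; rewrite crossZr crossvv scaler0. Qed.

Lemma off_third_exists u v : f_ u != 0 -> f_ v != 0 -> cross u v != 0 ->
  exists a b, [/\ a != 0, b != 0 & f_ (a *: u + b *: v) != 0].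
Proof.
move=> fu fv uv; have S3 := off_line_three fu fv uv.
have uS : rep u \in [set R in M | dot (cross u v) R == 0].
  by have := @off_line_mem u v 1 0; rewrite scale1r scale0r addr0; apply.
have vS : rep v \in [set R in M | dot (cross u v) R == 0].
  by have := @off_line_mem u v 0 1; rewrite scale1r scale0r add0r; apply.
have : exists T, T \in [set R in M | dot (cross u v) R == 0] :\ rep u :\ rep v.
  apply/card_gt0P; move: S3; rewrite (cardsD1 (rep u)) uS (cardsD1 (rep v)).
  by rewrite in_setD1 vS eq_sym rep_neq // !add1n => -[->].
case=> T; rewrite in_setD1 => /andP[Tv]; rewrite in_setD1 => /andP[Tu].
rewrite in_set => /andP[]; rewrite in_set => /andP[hT fT] /eqP/(line_span uv)[a [b TE]].
exists a, b; rewrite -TE; split=> //; apply/eqP => z0.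
- by move: Tv; rewrite (@rep_scale T v b) ?eqxx // TE z0 scale0r add0r.
- by move: Tu; rewrite (@rep_scale T u a) ?eqxx // TE z0 scale0r addr0.
Qed.

(** Unless the two combinations are proportional, the line through [u] and [v] would have four
    points off the curve. *)
Lemma off_third_unique u v a b c d : f_ u != 0 -> f_ v != 0 -> cross u v != 0 ->
    a != 0 -> b != 0 -> c != 0 -> d != 0 ->
    f_ (a *: u + b *: v) != 0 -> f_ (c *: u + d *: v) != 0 ->
  a * d = b * c.
Proof.
move=> fu fv uv a0 b0 c0 d0 fab fcd; have S3 := off_line_three fu fv uv.
have crossab x y x' y' :
    cross (x *: u + y *: v) (x' *: u + y' *: v) = (x * y' - y * x') *: cross u v.
  by apply: row3P; rewrite [RHS]mxE !crossE !mxE; ring.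
apply/eqP; rewrite -subr_eq0; apply: contraT => abcd.
have : (size [:: rep u; rep v; rep (a *: u + b *: v); rep (c *: u + d *: v)]
    <= #|[set R in M | dot (cross u v) R == 0%R]|)%N.
  rewrite cardE; apply: uniq_leq_size => [|x].
    have nz x y x' y' : x * y' - y * x' != 0 -> rep (x *: u + y *: v) != rep (x' *: u + y' *: v).
      by move=> ne; rewrite rep_neq // crossab scaler_eq0 negb_or ne.
    have -> : rep u = rep (1 *: u + 0 *: v) by rewrite scale1r scale0r addr0.
    have -> : rep v = rep (0 *: u + 1 *: v) by rewrite scale1r scale0r add0r.
    by rewrite /= !inE !negb_or !nz ?(mul0r, mul1r, mulr0, mulr1, subr0, sub0r, oppr_eq0, oner_eq0).
  rewrite mem_enum in_cons => /predU1P[->|].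
    by have := @off_line_mem u v 1 0; rewrite scale1r scale0r addr0; apply.
  rewrite in_cons => /predU1P[->|].
    by have := @off_line_mem u v 0 1; rewrite scale1r scale0r add0r; apply.
  rewrite in_cons => /predU1P[->|]; first exact: off_line_mem.
  by rewrite mem_seq1 => /eqP->; apply: off_line_mem.
by rewrite S3.
Qed.

Lemma line_meet u v w Z : det3 u v w != 0 ->
  dot (cross u v) Z = 0 -> dot (cross u w) Z = 0 -> exists a, Z = a *: u.
Proof.
move=> D0 uvZ uwZ; have [a [b [c ZE]]] := det3_span Z D0.
have c0 : c = 0.
  by move/eqP: uvZ; rewrite ZE [dot _ _]det3_comb mulf_eq0 (negPf D0) orbF => /eqP.
have b0 : b = 0.
  move/eqP: uwZ; rewrite ZE (_ : dot _ _ = - (b * det3 u v w)).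
    by rewrite oppr_eq0 mulf_eq0 (negPf D0) orbF => /eqP.
  by rewrite /det3 /dot !crossE !mxE; ring.
by exists a; rewrite ZE c0 b0 !scale0r !addr0.
Qed.

(** Three lines of three points each, meeting pairwise in the vertices: 9 - 3 points. *)
Lemma coordinate_lines_card u v w : det3 u v w != 0 ->
    f_ u != 0 -> f_ v != 0 -> f_ w != 0 ->
  #|[set R in M | dot (cross u v) R == 0] :|: [set R in M | dot (cross u w) R == 0]
    :|: [set R in M | dot (cross v w) R == 0]| = 6%N.
Proof.
have meet x y z : det3 x y z != 0 -> f_ x != 0 ->
    [set R in M | dot (cross x y) R == 0] :&: [set R in M | dot (cross x z) R == 0] = [set rep x].
  move=> D0 fx; apply/setP => Z; rewrite in_setI in_set [Z \in [set R in M | _]]in_set in_set1.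
  apply/andP/eqP => [[/andP[ZM /eqP xyZ] /andP[_ /eqP xzZ]]|->].
    have hZ := subsetP (off_curve_sub f) _ ZM.
    by have [a /(rep_scale hZ)->] := line_meet D0 xyZ xzZ.
  have [a _ aE] := repP x; rewrite off_rep // aE !dotZr.
  by rewrite ![dot _ x]dotC !dot_crossl !mulr0 eqxx.
have flip x y : [set R in M | dot (cross x y) R == 0] = [set R in M | dot (cross y x) R == 0].
  by apply/setP => Z; rewrite in_set [in RHS]in_set crossC -scaleN1r dotZl mulN1r oppr_eq0.
move=> D0 fu fv fw.
have D1 : det3 v w u != 0 by rewrite det3_rot.
have D2 : det3 w u v != 0 by rewrite 2!det3_rot.
apply: card_three_sets.
- exact: off_line_three fu fv (det3_cross D0).
- by rewrite flip; apply: off_line_three fw fu (det3_cross D2).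
- exact: off_line_three fv fw (det3_cross D1).
- by rewrite meet // cards1.
- by rewrite flip setIC meet // cards1.
- by rewrite flip [X in _ :&: X]flip meet // cards1.
rewrite meet //; apply/setP => Z; rewrite in_setI in_set1 in_set0 in_set.
apply/andP => -[/eqP-> /andP[_ /eqP]].
have [a a0 ->] := repP u; rewrite dotZr => /eqP.
by rewrite mulf_eq0 (negPf a0) [dot _ _ == _](negPf D1).
Qed.

(* A frame plays the role of the four points (1:0:0), (0:1:0), (0:0:1), (1:1:1)
   of the Fano plane formed by the rational points off the curve. *)
Definition frame u v w := [/\ det3 u v w != 0, f_ u != 0, f_ v != 0, f_ w != 0 &
  f_ (u + v + w) != 0 /\ forall a b c, a != 0 -> b != 0 -> c != 0 ->
    f_ (a *: u + b *: v + c *: w) != 0 -> a = b /\ b = c].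

(** The sides of a triangle contain six of the seven points of [M]. Rescaling the vertices makes the
    seventh the unit point, and uniqueness of the seventh gives the second half of the
    definition. *)
Lemma frame_exists : exists u v w, frame u v w.
Proof.
have M7 : #|M| = 7%N.
  by have [_ ->] := degree_q_count hf linef smf many; rewrite (degree_q_small hf linef smf many).
have offM R : R \in M -> R \in points F /\ f_ R != 0 by rewrite in_set => /andP.
have [u uM] : exists u, u \in M by apply/card_gt0P; rewrite M7.
have [hu fu] := offM _ uM.
have [v] : exists v, v \in M :\ u by apply/card_gt0P; move: M7; rewrite (cardsD1 u) uM add1n => -[->].
rewrite in_setD1 => /andP[vu vM]; have [hv fv] := offM _ vM.
have uv : cross u v != 0 by apply: cross_points_neq0; rewrite // eq_sym.
have [w] : exists w, w \in M :\: [set R in M | dot (cross u v) R == 0].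
  apply/card_gt0P; have := cardsID [set R in M | dot (cross u v) R == 0] M.
  rewrite M7 (_ : M :&: _ = [set R in M | dot (cross u v) R == 0]).
    by rewrite off_line_three //; case: (#|_|).
  by apply/setIidPr/subsetP => R; rewrite in_set => /andP[].
rewrite in_setD in_set => /andP[+ wM]; rewrite wM /= => D0; have [hw fw] := offM _ wM.
set U := [set R in M | dot (cross u v) R == 0] :|: [set R in M | dot (cross u w) R == 0]
    :|: [set R in M | dot (cross v w) R == 0].
have UM : U \subset M.
  by apply/subsetP => R; rewrite !in_setU => /orP[/orP[]|]; rewrite in_set => /andP[].
have /eqP/cards1P[s sE] : #|M :\: U| = 1%N.
  have := cardsID U M; rewrite M7 (setIidPr UM) coordinate_lines_card // => /eqP.
  by rewrite -[7%N]/(6 + 1)%N eqn_add2l => /eqP.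
have [sM sU] : s \in M /\ s \notin U.
  by have := set11 s; rewrite -sE in_setD => /andP[].
have [hs fs] := offM _ sM.
have [a [b [c E]]] := det3_span s D0.
have inU R : R \in M -> (R \in U) = [|| dot (cross u v) R == 0, dot (cross u w) R == 0 | dot (cross v w) R == 0].
  move=> RM; have in3 l : (R \in [set R in M | dot l R == 0]) = (dot l R == 0) by rewrite in_set RM.
  by rewrite !in_setU !in3 orbA.
have notU x y z : f_ (x *: u + y *: v + z *: w) != 0 ->
    (rep (x *: u + y *: v + z *: w) \notin U) = [&& x != 0, y != 0 & z != 0].
  move=> fR; rewrite inU ?off_rep //; have [k k0 ->] := repP (x *: u + y *: v + z *: w).
  rewrite !dotZr !mulf_eq0 (negPf k0) /= [dot (cross u v) _](det3_comb u v w x y z).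
  rewrite (_ : dot (cross u w) _ = - (y * det3 u v w)); last by rewrite /det3 /dot !crossE !mxE; ring.
  rewrite (_ : dot (cross v w) _ = x * det3 u v w); last by rewrite /det3 /dot !crossE !mxE; ring.
  rewrite oppr_eq0 !mulf_eq0 (negPf D0) !orbF !negb_or; do !case: (_ != 0) => //=.
have := notU a b c; rewrite -E points_rep // => /(_ fs); rewrite sU => /esym/and3P[a0 b0 c0].
exists (a *: u), (b *: v), (c *: w); split; rewrite ?off_scale //.
  rewrite (_ : det3 _ _ _ = a * b * c * det3 u v w) ?mulf_neq0 //.
  by rewrite /det3 /dot !crossE !mxE; ring.
split=> [|x y z x0 y0 z0]; first by rewrite -E.
rewrite !scalerA => fR; have := notU _ _ _ fR; rewrite !mulf_neq0 //= => nU.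
have /set1P : rep ((x * a) *: u + (y * b) *: v + (z * c) *: w) \in [set s].
  by rewrite -sE in_setD nU off_rep.
rewrite -(points_rep hs) => /esym/rep_inj[k k0 sk].
move: sk; rewrite [in RHS]E !scalerDr !scalerA => /(det3_inj D0)[xk yk zk].
by rewrite (mulIf a0 xk) (mulIf b0 yk) (mulIf c0 zk).
Qed.

Lemma frame_rot u v w : frame u v w -> frame v w u.
Proof.
have rot a b c : a *: v + b *: w + c *: u = c *: u + a *: v + b *: w.
  by rewrite [LHS]addrC addrA.
case=> D0 fu fv fw [fs only]; split; [by rewrite det3_rot | exact: fv | exact: fw | exact: fu |].
have := rot 1 1 1; rewrite !scale1r => ->; split=> [|a b c a0 b0 c0]; first exact: fs.
by rewrite rot => /(only _ _ _ c0 a0 b0)[-> ->].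
Qed.

(** The line through w and the unit point contains a third point of [M]. If its w-coordinate were
    nonzero it would be the unit point again, so it is u + v. *)
Lemma frame_pair u v w : frame u v w -> f_ (u + v) != 0.
Proof.
case=> D0 fu fv fw [fs only].
have ws : cross w (u + v + w) != 0.
  apply: (@det3_cross _ _ _ u); rewrite (_ : det3 _ _ _ = - det3 u v w) ?oppr_eq0 //.
  by rewrite /det3 /dot !crossE !mxE; ring.
have [a [b [a0 b0]]] := off_third_exists fw fs ws.
have -> : a *: w + b *: (u + v + w) = b *: u + b *: v + (a + b) *: w.
  by rewrite !scalerDr scalerDl addrC -!addrA [b *: w + _]addrC.
have [->|ab fT] := eqVneq (a + b) 0; first by rewrite scale0r addr0 -scalerDr off_scale.
have [_ /eqP] := only b b (a + b) b0 b0 ab fT.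
by rewrite eq_sym -[X in _ == X]add0r (inj_eq (addIr b)) (negPf a0).
Qed.

Lemma frame_pair_only u v w a b : frame u v w -> a != 0 -> b != 0 ->
  f_ (a *: u + b *: v) != 0 -> a = b.
Proof.
move=> fr a0 b0 fab; have fuv := frame_pair fr; have [D0 fu fv _ _] := fr.
have := @off_third_unique u v 1 1 a b fu fv (det3_cross D0) (oner_neq0 _) (oner_neq0 _) a0 b0.
by rewrite !scale1r !mul1r => ->.
Qed.

(** Any two nonzero coordinates of a point off the curve are equal. The products encode this without
    distinguishing which coordinates are zero. *)
Lemma frame_only u v w a b c : frame u v w -> f_ (a *: u + b *: v + c *: w) != 0 ->
  [/\ a * b * (a - b) = 0, b * c * (b - c) = 0 & c * a * (c - a) = 0].
Proof.
move=> fr fT.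
have zero x y : (x != 0 -> y != 0 -> x = y) -> x * y * (x - y) = 0.
  have [->|x0] := eqVneq x 0; first by rewrite !mul0r.
  have [->|y0] := eqVneq y 0; first by rewrite mulr0 mul0r.
  by move=> ->; rewrite ?subrr ?mulr0.
have [a0|a0] := eqVneq a 0.
  rewrite a0 !(mul0r, mulr0); split=> //; apply: zero => b0 c0.
  by apply: (frame_pair_only (frame_rot fr)) => //; move: fT; rewrite a0 scale0r add0r.
have [b0|b0] := eqVneq b 0.
  rewrite b0 !(mul0r, mulr0); split=> //; apply: zero => c0 _.
  apply: (frame_pair_only (frame_rot (frame_rot fr))) => //.
  by move: fT; rewrite b0 scale0r addr0 addrC.
have [c0|c0] := eqVneq c 0.
  rewrite c0 !(mul0r, mulr0); split=> //; apply: zero => _ _.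
  by apply: (frame_pair_only fr) => //; move: fT; rewrite c0 scale0r addr0.
have [_ _ _ _ [_ only]] := fr; have [ab bc] := only a b c a0 b0 c0 fT.
by rewrite -bc -ab subrr !mulr0.
Qed.
End ExceptionalQuartic.

Lemma linear_subst_homog (F : finFieldType) (A : 'M[F]_3) d (f : {mpoly F[3]}) :
  f \is d.-homog -> linear_subst A f \is d.-homog.
Proof.
pose P d (p : {mpoly F[3]}) := linear_subst A p \is d.-homog.
move: d f; apply: (@homog_ind _ _ P) => [d|d p r|d c p||d p i]; rewrite /P /linear_subst.
- by rewrite comp_mpoly0 rpred0.
- by rewrite comp_mpolyD => hp hr; apply: rpredD.
- by rewrite comp_mpolyZ => hp; apply: rpredZ.
- by rewrite comp_mpoly1 dhomog1.
- rewrite rmorphM /= comp_mpolyXU -tnth_nth tnth_mktuple -[d.+1]addn1 => hp; apply: dhomogM => //.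
  by apply: rpred_sum => j _; apply: rpredZ; rewrite dhomogX /= mdeg1.
Qed.

Lemma linear_subst_meval (F : finFieldType) (A : 'M[F]_3) (f : {mpoly F[3]}) (x : 'rV[F]_3) :
  (linear_subst A f).@[coords x] = f.@[coords (x *m A^T)].
Proof.
rewrite /linear_subst comp_mpoly_meval; apply: meval_eq => i.
rewrite tnth_mktuple raddf_sum /coords mxE; apply: eq_bigr => j _ /=.
by rewrite mevalZ mevalXU mxE mulrC.
Qed.

Section ExceptionalQuartic.

Variable F : finFieldType.
Local Notation q := #|F|.
Local Notation V3 := 'rV[F]_3.

Definition vec (a b c : F) : V3 := \row_i [:: a; b; c]`_i.

Definition frame_mx (u v w : V3) : 'M[F]_3 := \matrix_(i, j) [:: u; v; w]`_j 0 i.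

Lemma mul_frame_mx u v w (x : V3) :
  x *m (frame_mx u v w)^T = x 0 0 *: u + x 0 1 *: v + x 0 2 *: w.
Proof. by apply/rowP => i; rewrite !mxE sum3 !mxE. Qed.

Lemma frame_mx_unit u v w : det3 u v w != 0 -> frame_mx u v w \in unitmx.
Proof.
move=> D0; rewrite -unitmx_tr -row_free_unit; apply/inj_row_free => x.
rewrite mul_frame_mx => x0.
have [|x00 x01 x02] := @det3_inj _ u v w (x 0 0) (x 0 1) (x 0 2) 0 0 0 D0.
  by rewrite x0 !scale0r !addr0.
by apply: row3P; rewrite mxE.
Qed.

Variable f : {mpoly F[3]}.
Hypotheses (hf : f \is q.-homog) (linef : line_free f) (smf : smooth f).
Hypothesis many : ((q - 1) * q + 1 < num_points f)%N.
Local Notation f_ v := (f.@[coords v]).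

Let q4 : q = 4%N := degree_q_small hf linef smf many.

Lemma char2 (x : F) : x + x = 0.
Proof.
have two0 : 2%:R = 0 :> F.
  have := natr_card F; rewrite q4 (natrM _ 2 2) => /eqP.
  by rewrite mulf_eq0 orbb => /eqP.
by rewrite -mulr2n -mulr_natl two0 mul0r.
Qed.

Lemma fourth_power (x : F) : x ^+ 4 = x.
Proof. by rewrite -q4 expf_card. Qed.

(** For q = 4, two linear forms raise the degree from 4 to 6 = 2 (q - 1), so that [two_point_sum]
    applies; in characteristic 2, opposite values are equal. *)
Lemma frame_value_transfer u v w (r s b c : V3) : frame f u v w ->
    dot r b * dot s b = 1 -> dot r c * dot s c = 1 -> cross b c != 0 ->
    (forall x : V3, f_ (x 0 0 *: u + x 0 1 *: v + x 0 2 *: w) != 0 ->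
       dot r x != 0 -> dot s x != 0 -> (exists a, x = a *: b) \/ (exists a, x = a *: c)) ->
  f_ (b 0 0 *: u + b 0 1 *: v + b 0 2 *: w) = f_ (c 0 0 *: u + c 0 1 *: v + c 0 2 *: w).
Proof.
move=> fr rsb rsc bc only; pose g := linear_subst (frame_mx u v w) f.
have gE x : g.@[coords x] = f_ (x 0 0 *: u + x 0 1 *: v + x 0 2 *: w).
  by rewrite linear_subst_meval mul_frame_mx.
have hg : g * (linform r * linform s) \is (2 * q.-1).-homog.
  rewrite (_ : (2 * q.-1 = q + (1 + 1))%N); last by rewrite q4.
  by apply: dhomogM; [apply: linear_subst_homog | apply: dhomogM; apply: linform_homog].
have := two_point_sum hg bc; rewrite !mevalM !meval_linform rsb rsc !mulr1 !gE => sum0.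
apply/eqP; rewrite -subr_eq0 -(addrK (f_ (c 0 0 *: u + c 0 1 *: v + c 0 2 *: w)) (f_ _)).
rewrite sum0 => [|x]; first by rewrite sub0r -opprD char2 oppr0.
rewrite !mevalM !meval_linform gE !mulf_eq0 !negb_or => /andP[fx /andP[rx sx]].
exact: only.
Qed.

Lemma vecE a b c : (vec a b c 0 0 = a) * (vec a b c 0 1 = b) * (vec a b c 0 2 = c).
Proof. by rewrite !mxE. Qed.

Lemma vec_cross2 a b c a' b' c' : cross (vec a b c) (vec a' b' c') 0 2 = a * b' - b * a'.
Proof. by rewrite cross2 !vecE. Qed.

Lemma vecZ k a b c (x : V3) : x 0 0 = k * a -> x 0 1 = k * b -> x 0 2 = k * c ->
  x = k *: vec a b c.
Proof. by move=> x0 x1 x2; apply: row3P; rewrite mxE vecE. Qed.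

(** Two lines of the Fano plane cover five of its seven points; each part uses two lines that miss
    [u] and one other point. *)
Lemma frame_values u v w : frame f u v w ->
  [/\ f_ v = f_ u, f_ (u + v) = f_ u & f_ (u + v + w) = f_ u].
Proof.
move=> fr; have char2_eq (x y : F) : x - y = 0 -> x + y = 0.
  by move/subr0_eq->; apply: char2.
have only x : f_ (x 0 0 *: u + x 0 1 *: v + x 0 2 *: w) != 0 ->
    [/\ x 0 0 = 0 \/ x 0 1 = 0 \/ x 0 0 = x 0 1, x 0 1 = 0 \/ x 0 2 = 0 \/ x 0 1 = x 0 2
      & x 0 0 = 0 \/ x 0 2 = 0 \/ x 0 0 = x 0 2].
  case/(frame_only hf linef smf many fr) => xy yz zx.
  have ors (a b : F) : a * b * (a - b) = 0 -> a = 0 \/ b = 0 \/ a = b.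
    move/eqP; rewrite !mulf_eq0 subr_eq0 => /orP[/orP[]|] /eqP->; auto.
  split; try exact: ors.
  by case: (ors _ _ zx) => [|[]]; auto.
have eval a b c x : a *: u + b *: v + c *: w = x ->
    f_ (vec a b c 0 0 *: u + vec a b c 0 1 *: v + vec a b c 0 2 *: w) = f_ x.
  by rewrite !vecE => ->.
have c0 a b c a' b' c' : a * b' - b * a' != 0 ->
    cross (vec a b c) (vec a' b' c') != 0.
  by apply: contraNneq => E; rewrite -(vec_cross2 a b c a' b' c') E mxE.
have Eu : 1 *: u + 0 *: v + 0 *: w = u by rewrite scale1r !scale0r !addr0.
split.
(* x + y = 0 and x + y + z = 0 miss (1:0:0) and (0:1:0). *)
- have := @frame_value_transfer u v w (vec 1 1 0) (vec 1 1 1) (vec 1 0 0) (vec 0 1 0) fr.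
  rewrite (eval _ _ _ _ Eu) (eval _ _ _ v); last by rewrite scale1r !scale0r addr0 add0r.
  rewrite /dot !vecE !(mul0r, mul1r, mulr0, mulr1, addr0, add0r) => -> //.
    by apply: c0; rewrite !mul1r !mul0r subr0 oner_neq0.
  move=> x /only[xy yz zx]; rewrite !(mul0r, mul1r, addr0).
  case: xy => [xy|[xy|xy]]; rewrite xy ?char2 ?eqxx ?add0r ?addr0 // => nxy nxyz.
  + right; exists (x 0 1); apply: vecZ; rewrite ?mulr0 ?mulr1 //.
    by case: yz nxy nxyz => [->|[//|->]]; rewrite ?char2 eqxx.
  + left; exists (x 0 0); apply: vecZ; rewrite ?mulr0 ?mulr1 //.
    by case: zx nxy nxyz => [->|[//|->]]; rewrite ?char2 eqxx.
(* x = 0 and x + z = 0 miss (1:0:0) and (1:1:0). *)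
- have := @frame_value_transfer u v w (vec 1 0 0) (vec 1 0 1) (vec 1 0 0) (vec 1 1 0) fr.
  rewrite (eval _ _ _ _ Eu) (eval _ _ _ (u + v)); last by rewrite !scale1r scale0r addr0.
  rewrite /dot !vecE !(mul0r, mul1r, mulr0, mulr1, addr0, add0r) => -> //.
    by apply: c0; rewrite !mul1r !mul0r subr0 oner_neq0.
  move=> x /only[xy yz zx]; rewrite !(mul0r, mul1r, addr0) => nx nxz.
  have x2 : x 0 2 = 0 by case: zx nx nxz => [->|[//|->]]; rewrite ?char2 eqxx.
  case: xy nx => [->|[x1|x01] _]; first by rewrite eqxx.
    by left; exists (x 0 0); apply: vecZ; rewrite ?mulr0 ?mulr1.
  by right; exists (x 0 0); apply: vecZ; rewrite ?mulr0 ?mulr1.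
(* x = 0 and x + y + z = 0 miss (1:0:0) and (1:1:1). *)
- have := @frame_value_transfer u v w (vec 1 0 0) (vec 1 1 1) (vec 1 0 0) (vec 1 1 1) fr.
  rewrite (eval _ _ _ _ Eu) (eval _ _ _ (u + v + w)); last by rewrite !scale1r.
  rewrite /dot !vecE !(mul0r, mul1r, mulr0, mulr1, addr0, add0r) char2 add0r => -> //.
    by apply: c0; rewrite !mul1r !mul0r subr0 oner_neq0.
  move=> x /only[xy yz zx]; rewrite !(mul0r, mul1r, addr0) => nx nxyz.
  case: xy nx nxyz => [->|[x1|x01] nx]; first by rewrite eqxx.
    case: zx nx => [->|[x2|x02] nx]; first by rewrite eqxx.
      by left; exists (x 0 0); apply: vecZ; rewrite ?mulr0 ?mulr1.
    by rewrite x1 x02 addr0 char2 eqxx.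
  rewrite -x01 char2 add0r => n2; right; exists (x 0 0); apply: vecZ; rewrite ?mulr1 //.
  by case: zx nx n2 => [->|[->|//]]; rewrite eqxx.
Qed.

Definition quartic3 (a b c : F) : F :=
  a ^+ 4 + b ^+ 4 + c ^+ 4 + a ^+ 2 * b ^+ 2 + b ^+ 2 * c ^+ 2 + c ^+ 2 * a ^+ 2
  + a ^+ 2 * b * c + a * b ^+ 2 * c + a * b * c ^+ 2.

Lemma meval_exceptional (x : V3) :
  (exceptional_quartic F).@[coords x] = quartic3 (x 0 0) (x 0 1) (x 0 2).
Proof. by rewrite /exceptional_quartic !(mevalD, mevalM, rmorphXn) /= !mevalXU. Qed.

Lemma exceptional_homog : exceptional_quartic F \is 4.-homog.
Proof.
have hX (i : 'I_3) : ('X_i : {mpoly F[3]}) \is 1.-homog by rewrite dhomogX /= mdeg1.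
have hXn (i : 'I_3) n : ('X_i ^+ n : {mpoly F[3]}) \is n.-homog.
  by rewrite -{2}[n]mul1n; apply: dhomogMn.
have hM d e (p r : {mpoly F[3]}) : p \is d.-homog -> r \is e.-homog -> p * r \is (d + e).-homog.
  exact: dhomogM.
have M22 (i j : 'I_3) : ('X_i ^+ 2 * 'X_j ^+ 2 : {mpoly F[3]}) \is 4.-homog by apply: (hM 2 2); apply: hXn.
by rewrite /exceptional_quartic !rpredD ?M22 ?hXn //;
  [apply: (hM 3 1) => //; apply: (hM 2 1)
  |apply: (hM 3 1) => //; apply: (hM 1 2)
  |apply: (hM 2 2) => //; apply: (hM 1 1)].
Qed.

Lemma quartic3_rot a b c : quartic3 b c a = quartic3 a b c.
Proof. by rewrite /quartic3; ring. Qed.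

(** Nonzero elements of F_4 have cube 1, so distinct ones satisfy a^2 + a b + b^2 = 0. Modulo this
    relation and 2 the quartic reduces to c^4 - a^3 c = c - c. *)
Lemma quartic3_distinct a b c : a != 0 -> b != 0 -> a != b -> quartic3 a b c = 0.
Proof.
have cube (x : F) : x != 0 -> x ^+ 3 = 1.
  by move=> x0; apply: (mulfI x0); rewrite -exprS fourth_power mulr1.
move=> a0 b0 ab; have Q0 : a ^+ 2 + a * b + b ^+ 2 = 0.
  have : (a - b) * (a ^+ 2 + a * b + b ^+ 2) = 0.
    by transitivity (a ^+ 3 - b ^+ 3); [ring | rewrite !cube ?subrr].
  by move/eqP; rewrite mulf_eq0 subr_eq0 (negPf ab) => /eqP.
transitivity ((a ^+ 2 + a * b + b ^+ 2) * (a ^+ 2 + a * b + b ^+ 2 + c ^+ 2 + a * c)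
  + c ^+ 4 - a ^+ 3 * c - (a ^+ 3 * b + a ^+ 2 * b ^+ 2 + a * b ^+ 3 + (a ^+ 3 * b + a ^+ 2 * b ^+ 2 + a * b ^+ 3))).
  by rewrite /quartic3; ring.
by rewrite Q0 char2 cube // fourth_power; ring.
Qed.

(** Both sides are linear under scaling, since fourth powers are trivial in F_4. They vanish when
    two nonzero coordinates differ; the remaining vectors are multiples of Fano points, where [f]
    has the constant value f(u) and the quartic the value 1. *)
Lemma frame_value u v w a b c : frame f u v w ->
  f_ (a *: u + b *: v + c *: w) = quartic3 a b c * f_ u.
Proof.
move=> fr; have [fv fuv fuvw] := frame_values fr.
have [fw fvw _] := frame_values (frame_rot fr).
have [_ fwu _] := frame_values (frame_rot (frame_rot fr)).
have scale k x : f_ (k *: x) = k * f_ x by rewrite (meval_scale _ _ hf) expf_card.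
have zero : a * b * (a - b) != 0 \/ b * c * (b - c) != 0 \/ c * a * (c - a) != 0 ->
    f_ (a *: u + b *: v + c *: w) = quartic3 a b c * f_ u.
  move=> ne; have [->|/(frame_only hf linef smf many fr)[ab bc ca]] := eqVneq (f_ (a *: u + b *: v + c *: w)) 0; last first.
    by move: ne; rewrite ab bc ca eqxx => -[|[]].
  have dist (x y : F) : x * y * (x - y) != 0 -> [/\ x != 0, y != 0 & x != y].
    by rewrite !mulf_eq0 subr_eq0 !negb_or => /andP[/andP[]].
  case: ne => [|[|]] /dist[x0 y0 xy].
  - by rewrite quartic3_distinct ?mul0r.
  - by rewrite -quartic3_rot quartic3_distinct ?mul0r.
  - by rewrite -2!quartic3_rot quartic3_distinct ?mul0r.
have [ab|ab] := eqVneq (a * b * (a - b)) 0; last by apply: zero; left.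
have [bc|bc] := eqVneq (b * c * (b - c)) 0; last by apply: zero; right; left.
have [ca|ca] := eqVneq (c * a * (c - a)) 0; last by apply: zero; right; right.
have eq (x y : F) : x * y * (x - y) = 0 -> x != 0 -> y != 0 -> x = y.
  by move/eqP; rewrite !mulf_eq0 subr_eq0 => /orP[/orP[]|] /eqP-> //; rewrite eqxx.
have q3 k : [/\ quartic3 k 0 0 = k, quartic3 k k 0 = k & quartic3 k k k = k].
  split; rewrite -[RHS]fourth_power /quartic3; first ring.
    by transitivity (k ^+ 4 + (k ^+ 4 + k ^+ 4)); [ring | rewrite char2 addr0].
  transitivity (k ^+ 4 + (k ^+ 4 *+ 4 + k ^+ 4 *+ 4)); [ring | by rewrite char2 addr0].
have [a0|a0] := eqVneq a 0; have [b0|b0] := eqVneq b 0; have [c0|c0] := eqVneq c 0.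
- rewrite a0 b0 c0 !scale0r !addr0; have [-> _ _] := q3 0; rewrite mul0r.
  by have := scale 0 u; rewrite scale0r mul0r.
- by rewrite a0 b0 !scale0r !add0r -quartic3_rot -quartic3_rot; have [-> _ _] := q3 c; rewrite scale fw fv.
- by rewrite a0 c0 !scale0r add0r addr0 -quartic3_rot; have [-> _ _] := q3 b; rewrite scale fv.
- rewrite a0 -(eq _ _ bc b0 c0) scale0r add0r -scalerDr -quartic3_rot.
  by have [_ -> _] := q3 b; rewrite scale fvw fv.
- by rewrite b0 c0 !scale0r !addr0; have [-> _ _] := q3 a; rewrite scale.
- rewrite b0 -(eq _ _ ca c0 a0) scale0r addr0 addrC -scalerDr -2!quartic3_rot.
  by have [_ -> _] := q3 c; rewrite scale fwu fw fv.
- rewrite c0 -(eq _ _ ab a0 b0) scale0r addr0 -scalerDr.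
  by have [_ -> _] := q3 a; rewrite scale fuv.
rewrite -(eq _ _ bc b0 c0) -(eq _ _ ab a0 b0) -!scalerDr.
by have [_ _ ->] := q3 a; rewrite scale fuvw.
Qed.

Lemma degree_q_exceptional : proj_equiv f (exceptional_quartic F).
Proof.
have [u [v [w fr]]] := frame_exists hf linef smf many.
have [D0 fu _ _ _] := fr.
exists (frame_mx u v w), (f_ u)^-1; split; rewrite ?invr_eq0 ?frame_mx_unit //.
apply/eqP; rewrite -subr_eq0; apply/eqP/form_eq0.
  apply: rpredB; first by rewrite q4 exceptional_homog.
  by apply: rpredZ; apply: linear_subst_homog.
move=> x; rewrite mevalB mevalZ linear_subst_meval mul_frame_mx (frame_value _ _ _ fr).
by rewrite meval_exceptional mulrC mulfK // subrr.
Qed.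

End ExceptionalQuartic.

(** * Descent to rational points and the upper bound in all degrees *)

Section Upperbound.

Variable F : finFieldType.
Local Notation iota := (to_alg_closure F).

Lemma meval_map (v : 'I_3 -> F) (p : {mpoly F[3]}) :
  (map_mpoly iota p).@[fun i => iota (v i)] = iota p.@[v].
Proof.
rewrite [p in LHS]mpolyE [in RHS]mevalE (raddf_sum (map_mpoly iota)) (raddf_sum (meval _)) raddf_sum /=.
apply: eq_bigr => m _.
rewrite map_mpolyZ map_mpolyX mevalZ mevalX rmorphM rmorph_prod /=; congr (_ * _).
by apply: eq_bigr => i _; rewrite rmorphXn.
Qed.

Lemma mderiv_map k (p : {mpoly F[3]}) :
  mderiv k (map_mpoly iota p) = map_mpoly iota (mderiv k p).
Proof.
rewrite [p]mpolyE (raddf_sum (map_mpoly iota)) !(raddf_sum (mderiv k)) (raddf_sum (map_mpoly iota)) /=.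
apply: eq_bigr => m _.
by rewrite map_mpolyZ map_mpolyX !mderivZ !mderivX !map_mpolyZ map_mpolyX rmorph_nat.
Qed.

Lemma nonsingular_smooth (f : {mpoly F[3]}) : nonsingular f -> smooth f.
Proof.
move=> ns v v0 fv; apply/eqP => g0; apply: ns; exists (map_mx iota v); split.
- by rewrite map_mx_eq0.
- rewrite -(rmorph0 iota) -fv -meval_map; apply: meval_eq => i; exact: mxE.
- move=> k; rewrite mderiv_map -(rmorph0 iota).
  have -> : 0 = (mderiv k f).@[coords v] by have := congr1 (fun w : 'rV_3 => w 0 k) g0; rewrite !mxE.
  rewrite -meval_map; apply: meval_eq => i; exact: mxE.
Qed.

Lemma num_points_le (d : nat) (f : {mpoly F[3]}) : f \is d.-homog ->
  (num_points f <= #|F| ^ 2 + #|F| + 1)%N.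
Proof.
move=> hf; rewrite -card_pointsE (num_pointsE hf); apply: subset_leq_card.
by apply/subsetP => P; rewrite in_set => /andP[].
Qed.

Lemma sziklai_bound d (f : {mpoly F[3]}) :
    is_plane_curve d f -> nonsingular f -> no_linear_component f ->
    ~ (#|F| = 4%N /\ proj_equiv f (exceptional_quartic F)) ->
  (num_points f <= (d - 1) * #|F| + 1)%N.
Proof.
case=> d0 f0 hf /nonsingular_smooth smf nl nex.
have lin : linear_factor_free f by move=> l g l2 E; apply: nl; exists l, g.
have linef := line_free_intro hf lin.
have q1 := card_field_gt1 F.
case: (ltngtP d #|F|) => [dq|dq|dq].
- exact: small_degree_bound.
- have [dq2|dq2] := leqP (#|F| + 2) d.
    (* From degree q + 2 on, the bound is at least the number of points of the whole plane. *)
    apply: leq_trans (num_points_le hf) _; move: dq2 q1; clear; move: (#|F|); nia.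
  have dE : d = #|F|.+1 by move: dq dq2; clear; move: (#|F|); lia.
  have := num_points_bound d0 hf linef smf; rewrite dE; move: q1; clear.
  rewrite subSS subn0; move: (num_points f) (#|F|) => N q q1 le.
  (* (q^2 + 2)(q + 2) exceeds (q + 1)(q^2 + q + 1) by 3, hence N <= q^2 + 1. *)
  have : (N * (q + 2) < (q * q + 2) * (q + 2))%N by apply: leq_ltn_trans le _; nia.
  by rewrite ltn_mul2r; nia.
rewrite dq in hf *; rewrite leqNgt; apply/negP => many; apply: nex; split.
  exact: degree_q_small many.
exact: degree_q_exceptional many.
Qed.

End Upperbound.

(** * Extremal curves *)

Section FormalPolynomials.

Variable F : finFieldType.
Local Notation L := (alg_closure F).
Local Notation iota := (to_alg_closure F).

(* A syntax of polynomials whose values and partial derivatives are found by simplification. *)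
Inductive form :=
  Var of 'I_3 | Cst of F | Add of form & form | Opp of form | Mul of form & form | Exp of form & nat.

Fixpoint interp (A : comNzRingType) (V : 'I_3 -> A) (h : F -> A) (e : form) : A :=
  match e with
  | Var i => V i
  | Cst c => h c
  | Add e1 e2 => interp V h e1 + interp V h e2
  | Opp e1 => - interp V h e1
  | Mul e1 e2 => interp V h e1 * interp V h e2
  | Exp e1 n => interp V h e1 ^+ n
  end.

Fixpoint dinterp (A : comNzRingType) k (V : 'I_3 -> A) (h : F -> A) (e : form) : A :=
  match e with
  | Var i => (i == k)%:R
  | Cst c => 0
  | Add e1 e2 => dinterp k V h e1 + dinterp k V h e2
  | Opp e1 => - dinterp k V h e1
  | Mul e1 e2 => dinterp k V h e1 * interp V h e2 + interp V h e1 * dinterp k V h e2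
  | Exp e1 n => n%:R * interp V h e1 ^+ n.-1 * dinterp k V h e1
  end.

Definition poly_of (e : form) : {mpoly F[3]} := interp (fun i => 'X_i) (@mpolyC 3 F) e.

Lemma rmorph_interp (A B : comNzRingType) (phi : {rmorphism A -> B}) V h W h' e :
  (forall i, phi (V i) = W i) -> (forall c, phi (h c) = h' c) ->
  phi (interp V h e) = interp W h' e.
Proof.
move=> hV hh; elim: e => //= [e1 <- e2 <-|e1 <-|e1 <- e2 <-|e1 <- n].
- exact: rmorphD.
- exact: rmorphN.
- exact: rmorphM.
- exact: rmorphXn.
Qed.

Lemma rmorph_dinterp (A B : comNzRingType) (phi : {rmorphism A -> B}) k V h W h' e :
  (forall i, phi (V i) = W i) -> (forall c, phi (h c) = h' c) ->
  phi (dinterp k V h e) = dinterp k W h' e.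
Proof.
move=> hV hh; have ri e1 := rmorph_interp e1 hV hh.
elim: e => //= [i|c|e1 <- e2 <-|e1 <-|e1 <- e2 <-|e1 <- n]; rewrite -?ri.
- exact: rmorph_nat.
- exact: rmorph0.
- exact: rmorphD.
- exact: rmorphN.
- by rewrite rmorphD !rmorphM.
- by rewrite !rmorphM rmorph_nat rmorphXn.
Qed.

Lemma mderivXn (A : comNzRingType) k (p : {mpoly A[3]}) n :
  mderiv k (p ^+ n) = n%:R * p ^+ n.-1 * mderiv k p.
Proof.
case: n => [|n]; first by rewrite expr0 -mpolyC1 mderivC !mul0r.
elim: n => [|n IHn]; first by rewrite !mul1r.
by rewrite exprS mderivM IHn !exprS -[n.+2]addn1 natrD; ring.
Qed.

Lemma mderiv_interp (A : comNzRingType) k (h : F -> {mpoly A[3]}) e :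
  (forall c, mderiv k (h c) = 0) ->
  mderiv k (interp (fun i => 'X_i) h e) = dinterp k (fun i => 'X_i) h e.
Proof.
move=> hh; elim: e => //= [i|e1 <- e2 <-|e1 <-|e1 <- e2 <-|e1 <- n].
- rewrite mderivX mnm1E; case: eqP => [<-|_]; last by rewrite scale0r.
  by rewrite scale1r (_ : (U_(i) - U_(i))%MM = 0%MM) ?mpolyX0 //; apply/mnmP => j; rewrite mnmBE subnn mnm0E.
- exact: mderivD.
- exact: mderivN.
- exact: mderivM.
- exact: mderivXn.
Qed.

Lemma meval_poly_of (v : 'I_3 -> F) e : (poly_of e).@[v] = interp v id e.
Proof.
apply: (rmorph_interp (phi := meval v)) => [i|c] /=; first exact: mevalXU.
exact: mevalC.
Qed.

Lemma map_poly_of e :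
  map_mpoly iota (poly_of e) = interp (fun i => 'X_i) (fun c => (iota c)%:MP) e.
Proof.
apply: (rmorph_interp (phi := map_mpoly iota)) => [i|c] /=; first exact: map_mpolyX.
exact: map_mpolyC.
Qed.

Lemma nonsingular_intro e :
    (forall V : 'I_3 -> L, interp V iota e = 0 -> (forall k, dinterp k V iota e = 0) ->
       [/\ V 0 = 0, V 1 = 0 & V 2 = 0]) ->
  nonsingular (poly_of e).
Proof.
rewrite /nonsingular map_poly_of /= => sing [v [v0 fv dv]]; apply: (negP v0); apply/eqP.
have [|k|v1 v2 v3] := sing (fun i => v 0 i); last by apply: row3P; rewrite [RHS]mxE.
  rewrite -[RHS]fv; apply/esym/(rmorph_interp (phi := meval _)) => [i|c] /=; first exact: mevalXU.
  exact: mevalC.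
rewrite -[RHS](dv k) mderiv_interp => [|c]; last exact: mderivC.
apply/esym/(rmorph_dinterp (phi := meval _)) => [i|c] /=; first exact: mevalXU.
exact: mevalC.
Qed.

End FormalPolynomials.

Declare Scope curve_scope.
Delimit Scope curve_scope with curve.
Bind Scope curve_scope with form.
Notation "a + b" := (Add a b) : curve_scope.
Notation "- a" := (Opp a) : curve_scope.
Notation "a - b" := (Add a (Opp b)) : curve_scope.
Notation "a * b" := (Mul a b) : curve_scope.
Notation "a ^+ n" := (Exp a n) : curve_scope.

Section Examples.

Variable F : finFieldType.
Local Notation q := #|F|.
Local Notation V3 := 'rV[F]_3.
Local Notation L := (alg_closure F).
Local Notation iota := (to_alg_closure F).
Implicit Types f g : {mpoly F[3]}.

Lemma sum_vec (G : F -> F -> F -> nat) :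
  (\sum_(v : V3) G (v 0%R 0%R) (v 0%R 1%R) (v 0%R 2%R) = \sum_a \sum_b \sum_c G a b c)%N.
Proof.
rewrite !pair_bigA /= (reindex (fun p : F * F * F => vec p.1.1 p.1.2 p.2)) /=.
  by apply: eq_bigr => p _; rewrite !vecE.
exists (fun v : V3 => (v 0 0, v 0 1, v 0 2)) => [[[a b] c] _|v _] /=; first by rewrite !vecE.
by apply: row3P; rewrite vecE.
Qed.

(** The affine cone over the curve consists of q - 1 vectors for each point, and the origin. *)
Lemma num_points_sum d f (B : F -> F -> F -> bool) : (0 < d)%N -> f \is d.-homog ->
    (forall a b c, (f.@[coords (vec a b c)] == 0) = B a b c) ->
  (q.-1 * num_points f + 1 = \sum_a \sum_b \sum_c B a b c)%N.
Proof.
move=> d0 hf fB; have inv : scale_inv (fun v : V3 => f.@[coords v] == 0).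
  by move=> a v a0; rewrite (meval_scale _ _ hf) mulf_eq0 expf_eq0 (negPf a0) andbF.
rewrite (num_pointsE hf) -card_vectors // -sum_vec.
transitivity #|[set v : V3 | f.@[coords v] == 0]|.
  rewrite [RHS](cardsD1 0) in_set -(scale0r (0 : V3)) (meval_scale _ _ hf) expr0n gtn_eqF //.
  rewrite mul0r eqxx addnC; congr (_ + _)%N; apply: eq_card => v.
  by rewrite in_set in_setD1 in_set scale0r.
rewrite -sum1dep_card big_mkcond; apply: eq_bigr => v _.
by rewrite -fB (_ : vec _ _ _ = v) //; apply: row3P; rewrite vecE.
Qed.

Lemma nonsingular_neq0 f : nonsingular f -> f != 0.
Proof.
move=> ns; apply/eqP => f0; apply: ns; exists (delta_mx 0 0); rewrite f0 (rmorph0 (map_mpoly iota)).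
split=> [||k]; rewrite ?mderiv0 ?meval0 //.
by apply/eqP => /rowP/(_ 0)/eqP; rewrite !mxE !eqxx oner_eq0.
Qed.

Lemma natr_card_closure : q%:R = 0 :> L.
Proof. by rewrite -(rmorph_nat iota) natr_card rmorph0. Qed.

Lemma example_intro d f N : (0 < d)%N -> f \is d.-homog -> nonsingular f ->
    num_points f = N ->
  exists C : {mpoly F[3]}, [/\ is_plane_curve d C, nonsingular C & num_points C = N].
Proof. by move=> d0 hf ns <-; exists f; split=> //; split=> //; apply: nonsingular_neq0. Qed.

Let hX (i : 'I_3) : ('X_i : {mpoly F[3]}) \is 1.-homog.
Proof. by rewrite dhomogX /= mdeg1. Qed.

Let hXn (i : 'I_3) n : ('X_i ^+ n : {mpoly F[3]}) \is n.-homog.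
Proof. by rewrite -{2}[n]mul1n; apply: dhomogMn. Qed.

Let hM d e c f g : f \is d.-homog -> g \is e.-homog -> (d + e = c)%N -> f * g \is c.-homog.
Proof. by move=> hf hg <-; apply: dhomogM. Qed.

Local Notation X := (Var F 0).
Local Notation Y := (Var F 1).
Local Notation Z := (Var F 2).

Lemma num_points_eq d f (B : F -> F -> F -> bool) N : (0 < d)%N -> f \is d.-homog ->
    (forall a b c, (f.@[coords (vec a b c)] == 0) = B a b c) ->
    (\sum_a \sum_b \sum_c B a b c = q.-1 * N + 1)%N ->
  num_points f = N.
Proof.
move=> d0 hf fB; rewrite -(num_points_sum d0 hf fB) => /eqP.
rewrite eqn_add2r eqn_pmul2l => [/eqP//|]; by have := card_field_gt1 F; case: (q) => [|[]].
Qed.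

Lemma sum_nonzero (G : F -> nat) n : (forall a, a != 0 -> G a = n) ->
  (\sum_a G a = G 0%R + q.-1 * n)%N.
Proof.
move=> Gn; rewrite (bigD1 0) //=; congr (_ + _)%N.
rewrite (eq_bigr (fun=> n)) => [|a a0]; last exact: Gn.
by rewrite sum_nat_const card_nonzero.
Qed.

Lemma sum_const n : (\sum_(a : F) n = q * n)%N.
Proof. by rewrite sum_nat_const. Qed.

Lemma sum_eq (t : F) : (\sum_c (c == t) = 1)%N.
Proof. by rewrite (bigD1 t) //= eqxx big1 // => c /negPf->. Qed.

Lemma exp_pred_card (x : F) : x ^+ q.-1 = (x != 0)%:R.
Proof.
have q1 := card_field_gt1 F; have [->|x0] := eqVneq x 0.
  by rewrite expr0n; case: (q) q1 => [|[]].
by apply: (mulfI x0); rewrite -exprS mulr1 prednK ?expf_card // ltnW.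
Qed.

Lemma exp_eq0 (R : idomainType) (x : R) n : x ^+ n.+1 = 0 -> x = 0.
Proof. by move/eqP; rewrite expf_eq0 => /eqP. Qed.

Lemma example_conic :
  exists C : {mpoly F[3]}, [/\ is_plane_curve 2 C, nonsingular C & num_points C = (2 - 1) * q + 1]%N.
Proof.
have hC : poly_of (X * Z - Y ^+ 2)%curve \is 2.-homog.
  by apply: rpredB; [apply: (hM (hX _) (hX _)) | apply: hXn].
apply: (example_intro _ hC) => //.
  apply: nonsingular_intro => V; rewrite /= => C0 dC.
  (* The derivative in Y is identically zero in characteristic 2, so y = 0 has to come from the
     equation itself. *)
  have := dC 0; have := dC 2; rewrite /= !(mul1r, mul0r, mulr0, mulr1, add0r, addr0, subr0).
  move=> x0 z0; split=> //; apply/eqP; rewrite -sqrf_eq0 -oppr_eq0 -[X in X == _]add0r.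
  by move: C0; rewrite x0 mul0r => ->.
apply: (num_points_eq (B := fun a b c => a * c == b ^+ 2) _ hC) => // [a b c|].
  by rewrite meval_poly_of /= /coords !vecE subr_eq0.
rewrite (sum_nonzero (n := q)) => [|a a0]; last first.
  rewrite -[RHS]muln1 -sum_const; apply: eq_bigr => b _.
  apply: etrans (sum_eq (b ^+ 2 / a)); apply: eq_bigr => c _.
  by rewrite -[in RHS](inj_eq (mulfI a0)) [a * (_ / _)]mulrC divfK.
rewrite (sum_nonzero (n := 0%N)) => [|b b0]; last first.
  by rewrite big1 // => c _; rewrite mul0r eq_sym sqrf_eq0 (negPf b0).
under eq_bigr do rewrite mul0r expr0n eqxx; rewrite sum_const.
by have := card_field_gt1 F; move: (q); clear; case=> // n; nia.
Qed.

(** At rational points the last two terms cancel and the first two give X^2 (1 - Z^(q-1)), so only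
    the points of Z = 0 other than (0:1:0) are missed. As q = 0 in the field, the derivatives in Y,
    X, Z kill Z, X, Y in this order. *)
Lemma example_card_succ :
  exists C : {mpoly F[3]}, [/\ is_plane_curve (q + 1) C, nonsingular C & num_points C = (q + 1 - 1) * q + 1]%N.
Proof.
have q1 := card_field_gt1 F.
have q0 : q%:R = 0 :> L := natr_card_closure.
have p0 : q.-1%:R = -1 :> L by apply/eqP; rewrite -addr_eq0 natr1 prednK ?q0 // ltnW.
have hC : poly_of (X ^+ q.+1 - X ^+ 2 * Z ^+ q.-1 + Y ^+ q * Z - Y * Z ^+ q)%curve \is (q + 1).-homog.
  rewrite addn1; apply: rpredB; first apply: rpredD; first apply: rpredB.
  - exact: hXn.
  - by apply: (hM (hXn _ _) (hXn _ _)); rewrite !addSn add0n prednK // ltnW.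
  - by apply: (hM (hXn _ _) (hX _)); rewrite addn1.
  - by apply: (hM (hX _) (hXn _ _)); rewrite add1n.
apply: (example_intro _ hC) => //; first by rewrite addn1.
  apply: nonsingular_intro => V _ dC.
  have := dC 0; have := dC 1; have := dC 2; have [n qE] : exists n, q = n.+2 by case: (q) q1 => [|[|n]] // _; exists n.
  move: q0 p0; rewrite qE /= => q0 p0.
  rewrite /= q0 p0 !(mul1r, mul0r, mulr0, mulr1, add0r, addr0, subr0).
  move=> + + + ; rewrite oppr0 add0r => d2 /eqP; rewrite oppr_eq0 => /eqP/exp_eq0 z0.
  rewrite z0 expr0n mulr0 subr0 -natr1 q0 add0r mul1r => /exp_eq0 x0.
  by move: d2; rewrite x0 expr0n mul0r oppr0 add0r => /exp_eq0.
apply: (num_points_eq (B := fun a b c => (a == 0) || (c != 0)) _ hC) => // [|a b c|].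
- by rewrite addn1.
- rewrite meval_poly_of /= /coords !vecE [a ^+ _.+1]exprS !expf_card exp_pred_card.
  rewrite addrK -expr2 -[X in X - _]mulr1 -mulrBr mulf_eq0 sqrf_eq0.
  by case: (c == 0); rewrite ?subr0 ?oner_eq0 ?subrr ?eqxx.
rewrite (sum_nonzero (n := q * q.-1)%N) => [|a a0]; last first.
  rewrite -sum_const; apply: eq_bigr => b _.
  by rewrite (sum_nonzero (n := 1%N)) => [|c c0]; rewrite (negPf a0) ?eqxx ?muln1 // c0.
rewrite eqxx /= !sum_const; move: q1; move: (q); clear.
by case=> // n; nia.
Qed.

(** At rational points with x nonzero the terms in Y cancel and X (1 - Z^(q-1)) remains; for x = 0
    only -Y remains. So the points are those with x and z nonzero, and (0:0:1). *)
Lemma example_card :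
  exists C : {mpoly F[3]}, [/\ is_plane_curve q C, nonsingular C & num_points C = (q - 1) * q + 1]%N.
Proof.
have q1 := card_field_gt1 F; have qS : q.-1.+1 = q by rewrite prednK // ltnW.
have hC : poly_of (X ^+ q - X * Z ^+ q.-1 + X ^+ q.-1 * Y - Y ^+ q)%curve \is q.-homog.
  apply: rpredB; first apply: rpredD; first apply: rpredB.
  - exact: hXn.
  - by apply: (hM (hX _) (hXn _ _)); rewrite add1n.
  - by apply: (hM (hXn _ _) (hX _)); rewrite addn1.
  - exact: hXn.
apply: (example_intro _ hC) => //; first exact: ltnW.
  apply: nonsingular_intro => V C0 dC; have q0 : q%:R = 0 :> L := natr_card_closure.
  have := dC 0; have := dC 1; move: C0; have [n qE] : exists n, q = n.+2.
    by case: (q) q1 => [|[|n]] // _; exists n.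
  move: q0; rewrite qE /= => q0.
  rewrite /= q0 !(mul1r, mul0r, mulr0, mulr1, add0r, addr0, subr0).
  rewrite oppr0 add0r => + /exp_eq0 x0; rewrite x0 !expr0n !mul0r subr0 !add0r => /eqP.
  rewrite oppr_eq0 => /eqP/exp_eq0 y0 /eqP; rewrite y0 mulr0 addr0 oppr_eq0 => /eqP/exp_eq0 z0.
  by split.
apply: (num_points_eq (B := fun a b c => if a == 0 then b == 0 else c != 0) _ hC) => // [|a b c|].
- exact: ltnW.
- rewrite meval_poly_of /= /coords !vecE !expf_card !exp_pred_card.
  have [->|a0] /= := eqVneq a 0; first by rewrite !mul0r subr0 !add0r oppr_eq0.
  rewrite mul1r addrK; case: (c == 0); rewrite ?mulr0 ?mulr1 ?subr0 ?subrr ?eqxx //.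
  exact: negPf.
rewrite (sum_nonzero (n := q * q.-1)%N) => [|a a0]; last first.
  rewrite -sum_const; apply: eq_bigr => b _; rewrite (negPf a0).
  by rewrite (sum_nonzero (n := 1%N)) => [|c c0]; rewrite ?eqxx ?muln1 // c0.
rewrite eqxx /= (sum_nonzero (n := 0%N)) => [|b b0]; last by rewrite big1 // => c _; rewrite (negPf b0).
by rewrite eqxx sum_const; move: q1; move: (q); clear; case=> // n; nia.
Qed.

(** A (q - 1)-st power is 0 or 1, and the coefficients 1, b, -(1 + b) have sum 0 but no vanishing
    sum over a proper nonempty subset. So the points are the (q - 1)^2 ones with all coordinates
    nonzero. *)
Lemma example_card_pred : (2 < q)%N ->
  exists C : {mpoly F[3]}, [/\ is_plane_curve (q - 1) C, nonsingular C & num_points C = (q - 1 - 1) * q + 1]%N.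
Proof.
move=> q2; have [n qE] : exists n, q = n.+3 by case: (q) q2 => [|[|[|n]]] // _; exists n.
have [b b0 b1] : exists2 b : F, b != 0 & 1 + b != 0.
  have : exists b, b \in ~: [set 0; -1 : F].
    apply/card_gt0P; rewrite cardsCs setCK cards2 subn_gt0; apply: leq_ltn_trans q2.
    by case: (_ != _).
  case=> b; rewrite !inE negb_or => /andP[b0 b1]; exists b => //.
  by rewrite addrC addr_eq0.
have hC : poly_of (X ^+ (q - 1) + Cst b * Y ^+ (q - 1) - Cst (1 + b)%R * Z ^+ (q - 1))%curve \is (q - 1).-homog.
  by rewrite /poly_of /= !mul_mpolyC; apply: rpredB; first apply: rpredD; rewrite ?rpredZ ?hXn.
apply: (example_intro _ hC) => //; first by rewrite qE.
  apply: nonsingular_intro => V C0 dC; have q0 : q%:R = 0 :> L := natr_card_closure.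
  have := dC 0; have := dC 1; have := dC 2.
  move: q0; rewrite qE subn1 /= -natr1 => /eqP; rewrite addr_eq0 => /eqP p0.
  rewrite /= p0 !(mul1r, mul0r, mulr0, mulr1, add0r, addr0, subr0).
  move=> /eqP; rewrite oppr_eq0 mulf_eq0 fmorph_eq0 (negPf b1) /= mulN1r oppr_eq0 => /eqP/exp_eq0 z0.
  move=> /eqP; rewrite mulf_eq0 fmorph_eq0 (negPf b0) /= mulN1r oppr_eq0 => /eqP/exp_eq0 y0.
  by move=> /eqP; rewrite mulN1r oppr_eq0 => /eqP/exp_eq0.
apply: (num_points_eq (B := fun x y z => if x == 0 then (y == 0) && (z == 0)
    else (y != 0) && (z != 0)) _ hC) => // [|x y z|].
- by rewrite qE.
- rewrite meval_poly_of /= /coords !vecE !subn1 !exp_pred_card.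
  case: (x == 0); case: (y == 0); case: (z == 0); rewrite /= ?mulr0 ?mulr1 ?add0r ?addr0 ?subr0 ?oppr_eq0 ?subrr ?eqxx ?oner_eq0 ?(negPf b0) ?(negPf b1) //.
  + by rewrite opprD addrCA subrr addr0 oppr_eq0 oner_eq0.
  + by rewrite opprD addrA subrr add0r oppr_eq0; apply: negPf.
rewrite (sum_nonzero (n := q.-1 * q.-1)%N) => [|x x0]; last first.
  rewrite (negPf x0) (sum_nonzero (n := q.-1)) => [|y y0].
    by rewrite eqxx /= big1.
  by rewrite y0 /= (sum_nonzero (n := 1%N)) => [|z z0]; rewrite ?z0 ?eqxx ?muln1.
rewrite eqxx (sum_nonzero (n := 0%N)) => [|y y0]; last by rewrite (negPf y0) /= big1.
rewrite eqxx /= sum_eq; move: q2; move: (q); clear; case=> // [[|n]] // _; nia.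
Qed.

End Examples.

(** * The Hermitian curve and the fibres of the norm *)

Section Hermitian.

Variable F : finFieldType.
Local Notation q := #|F|.
Local Notation L := (alg_closure F).
Variable r : nat.
Hypothesis rq : (r ^ 2 = q)%N.

Let r1 : (1 < r)%N.
Proof. by have := card_field_gt1 F; rewrite -rq; case: r => [|[|]]. Qed.

Lemma card_roots_le n (a : F) : (0 < n)%N -> (#|[set x | x ^+ n == a]| <= n)%N.
Proof.
move=> n0; have p0 : 'X^n - a%:P != 0 by rewrite -size_poly_eq0 size_XnsubC.
rewrite -ltnS -(size_XnsubC a n0) cardE; apply: max_poly_roots => //; last exact: enum_uniq.
by apply/allP => x; rewrite mem_enum inE rootE !hornerE subr_eq0.
Qed.

Lemma frobenius_sqrtD (x y : F) : (x + y) ^+ r = x ^+ r + y ^+ r.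
Proof.
have [p p_pr pF] := finPcharP F; apply: exprDn_pchar.
have : [pchar F].-nat (r ^ 2)%N.
  by rewrite rq (card_pprimeChar pF) pnatX; apply/orP; left; rewrite pnatE.
by rewrite pnatX orbF.
Qed.

Lemma norm_fixed (x : F) : (x ^+ r.+1) ^+ r = x ^+ r.+1.
Proof.
by rewrite exprSr exprMn -exprM mulnn rq expf_card mulrC -exprSr.
Qed.

(** The condition a^r = a describes the subfield of order r. The norm has at most r - 1 nonzero
    values there and fibres of at most r + 1 elements; as there are q - 1 = (r - 1)(r + 1) nonzero
    elements in all, every fibre is full. *)
Lemma card_norm_fibre (a : F) : a != 0 -> a ^+ r = a -> #|[set x | x ^+ r.+1 == a]| = r.+1.
Proof.
have qE : (q.-1 = (r - 1) * r.+1)%N by rewrite -rq; move: r1; clear; case: r => // n _; rewrite !expnS expn0; lia.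
pose K := [set a : F | (a != 0) && (a ^+ r == a)].
have cK : (#|K| <= r - 1)%N.
  have r10 : (0 < r - 1)%N by rewrite subn_gt0.
  apply: leq_trans (card_roots_le 1 r10); apply: subset_leq_card; apply/subsetP => b.
  rewrite !inE => /andP[b0 /eqP br]; apply/eqP/(mulfI b0).
  by rewrite mulr1 -exprS subn1 prednK // ltnW.
have sumK : (\sum_(b in K) #|[set x | x ^+ r.+1 == b]| = q.-1)%N.
  rewrite -card_nonzero -[RHS]sum1_card [RHS](partition_big (fun x : F => x ^+ r.+1) (mem K)) /=.
    apply: eq_bigr => b; rewrite !inE => /andP[b0 _]; rewrite -sum1_card; apply: eq_bigl => x.
    rewrite !inE; case: eqP => [E|]; rewrite ?andbF // andbT.
    by apply/esym; apply: contraNneq b0 => x0; rewrite -E x0 expr0n.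
  by move=> x x0; rewrite !inE expf_neq0 //= norm_fixed.
move=> a0 ar; have aK : a \in K by rewrite inE a0 ar eqxx.
apply/eqP; rewrite eqn_leq card_roots_le //=.
have : (\sum_(b in K | b != a) #|[set x | x ^+ r.+1 == b]| <= (r - 2) * r.+1)%N.
  apply: leq_trans (_ : (\sum_(b in K | b != a) r.+1 <= _)%N); first by apply: leq_sum => b _; apply: card_roots_le.
  rewrite sum_nat_const leq_mul2r /= -ltnS.
  have -> : #|[pred b | (b \in K) && (b != a)]| = #|K :\ a|.
    by apply: eq_card => b; rewrite in_setD1 andbC.
  have := cardsD1 a K; rewrite aK; lia.
move: sumK; rewrite (bigD1 a) //= qE; move: (\sum_(_ in _ | _) _)%N (#|_|) r1; clear; nia.
Qed.

Lemma sum_norm_eq (w : F) : w ^+ r = w ->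
  (\sum_(z : F) (w + z ^+ r.+1 == 0)%R = if (w == 0)%R then 1 else r.+1)%N.
Proof.
move=> wr; have wNr : (- w) ^+ r = - w.
  apply/eqP; rewrite -addr_eq0 addrC -{1}wr -frobenius_sqrtD subrr expr0n.
  by case: r r1.
have -> : (\sum_(z : F) (w + z ^+ r.+1 == 0)%R = #|[set z | (z ^+ r.+1 == - w)%R]|)%N.
  rewrite -sum1dep_card [RHS]big_mkcond; apply: eq_bigr => z _.
  by rewrite addrC addr_eq0; case: eqP.
have [->|w0] := eqVneq w 0; last by rewrite card_norm_fibre // oppr_eq0.
by rewrite -(cards1 (0 : F)); apply: eq_card => z; rewrite !inE oppr0 expf_eq0.
Qed.

Lemma example_hermitian :
  exists C : {mpoly F[3]}, [/\ is_plane_curve (r + 1) C, nonsingular C & num_points C = (r + 1 - 1) * q + 1]%N.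
Proof.
have q1 := card_field_gt1 F.
have hX (i : 'I_3) : ('X_i ^+ r.+1 : {mpoly F[3]}) \is (r + 1).-homog.
  by rewrite -[(r + 1)%N]mul1n addn1; apply: dhomogMn; rewrite dhomogX /= mdeg1.
have hC : poly_of (Var F 0 ^+ r.+1 + Var F 1 ^+ r.+1 + Var F 2 ^+ r.+1)%curve \is (r + 1).-homog.
  by apply: rpredD; first apply: rpredD.
apply: (example_intro _ hC) => //; first by rewrite addn1.
  apply: nonsingular_intro => V _ dC; have := dC 0; have := dC 1; have := dC 2.
  have r0 : r%:R = 0 :> L.
    by have /eqP := natr_card_closure F; rewrite -rq natrX sqrf_eq0 => /eqP.
  have [m rE] : exists m, r = m.+1 by case: r r1 => // m; exists m.
  rewrite /= -natr1 r0 add0r !(mul1r, mulr0, mulr1, add0r, addr0) rE.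
  by move=> /exp_eq0 z0 /exp_eq0 y0 /exp_eq0 x0.
apply: (num_points_eq (B := fun a b c => a ^+ r.+1 + b ^+ r.+1 + c ^+ r.+1 == 0) _ hC) => // [|a b c|].
- by rewrite addn1.
- by rewrite meval_poly_of /= /coords !vecE.
(* The number of c is r + 1, or 1 if the first two norms cancel; the additive form can be summed
   over b and a without truncated subtraction. *)
have inner (a b : F) : (\sum_c (a ^+ r.+1 + b ^+ r.+1 + c ^+ r.+1 == 0)%R
    + r * (a ^+ r.+1 + b ^+ r.+1 == 0)%R = r.+1)%N.
  rewrite sum_norm_eq; last by rewrite frobenius_sqrtD !norm_fixed.
  by case: eqP; rewrite ?muln1 ?muln0 ?addn0 ?add1n.
have middle (a : F) : (\sum_b \sum_c (a ^+ r.+1 + b ^+ r.+1 + c ^+ r.+1 == 0)%R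
    + r * (if (a == 0)%R then 1 else r.+1) = q * r.+1)%N.
  have -> : ((if (a == 0)%R then 1 else r.+1) = \sum_b (a ^+ r.+1 + b ^+ r.+1 == 0)%R)%N.
    by rewrite sum_norm_eq ?norm_fixed // expf_eq0.
  by rewrite big_distrr -big_split /= -sum_const; apply: eq_bigr => b _; apply: inner.
have main (a : F) : (\sum_b \sum_c (a ^+ r.+1 + b ^+ r.+1 + c ^+ r.+1 == 0)%R
    = q * r.+1 - r * (if (a == 0)%R then 1 else r.+1))%N by rewrite -(middle a) addnK.
rewrite (sum_nonzero (n := q * r.+1 - r * r.+1)%N) => [|a a0]; last by rewrite main (negPf a0).
rewrite main eqxx; move: r1; rewrite -rq; clear; case: r => // n _.
have -> : (n.+1 ^ 2 = (n * n + 2 * n).+1)%N by rewrite expnS expn1; lia.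
have -> : ((n * n + 2 * n).+1 * n.+2 - n.+1 * n.+2 = n * n.+1 * n.+2)%N by nia.
have -> : ((n * n + 2 * n).+1 * n.+2 - n.+1 * 1 = n * n.+1 * n.+2 + n.+1 * n.+1)%N by nia.
by rewrite addnK -pred_Sn; lia.
Qed.

End Hermitian.

(** * A nonsingular curve of degree q + 2 through all rational points *)

Section SpaceFillingCurve.

Variable F : finFieldType.
Local Notation q := #|F|.
Local Notation L := (alg_closure F).
Local Notation iota := (to_alg_closure F).
Local Notation V3 := 'rV[L]_3.

(** In every characteristic t - t^3 takes the value 0 at both 0 and 1, so on a finite field it is
    not injective and hence not surjective. *)
Lemma artin_schreier_like_nonroot : exists c : F, forall t, t ^+ 3 - t + c != 0.
Proof.
apply: NNPP => none.
have surj c : exists t : F, t - t ^+ 3 = c.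
  apply: NNPP => nc; apply: none; exists c => t; apply/eqP => tc; apply: nc; exists t.
  by apply/eqP; rewrite -subr_eq0 -oppr_eq0 !opprB addrA addrAC; apply/eqP; rewrite -[RHS]tc; ring.
have /imset_injP inj : #|[set t - t ^+ 3 | t in [set: F]]| == #|[set: F]|.
  apply/eqP/eq_card => x; rewrite [RHS]inE; have [t <-] := surj x.
  by apply/imsetP; exists t; rewrite ?inE.
have := inj 0 1 (in_setT _) (in_setT _); rewrite expr0n expr1n !subrr => /(_ erefl)/eqP.
by rewrite eq_sym oner_eq0.
Qed.

Lemma fixed_rational (x : L) : x ^+ q = x -> exists t, x = iota t.
Proof.
move=> xq; have := congr1 (fun p => (map_poly iota p).[x]) (finField_genPoly F).
rewrite rmorphB /= map_polyXn map_polyX !hornerE xq subrr rmorph_prod horner_prod => /esym/eqP.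
rewrite prodf_seq_eq0 => /hasP[t _] /=; rewrite map_polyXsubC hornerXsubC subr_eq0 => /eqP->.
by exists t.
Qed.

Definition frob (u : V3) : V3 := \row_i u 0 i ^+ q.

Lemma frobE u i : frob u 0 i = u 0 i ^+ q.
Proof. by rewrite mxE. Qed.

Lemma frob_add (x y : L) : (x + y) ^+ q = x ^+ q + y ^+ q.
Proof. exact: (exprD_card iota). Qed.

Lemma frob_opp (x : L) : (- x) ^+ q = - x ^+ q.
Proof.
apply/eqP; rewrite -addr_eq0 -frob_add addNr expr0n gtn_eqF //.
exact: ltnW (card_field_gt1 F).
Qed.

Lemma frob_iota (c : F) : iota c ^+ q = iota c.
Proof. by rewrite -rmorphXn expf_card. Qed.

Lemma frobZ a u : frob (a *: u) = a ^+ q *: frob u.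
Proof. by apply/rowP => i; rewrite !mxE exprMn. Qed.

Lemma frobD u v : frob (u + v) = frob u + frob v.
Proof. by apply/rowP => i; rewrite !mxE frob_add. Qed.

Lemma frob_cross u v : frob (cross u v) = cross (frob u) (frob v).
Proof. by apply: row3P; rewrite frobE !crossE !frobE frob_add frob_opp !exprMn. Qed.

Lemma frob_eq0 u : frob u = 0 -> u = 0.
Proof.
move=> u0; apply/rowP => i; have := congr1 (fun w : V3 => w 0 i) u0.
by rewrite !mxE => /eqP; rewrite expf_eq0 => /andP[_ /eqP].
Qed.

Variable c : F.
Hypothesis c_nonroot : forall t, t ^+ 3 - t + c != 0.

(* The companion matrix of [t^3 - t + c] and its transpose. *)
Definition companion (u : V3) : V3 := \row_i [:: - iota c * u 0 2; u 0 0 + u 0 2; u 0 1]`_i.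
Definition companionT (u : V3) : V3 := \row_i [:: u 0 1; u 0 2; - iota c * u 0 0 + u 0 1]`_i.

Lemma companionE u : (companion u 0 0 = - iota c * u 0 2) * (companion u 0 1 = u 0 0 + u 0 2)
  * (companion u 0 2 = u 0 1).
Proof. by rewrite !mxE. Qed.

Lemma companionTE u : (companionT u 0 0 = u 0 1) * (companionT u 0 1 = u 0 2)
  * (companionT u 0 2 = - iota c * u 0 0 + u 0 1).
Proof. by rewrite !mxE. Qed.

Lemma dot_companion u v : dot (companionT u) v = dot u (companion v).
Proof. by rewrite /dot !companionE !companionTE; ring. Qed.

Lemma companionZ a u : companion (a *: u) = a *: companion u.
Proof. by apply: row3P; rewrite [RHS]mxE !companionE !mxE; ring. Qed.

Lemma companionTZ a u : companionT (a *: u) = a *: companionT u.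
Proof. by apply: row3P; rewrite [RHS]mxE !companionTE !mxE; ring. Qed.

Lemma frob_companion u : frob (companion u) = companion (frob u).
Proof.
by apply: row3P; rewrite frobE !companionE !frobE ?frob_add // exprMn frob_opp frob_iota.
Qed.

Lemma frob_companionT u : frob (companionT u) = companionT (frob u).
Proof.
by apply: row3P; rewrite frobE !companionTE !frobE ?frob_add // exprMn frob_opp frob_iota.
Qed.

Lemma eigenvector_companion u a : companion u = a *: u ->
  u 0 0 = (a ^+ 2 - 1) * u 0 2 /\ u 0 1 = a * u 0 2.
Proof.
move=> E; have E1 := congr1 (fun w : V3 => w 0 1) E; have E2 := congr1 (fun w : V3 => w 0 2) E.
rewrite /= companionE mxE in E1; rewrite /= companionE mxE in E2.
by split=> //; rewrite mulrBl mul1r expr2 -mulrA -E2 -E1 addrK.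
Qed.

Lemma eigenvalue_companion u a : u != 0 -> companion u = a *: u -> a ^+ 3 - a + iota c = 0.
Proof.
move=> u0 E; have [ux uy] := eigenvector_companion E.
have E0 := congr1 (fun w : V3 => w 0 0) E; rewrite /= companionE mxE ux in E0.
have z0 : u 0 2 != 0.
  by apply: contraNneq u0 => z0; apply/eqP/row3P; rewrite [RHS]mxE ?ux ?uy z0 ?mulr0.
apply: (mulIf z0); rewrite mul0r.
transitivity (a * ((a ^+ 2 - 1) * u 0 2) - - iota c * u 0 2); first ring.
by rewrite E0 subrr.
Qed.

Lemma eigenvector_companionT u a : companionT u = a *: u -> u 0 1 = a * u 0 0.
Proof. by move/(congr1 (fun w : V3 => w 0 0)); rewrite /= companionTE mxE. Qed.

Lemma eigenvalue_companionT u a : u != 0 -> companionT u = a *: u -> a ^+ 3 - a + iota c = 0.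
Proof.
move=> u0 E.
have E0 := congr1 (fun w : V3 => w 0 0) E; rewrite /= companionTE mxE in E0.
have E1 := congr1 (fun w : V3 => w 0 1) E; rewrite /= companionTE mxE E0 in E1.
have E2 := congr1 (fun w : V3 => w 0 2) E; rewrite /= companionTE mxE E0 E1 in E2.
have z0 : u 0 0 != 0.
  by apply: contraNneq u0 => z0; apply/eqP/row3P; rewrite [RHS]mxE ?E1 ?E0 z0 ?mulr0.
apply: (mulIf z0); rewrite mul0r.
transitivity (a * (a * (a * u 0 0)) - (- iota c * u 0 0 + a * u 0 0)); first ring.
by rewrite E2 subrr.
Qed.

Lemma root_not_fixed (a : L) : a ^+ 3 - a + iota c = 0 -> a ^+ q != a.
Proof.
move=> aroot; apply/eqP => /fixed_rational[t at_]; have := c_nonroot t.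
by rewrite -(fmorph_eq0 iota) rmorphD rmorphB rmorphXn /= -at_ aroot eqxx.
Qed.

(** With A = [companion] and n = P x P^q, the equation of the curve is n . A P. Since q-th powers
    have zero derivatives, its gradient is A^T n - A P x P^q, so the hypotheses describe a singular
    point. Each case produces an eigenvalue of A, a root of t^3 - t + c, that is forced to be
    rational or a multiple root. *)
Lemma space_filling_regular (P : V3) :
    dot (cross P (frob P)) (companion P) = 0 ->
    companionT (cross P (frob P)) = cross (companion P) (frob P) ->
  P = 0.
Proof.
set n := cross P (frob P) => nAP sing; apply/eqP/contraT => P0.
have [n0|n0] := eqVneq n 0.
  (* Here [P] is proportional to its Frobenius image and the gradient condition makes it an
     eigenvector of A; applying Frobenius shows the eigenvalue to be rational. *)
  have [l E] := cross_eq0P P0 n0.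
  have l0 : l != 0.
    apply: contraNneq P0 => l0; apply/eqP/frob_eq0; by rewrite E l0 scale0r.
  have AP : cross P (companion P) = 0.
    apply/eqP; have : companionT n = 0 by apply: row3P; rewrite companionTE n0 !mxE ?mulr0 ?addr0.
    rewrite sing E crossZr crossC scalerN => /eqP; rewrite oppr_eq0 scaler_eq0 (negPf l0) //.
  have [a aE] := cross_eq0P P0 AP.
  have := eigenvalue_companion P0 aE => /root_not_fixed/eqP[]; apply/eqP.
  have := frob_companion P; rewrite aE frobZ E companionZ aE !scalerA => /eqP.
  rewrite -subr_eq0 -scalerBl scaler_eq0 (negPf P0) orbF subr_eq0 [l * a]mulrC.
  by rewrite (inj_eq (mulIf l0)).
have [a [b AP]] := line_span n0 nAP.
have ATn : companionT n = a *: n.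
  by rewrite sing AP crossC crossDr !crossZr crossvv scaler0 addr0 -/n [cross (frob P) P]crossC scalerN opprK.
have aroot := eigenvalue_companionT n0 ATn.
(* If b is nonzero, [n] is orthogonal to A P^q = (A P)^q and so to the second Frobenius image of
   [P]. Then [n] is proportional to its own Frobenius image, and its eigenvalue a is rational. *)
have [b0|b0] := eqVneq b 0; last first.
  have nP2 : dot n (frob (frob P)) = 0.
    have : dot n (companion (frob P)) = 0 by rewrite -dot_companion ATn dotZl dotC dot_crossr mulr0.
    rewrite -frob_companion AP frobD !frobZ dotDr !dotZr [dot n (frob P)]dotC dot_crossr mulr0 add0r.
    by move/eqP; rewrite mulf_eq0 expf_eq0 (negPf b0) andbF => /eqP.
  have [s [t E]] := line_span n0 nP2.
  have fn : frob n = - s *: n.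
    by rewrite frob_cross E crossDr !crossZr crossvv scaler0 addr0 crossC scalerN scaleNr.
  have s0 : - s != 0.
    by apply: contraNneq n0 => s0; apply/eqP/frob_eq0; rewrite fn s0 scale0r.
  have := root_not_fixed aroot; have := frob_companionT n.
  rewrite ATn frobZ fn companionTZ ATn !scalerA => /eqP.
  rewrite -subr_eq0 -scalerBl scaler_eq0 (negPf n0) orbF subr_eq0 [- s * a]mulrC.
  by rewrite (inj_eq (mulIf s0)) => ->.
(* Now [P] and [n] are right and left eigenvectors for the same a and are orthogonal, so a must be a
   double root. The third root is a^q, and the root sum 0 explains a^q = -2 a in [alpha], computed
   here from explicit eigenvectors. *)
rewrite b0 scale0r addr0 in AP; have anf := root_not_fixed aroot.
have AP1 : companion (frob P) = a ^+ q *: frob P by rewrite -frob_companion AP frobZ.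
have aq_root : (a ^+ q) ^+ 3 - a ^+ q + iota c = 0.
  by apply: eigenvalue_companion AP1; apply: contraNneq P0 => /frob_eq0->.
have [x0 y0] := eigenvector_companion AP; have [x1 y1] := eigenvector_companion AP1.
have n0E : n 0 1 = a * n 0 0 := eigenvector_companionT ATn.
have z0 : P 0 2 != 0.
  by apply: contraNneq P0 => z0; apply/eqP/row3P; rewrite [RHS]mxE ?x0 ?y0 z0 ?mulr0.
have z1 : frob P 0 2 != 0 by rewrite frobE expf_neq0.
have alpha : a ^+ q = - (a + a).
  have /eqP : P 0 2 * frob P 0 2 * ((a - a ^+ q) * (a ^+ q + (a + a))) = 0.
    transitivity (a * n 0 0 - n 0 1); last by rewrite n0E subrr.
    by rewrite /n !crossE x0 y0 x1 y1; ring.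
  rewrite !mulf_eq0 (negPf z0) (negPf z1) subr_eq0 eq_sym (negPf anf) /= addr_eq0.
  by move/eqP.
have c0 : iota c != 0.
  by have := c_nonroot 0; rewrite expr0n /= subr0 add0r fmorph_eq0.
have three0 : (3%:R : L) != 0.
  apply: contraNneq anf => three0; rewrite alpha; apply/eqP.
  transitivity (a - 3%:R * a); [ring | by rewrite three0 mul0r subr0].
have a0 : a != 0.
  by apply: contraNneq c0 => a0; rewrite a0 expr0n subr0 add0r in aroot; apply/eqP.
have a2 : 3%:R * a ^+ 2 = 1.
  have /eqP : 3%:R * (a * (1 - 3%:R * a ^+ 2)) = 0.
    transitivity ((a ^+ q) ^+ 3 - a ^+ q + iota c - (a ^+ 3 - a + iota c)); last by rewrite aroot aq_root subrr.
    by rewrite alpha; ring.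
  by rewrite !mulf_eq0 (negPf three0) (negPf a0) subr_eq0 => /eqP.
(* Frobenius applied to 3 a^2 = 1; with a^q = -2 a the left side is also 12 a^2 = 4, so 3 = 0, which
   was excluded. *)
have : 3%:R * (a ^+ q) ^+ 2 = 1.
  have three_q : 3%:R ^+ q = 3%:R :> L by rewrite -(rmorph_nat iota) frob_iota.
  by rewrite -{1}three_q -exprM mulnC exprM -exprMn a2 expr1n.
move/eqP; rewrite alpha (_ : 3%:R * _ = 1 + 3%:R); last first.
  by transitivity (3%:R * a ^+ 2 *+ 4); [ring | rewrite a2; ring].
by rewrite -subr_eq0 addrAC subrr add0r (negPf three0).
Qed.

Local Notation X := (Var F 0).
Local Notation Y := (Var F 1).
Local Notation Z := (Var F 2).

(** The polynomial is the product of A P with P x P^q written out; at a rational vector P^q = P, so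
    the cross product vanishes. *)
Lemma example_card_succ_succ :
  exists C : {mpoly F[3]}, [/\ is_plane_curve (q + 2) C, nonsingular C & num_points C = (q + 2 - 1) * q + 1]%N.
Proof.
have q1 := card_field_gt1 F.
have hX (i : 'I_3) : ('X_i : {mpoly F[3]}) \is 1.-homog by rewrite dhomogX /= mdeg1.
have hXq (i : 'I_3) : ('X_i ^+ q : {mpoly F[3]}) \is q.-homog.
  by rewrite -{2}[q]mul1n; apply: dhomogMn.
have hM d e (f g : {mpoly F[3]}) : f \is d.-homog -> g \is e.-homog -> f * g \is (d + e).-homog.
  by move=> hf hg; apply: dhomogM.
have cross_h (i j : 'I_3) : ('X_i * 'X_j ^+ q - 'X_j * 'X_i ^+ q : {mpoly F[3]}) \is (1 + q).-homog.
  by apply: rpredB; apply: hM.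
have hC : poly_of (- (Cst c * Z) * (Y * Z ^+ q - Z * Y ^+ q) + (X + Z) * (Z * X ^+ q - X * Z ^+ q)
    + Y * (X * Y ^+ q - Y * X ^+ q))%curve \is (q + 2).-homog.
  rewrite /poly_of /= mul_mpolyC.
  rewrite addnC -[2%N]/(1 + 1)%N -addnA; apply: rpredD; first apply: rpredD.
  - by apply: hM (cross_h _ _); rewrite rpredN; apply: rpredZ.
  - by apply: hM (cross_h _ _); apply: rpredD.
  - exact: hM (cross_h _ _).
apply: (example_intro _ hC) => //; first by rewrite addn2.
  apply: nonsingular_intro => V; pose P : V3 := \row_i V i.
  rewrite /= => C0 dC; have q0 := natr_card_closure F.
  suff P0 : P = 0.
    by split; [have := congr1 (fun w : V3 => w 0 0) P0 | have := congr1 (fun w : V3 => w 0 1) P0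
              | have := congr1 (fun w : V3 => w 0 2) P0]; rewrite !mxE.
  have PE : (P 0 0 = V 0) * (P 0 1 = V 1) * (P 0 2 = V 2) by rewrite !mxE.
  apply: space_filling_regular.
    by rewrite -[RHS]C0 /dot !companionE !crossE !frobE !PE; ring.
  apply: row3P; rewrite companionTE !crossE !companionE !frobE !PE.
  - have := dC 0; rewrite /= q0 !mul0r => E.
    by apply/eqP; rewrite -subr_eq0 -[X in _ == X]E; apply/eqP; ring.
  - have := dC 1; rewrite /= q0 !mul0r => E.
    by apply/eqP; rewrite -subr_eq0 -[X in _ == X]E; apply/eqP; ring.
  - have := dC 2; rewrite /= q0 !mul0r => E.
    by apply/eqP; rewrite -subr_eq0 -[X in _ == X]E; apply/eqP; ring.
apply: (num_points_eq (B := fun _ _ _ => true) _ hC) => // [|x y z|].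
- by rewrite addn2.
- by rewrite meval_poly_of /= /coords !vecE !expf_card; apply/eqP; ring.
by rewrite !sum_const; move: q1; move: (q); clear; case=> // n; nia.
Qed.

End SpaceFillingCurve.

Local Close Scope ring_scope.

Theorem theorem2 (q : nat) (F : finFieldType) (hq : #|F| = q) :
  (forall (d : nat) (C : {mpoly F[3]}),
      is_plane_curve d C -> nonsingular C -> no_linear_component C ->
      ~ (q = 4 /\ proj_equiv C (exceptional_quartic F)) ->
      num_points C <= (d - 1) * q + 1)
  /\
  (forall d : nat,
      (2 <= d /\ d \in [:: q + 2; q + 1; q; q - 1; 2])
      \/ (exists r : nat, r ^ 2 = q /\ d = r + 1) ->
      exists C : {mpoly F[3]},
        [/\ is_plane_curve d C, nonsingular C
          & num_points C = (d - 1) * q + 1]).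
Proof.
subst q; split=> [d C|d]; first exact: sziklai_bound.
case=> [[d2]|[r [rq ->]]]; last exact: example_hermitian rq.
rewrite !inE => /or4P[/eqP->|/eqP->|/eqP->|/orP[/eqP dE|/eqP->]].
- have [c hc] := artin_schreier_like_nonroot F; exact: example_card_succ_succ hc.
- exact: example_card_succ.
- exact: example_card.
- by rewrite dE; apply: example_card_pred; move: d2; rewrite dE; case: #|F| => [|[|[|]]].
- exact: example_conic.
Qed.
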